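(* Let $m,n\ge 1$. For $v\in\{0,1,\dots,m\}^n$ and $1\le k\le m-1$ we have $$\mathbf X\,\mathbf C^{(m)}_{kv}\simeq t^{\#\{i\,:\,v_i<k\}}\,\mathbf C^{(m)}_{v(k-1)}\,\mathbf X$$ in $\mathcal K^b(\mathrm{SBim}_{n+1})$, where $\mathbf X=\mathbf X_{n+1}$, juxtaposition of complexes is $\otimes$, and $kv$, $v(k-1)$ denote concatenated sequences.
   Context: Soergel bimodules and Rouquier complexes. $R=R_n=\mathbb{Z}[x_1,\dots,x_n]$ is graded by $\deg x_i=2$. Graded shift: $B(1)_d=B_{d+1}$. Complexes have differentials of degree $+1$; homological shift: $C[1]_k=C_{k+1}$, $d_{C[1]}=-d_C$. Put $B_i=R\otimes_{R^{s_i}}R(1)$ for $1\le i\le n-1$, where $s_i$ swaps $x_i,x_{i+1}$. $\mathrm{SBim}_n$ is the smallest full subcategory of graded $(R,R)$-bimodules (with degree zero maps) containing $R,B_1,\dots,B_{n-1}$ and closed under $\otimes=\otimes_R$, finite direct sums, grading shifts and direct summands. $\mathcal K^b(\mathrm{SBim}_n)$ (resp. $\mathcal K^-(\mathrm{SBim}_n)$) is the homotopy category of bounded (resp. bounded above) complexes. $\mathrm{Br}_n$ is the braid group, with generators $\sigma_1,\dots,\sigma_{n-1}$ (positive crossings). The Rouquier complex $F(\beta)$ of $\beta\in \mathrm{Br}_n$ is defined by $F(\sigma_i)=(B_i\to R(1))$, $F(\sigma_i^{-1})=(R(-1)\to B_i)$ with $B_i$ in homological degree $0$ and differentials $f\otimes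 g\mapsto fg$, respectively $1\mapsto x_i\otimes 1-1\otimes x_{i+1}$, and $F(\beta\beta')\simeq F(\beta)\otimes F(\beta')$. Braids are identified with their Rouquier complexes. $\sqcup$ is the external tensor product $\otimes_{\mathbb Z}$, $\mathrm{SBim}_k\times\mathrm{SBim}_l\to\mathrm{SBim}_{k+l}$, extended to complexes; $\mathbb 1_k=R_k$. Shift functors: $qC=C(-2)$, $tC=C(2)[-2]$, $t^{1/2}C=C(1)[-1]$. $\mathbf X_n=t^{(1-n)/2}F(\sigma_{n-1}\cdots\sigma_2\sigma_1)$. Symmetrizers. $\mathbf P_n\in\mathcal K^-(\mathrm{SBim}_n)$ is the categorified Young symmetrizer, characterized up to homotopy equivalence by: (i) $B_i\otimes\mathbf P_n\simeq0\simeq\mathbf P_n\otimes B_i$ for $1\le i\le n-1$; (ii) there is a chain map $R\to\mathbf P_n$ whose cone is homotopy equivalent to a bounded above complex with chain bimodules direct sums of shifts of $B_{i_1}\otimes\cdots\otimes B_{i_r}$, $r\ge1$. The group of homotopy classes of chain maps $qt^{1-n}\mathbf P_n\to\mathbf P_n$ is infinite cyclic; let $u_n$ be a generator. $\mathbf Q_n:=t^{n-1}\mathrm{Cone}(u_n:qt^{1-n}\mathbf P_n\to\mathbf P_n)$, which is homotopy equivalent to a bounded complex, and $\mathbf K_n:=(\mathbf Q_1\sqcup\mathbb 1_{n-1})\otimes(\mathbf Q_2\sqcup\mathbb 1_{n-2})\otimes\cdots\otimes\mathbf Q_n$ ($\mathbf K_0$ is trivial). The complexes $\mathbf C^{(m)}_v$.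 $\mathrm{FT}_n=(\sigma_{n-1}\cdots\sigma_2\sigma_1)^n$ is the full twist. For $v\in\{0,\dots,m\}^n$ let $r_j=\#\{i:v_i=j\}$. Let $\gamma_v=\sigma_{i_1}\cdots\sigma_{i_s}$, where successively exchanging the entries in positions $(i_1,i_1+1),\dots,(i_s,i_s+1)$ of $v$, each time exchanging adjacent entries $x,y$ with $x>y$, turns $v$ into the weakly increasing sequence $(0^{r_0},1^{r_1},\dots,m^{r_m})$; let $\omega\gamma_v=\sigma_{i_s}\cdots\sigma_{i_1}$. Then, omitting $\otimes$, $$\mathbf C_v^{(m)}=\gamma_v(\mathbf K_{r_0+\cdots+r_{m-1}}\sqcup\mathrm{FT}_{r_m})(\mathbb 1_{r_0+\cdots+r_{m-2}}\sqcup\mathrm{FT}_{r_{m-1}+r_m})\cdots(\mathbb 1_{r_0}\sqcup\mathrm{FT}_{r_1+\cdots+r_m})(\omega\gamma_v).$$ *)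

(* Defs.v *)
From HB Require Import structures.
From mathcomp Require Import all_boot all_order perm all_algebra.
From mathcomp Require Import boolp.
From mathcomp Require Import freeg mpoly.

Set Implicit Arguments.
Unset Strict Implicit.
Unset Printing Implicit Defensive.

Import Order.TTheory GRing.Theory Num.Theory.
Local Open Scope ring_scope.
Local Open Scope quotient_scope.

Notation Rn n := {mpoly int[n]}.

Section Additive.
Context {U V : zmodType} (f : U -> V).
Definition addmap := {morph f : x y / x + y}.

Lemma addmap_sub : {morph f : x y / x - y} -> addmap.
Proof.
move=> fB; have f0 : f 0 = 0 by rewrite -(subrr 0) fB subrr.
have fN x : f (- x) = - f x by rewrite -sub0r fB f0 sub0r.
by move=> x y; rewrite -{1}[y]opprK fB fN opprK.
Qed.

Hypothesis fD : addmap.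

Lemma addmap0 : f 0 = 0.
Proof. by apply: (addrI (f 0)); rewrite -fD !addr0. Qed.

Lemma addmapN x : f (- x) = - f x.
Proof. by apply: (addrI (f x)); rewrite -fD !subrr addmap0. Qed.

Lemma addmapB x y : f (x - y) = f x - f y.
Proof. by rewrite fD addmapN. Qed.

Lemma addmap_sum (I : Type) (s : seq I) (P : pred I) (F : I -> U) :
  f (\sum_(i <- s | P i) F i) = \sum_(i <- s | P i) f (F i).
Proof. exact: (big_morph f fD addmap0). Qed.

Lemma addmapMn x m : f (x *+ m) = f x *+ m.
Proof. by elim: m => [|m IH]; rewrite ?mulr0n ?addmap0 // !mulrS fD IH. Qed.

Lemma addmapMz x (z : int) : f (x *~ z) = f x *~ z.
Proof. by case: z => m; rewrite /intmul ?addmapN addmapMn. Qed.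
End Additive.

(* Z-gradings: [p d x] is the component of degree [d] of [x], so the piece
   of degree [d] is {x | p d x = x}. *)
Record is_grading (M : zmodType) (p : int -> M -> M) : Prop := IsGrading {
  gradD : forall d, addmap (p d);
  gradK : forall d e x, p d (p e x) = if d == e then p e x else 0;
  gradE : forall x, exists2 s : seq int, uniq s & x = \sum_(d <- s) p d x }.

Section Grading.
Context {M : zmodType} (p : int -> M -> M).
Hypothesis pG : is_grading p.

Definition gsupp (x : M) : seq int := projT1 (cid2 (gradE pG x)).

Lemma gsupp_uniq x : uniq (gsupp x).
Proof. by rewrite /gsupp; case: (cid2 _). Qed.

Lemma gsuppE x : x = \sum_(d <- gsupp x) p d x.
Proof. by rewrite /gsupp; case: (cid2 _). Qed.

Lemma gsupp_out x d : d \notin gsupp x -> p d x = 0.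
Proof.
move=> dx; rewrite {1}(gsuppE x) (addmap_sum (gradD pG d)) big1_seq // => e /andP[_ ex].
by rewrite (gradK pG) ; case: eqP dx ex => // -> /negP.
Qed.

Section FinSum.
Context {V : zmodType} (F : int -> M -> V).
Hypothesis FD : forall d, addmap (F d).

(* sum over all d of F d (p d x) *)
Definition gfold x : V := \sum_(d <- gsupp x) F d (p d x).

Lemma gfoldE s x : uniq s -> (forall d, d \notin s -> p d x = 0) ->
  gfold x = \sum_(d <- s) F d (p d x).
Proof.
move=> us hs; rewrite /gfold.
have H (t t' : seq int) : (forall d, d \notin t' -> p d x = 0) ->
  \sum_(d <- t) F d (p d x) = \sum_(d <- t | d \in t') F d (p d x).
  move=> ht; rewrite (bigID (mem t')) /= [X in _ + X]big1 ?addr0 // => d dt.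
  by rewrite ht // (addmap0 (FD d)).
rewrite (H (gsupp x) s hs) (H s (gsupp x)); last by move=> d; exact: gsupp_out.
rewrite -big_filter -[RHS]big_filter; apply: perm_big.
apply: uniq_perm; rewrite ?filter_uniq ?gsupp_uniq // => d.
by rewrite !mem_filter andbC.
Qed.

Lemma gfoldD : addmap gfold.
Proof.
move=> x y; set s := undup (gsupp x ++ gsupp y).
have h z : {subset gsupp z <= s} -> forall d, d \notin s -> p d z = 0.
  by move=> zs d ds; apply: gsupp_out; apply: contra ds; exact: zs.
have hx : forall d, d \notin s -> p d x = 0.
  by apply: h => d; rewrite mem_undup mem_cat => ->.
have hy : forall d, d \notin s -> p d y = 0.
  by apply: h => d; rewrite mem_undup mem_cat => ->; rewrite orbT.
rewrite !(@gfoldE s) ?undup_uniq //.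
  by rewrite -big_split; apply: eq_bigr => d _; rewrite (gradD pG) FD.
by move=> d ds; rewrite (gradD pG) hx // hy // addr0.
Qed.

Lemma gfold_hom e x : gfold (p e x) = F e (p e x).
Proof.
rewrite (@gfoldE [:: e]) // ?big_seq1 ?(gradK pG) ?eqxx // => d.
by rewrite inE (gradK pG) => /negPf->.
Qed.
End FinSum.

Lemma gext (V : zmodType) (f g : M -> V) : addmap f -> addmap g ->
  (forall e x, f (p e x) = g (p e x)) -> forall x, f x = g x.
Proof.
move=> fD gD fg x; rewrite (gsuppE x) (addmap_sum fD) (addmap_sum gD).
by apply: eq_bigr => d _.
Qed.

Lemma gfold0 (V : zmodType) (F : int -> M -> V) x :
  (forall d y, F d y = 0) -> gfold F x = 0.
Proof. by move=> F0; rewrite /gfold big1. Qed.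

End Grading.

Section FinSupp.
Context {M : zmodType} (p : int -> M -> M).
Hypothesis pD : forall d, addmap (p d).
Hypothesis pK : forall d e x, p d (p e x) = if d == e then p e x else 0.

Definition finsupp_at x := exists2 s : seq int, uniq s & x = \sum_(d <- s) p d x.

Lemma finsupp0 : finsupp_at 0.
Proof. by exists [::] => //; rewrite big_nil. Qed.

Lemma finsupp_hom d x : p d x = x -> finsupp_at x.
Proof. by move=> dx; exists [:: d]; rewrite // big_seq1. Qed.

Lemma finsuppD x y : finsupp_at x -> finsupp_at y -> finsupp_at (x + y).
Proof.
have H z (s t : seq int) : z = \sum_(d <- s) p d z -> uniq s -> uniq t ->
    {subset s <= t} -> z = \sum_(d <- t) p d z.
  move=> zE us ut st; rewrite {1}zE.
  have -> : \sum_(d <- t) p d z = \sum_(d <- t | d \in s) p d z.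
    rewrite (bigID (mem s)) /= [X in _ + X]big1 ?addr0 // => d ds.
    rewrite zE (addmap_sum (pD d)) big1_seq // => e /andP[_ es].
    by rewrite pK; case: eqP ds es => // -> /negP.
  rewrite -[RHS]big_filter; apply: perm_big; apply: uniq_perm => //.
    exact: filter_uniq.
  by move=> d; rewrite mem_filter; case ds: (d \in s) => //=; rewrite st.
case=> s us xE [t ut yE]; exists (undup (s ++ t)); first exact: undup_uniq.
rewrite {1}(H x s (undup (s ++ t)) xE us (undup_uniq _)); last first.
  by move=> d; rewrite mem_undup mem_cat => ->.
rewrite {1}(H y t (undup (s ++ t)) yE ut (undup_uniq _)); last first.
  by move=> d; rewrite mem_undup mem_cat => ->; rewrite orbT.
by rewrite -big_split; apply: eq_bigr => d _; rewrite /= pD.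
Qed.

Lemma finsupp_sum (I : Type) (s : seq I) (F : I -> M) :
  (forall i, finsupp_at (F i)) -> finsupp_at (\sum_(i <- s) F i).
Proof.
move=> h; elim: s => [|i s IH]; rewrite ?big_nil ?big_cons; first exact: finsupp0.
exact: finsuppD.
Qed.
End FinSupp.

(* The tensor product of abelian groups M and N balanced over a family of
   operators: the quotient of the free abelian group on M x N by the
   subgroup generated by the biadditivity relations and by
   (al a m, n) - (m, be a n).  With A = void this is the tensor product
   over Z. *)
Section Tensor.
Variables (M N : zmodType) (A : Type) (al : A -> M -> M) (be : A -> N -> N).

Inductive tens_rel : {freeg (M * N)} -> Prop :=
| TensDl m m' n : tens_rel (<< (m + m', n) >> - << (m, n) >> - << (m', n) >>)
| TensDr m n n' : tens_rel (<< (m, n + n') >> - << (m, n) >> - << (m, n') >>)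
| TensB a m n : tens_rel (<< (al a m, n) >> - << (m, be a n) >>).

Definition tens_ker : pred {freeg (M * N)} := fun x =>
  `[< forall S : pred {freeg (M * N)}, zmod_closed S ->
        (forall r, tens_rel r -> r \in S) -> x \in S >].

Lemma tens_ker_closed : zmod_closed tens_ker.
Proof.
split=> [|x y /asboolP hx /asboolP hy]; apply/asboolP => S Sc hS.
  by case: Sc.
by case: (Sc) => _; apply; [exact: hx | exact: hy].
Qed.
Definition tens_sub : zmodClosed {freeg (M * N)} := HB.pack tens_ker
  (GRing.isZmodClosed.Build {freeg (M * N)} tens_ker tens_ker_closed).

Definition tens : Type := Quotient.quot tens_sub.
HB.instance Definition _ := GRing.Zmodule.copy tens (Quotient.quot tens_sub).

Definition tmk (m : M) (n : N) : tens := \pi_(Quotient.quot tens_sub) << (m, n) >>.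

Lemma tens_rel0 x : tens_rel x -> \pi_(Quotient.quot tens_sub) x = 0.
Proof.
move=> rx; rewrite -(raddf0 \pi_(Quotient.quot tens_sub)).
apply/eqP; rewrite -Quotient.idealrBE subr0.
by apply/asboolP => S _; apply.
Qed.

Lemma tmkDl n : addmap (tmk^~ n).
Proof.
move=> m m'; apply/eqP; rewrite -subr_eq0 opprD addrA /tmk.
by rewrite -!raddfB /= (tens_rel0 (TensDl m m' n)).
Qed.

Lemma tmkDr m : addmap (tmk m).
Proof.
move=> n n'; apply/eqP; rewrite -subr_eq0 opprD addrA /tmk.
by rewrite -!raddfB /= (tens_rel0 (TensDr m n n')).
Qed.

Lemma tmkB a m n : tmk (al a m) n = tmk m (be a n).
Proof.
apply/eqP; rewrite -subr_eq0 /tmk.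
by rewrite -!raddfB /= (tens_rel0 (TensB a m n)).
Qed.

Section Lift.
Context {V : zmodType}.
Variable phi : M -> N -> V.

(* the additive map with value phi m n on the class of (m, n); it is only
   meaningful for phi biadditive and balanced *)
Definition tlift (x : tens) : V :=
  fglift (fun mn : M * N => phi mn.1 mn.2 : zmodule V) (repr x).

Definition balanced := [/\ forall n, addmap (phi^~ n), forall m, addmap (phi m)
  & forall a m n, phi (al a m) n = phi m (be a n)].

Hypothesis bphi : balanced.

Lemma tlift_pi x : tlift (\pi_(Quotient.quot tens_sub) x) =
  fglift (fun mn : M * N => phi mn.1 mn.2 : zmodule V) x.
Proof.
case: bphi => hl hr hb.
set L := fglift _; have LB y z : L (y - z) = L y - L z.
  by have h := lift_is_additive (fun mn : M * N => phi mn.1 mn.2 : zmodule V); exact: h.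
apply/eqP; rewrite -subr_eq0 /tlift -/L -LB.
have : repr (\pi_(Quotient.quot tens_sub) x) - x \in tens_sub.
  by rewrite Quotient.idealrBE reprK.
move/asboolP => /(_ [pred y | L y == 0]); apply.
  split=> [|y z]; rewrite !inE; last move=> /eqP hy /eqP hz.
    by rewrite -(subrr 0) LB subrr.
  by rewrite LB hy hz subrr.
have LU q : L << q >> = phi q.1 q.2 by rewrite /L liftU scale1r.
move=> r [] *; rewrite inE !LB !LU /= ?hl ?hr ?hb ?subrr //.
  by rewrite addrAC addrK subrr.
by rewrite addrAC addrK subrr.
Qed.

Lemma tliftE m n : tlift (tmk m n) = phi m n.
Proof. by rewrite /tmk tlift_pi liftU scale1r. Qed.

Lemma tliftD : addmap tlift.
Proof.
move=> x y; rewrite -[x]reprK -[y]reprK -raddfD /= !tlift_pi.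
apply: (addmap_sub (V := V)).
exact: (lift_is_additive (fun mn : M * N => phi mn.1 mn.2 : zmodule V)).
Qed.
End Lift.

Lemma tens_ind (P : tens -> Prop) : P 0 ->
  (forall x y, P x -> P y -> P (x + y)) ->
  (forall m n, P (tmk m n)) -> forall x, P x.
Proof.
move=> P0 PD PT x; rewrite -[x]reprK -[repr x]freeg_sumE.
rewrite raddf_sum; apply: (big_ind P) => // -[m n] _.
set c := coeff _ _; move: c => c.
suff : P (tmk m n *~ c) by rewrite /tmk -raddfMz freegU_mulz /= intz.
have PMn y k : P y -> P (y *+ k).
  by move=> Py; elim: k => [|k IH]; rewrite ?mulr0n // mulrS; apply: PD.
case: c => k; rewrite /intmul; first exact: PMn.
by rewrite -mulNrn -(addmapN (tmkDl n)); apply: PMn.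
Qed.

Lemma tens_ext (V : zmodType) (f g : tens -> V) : addmap f -> addmap g ->
  (forall m n, f (tmk m n) = g (tmk m n)) -> forall x, f x = g x.
Proof.
move=> fD gD fg; apply: tens_ind => [|x y hx hy|//].
  by rewrite (addmap0 fD) (addmap0 gD).
by rewrite fD gD hx hy.
Qed.
End Tensor.

Section TensorMaps.
Context {M N : zmodType} {A : Type} (al : A -> M -> M) (be : A -> N -> N).
Local Notation T := (tens al be).
Local Notation tm := (tmk al be).

Definition tmap (f : M -> M) (g : N -> N) : T -> T :=
  tlift (fun m n => tm (f m) (g n)).

Definition compat (f : M -> M) (g : N -> N) : Prop :=
  [/\ addmap f, addmap g, forall a m, f (al a m) = al a (f m)
    & forall a n, g (be a n) = be a (g n)].

Lemma compat_bal f g : compat f g ->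
  balanced al be (fun m n => tm (f m) (g n)).
Proof.
case=> fD gD fa ga; split=> [n m m'|m n n'|a m n].
- by rewrite fD tmkDl.
- by rewrite gD tmkDr.
- by rewrite fa ga tmkB.
Qed.

Lemma tmapE f g m n : compat f g -> tmap f g (tm m n) = tm (f m) (g n).
Proof. by move=> /compat_bal h; rewrite /tmap tliftE. Qed.

Lemma tmapD f g : compat f g -> addmap (tmap f g).
Proof. by move=> /compat_bal h; apply: tliftD. Qed.

Lemma compat_comp f g f' g' : compat f g -> compat f' g' ->
  compat (f \o f') (g \o g').
Proof.
move=> [fD gD fa ga] [fD' gD' fa' ga']; split=> [x y|x y|a x|a x] /=.
- by rewrite fD' fD.
- by rewrite gD' gD.
- by rewrite fa' fa.
- by rewrite ga' ga.
Qed.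

Lemma tmap_comp f g f' g' : compat f g -> compat f' g' ->
  forall x, tmap f g (tmap f' g' x) = tmap (f \o f') (g \o g') x.
Proof.
move=> h h'; have h'' := compat_comp h h'; apply: tens_ext.
- by move=> x y; rewrite !tmapD.
- exact: tmapD.
- by move=> m n; rewrite !tmapE.
Qed.

Lemma eq_tmap f g f' g' : f =1 f' -> g =1 g' -> tmap f g =1 tmap f' g'.
Proof.
by move=> /funext-> /funext->.
Qed.

Section TGrading.
Variables (p : int -> M -> M) (q : int -> N -> N).
Hypotheses (pG : is_grading p) (qG : is_grading q).

Hypothesis alD : forall a, addmap (al a).

(* each balancing operator is a finite sum of homogeneous ones *)
Definition gr_balanced := forall a, exists k (s : 'I_k -> A * int),
  [/\ forall m, al a m = \sum_i al (s i).1 m,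
      forall n, be a n = \sum_i be (s i).1 n,
      forall i e m, al (s i).1 (p e m) = p (e + (s i).2) (al (s i).1 m)
    & forall i e n, be (s i).1 (q e n) = q (e + (s i).2) (be (s i).1 n)].

Hypothesis pqB : gr_balanced.

(* the component of degree d of m (x) n is the sum over a of m_a (x) n_(d-a) *)
Definition tgr (d : int) : T -> T :=
  tlift (fun m n => gfold pG (fun a m' => tm m' (q (d - a) n)) m).

Lemma tgr_term_add d n a : addmap (fun m' => tm m' (q (d - a) n)).
Proof. by move=> x y; rewrite tmkDl. Qed.

Lemma tgr_bal d :
  balanced al be (fun m n => gfold pG (fun a m' => tm m' (q (d - a) n)) m).
Proof.
have hl n := gfoldD pG (tgr_term_add d n).
have hr m : addmap (fun n => gfold pG (fun a m' => tm m' (q (d - a) n)) m).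
  move=> n n'; rewrite /gfold -big_split; apply: eq_bigr => a _ /=.
  by rewrite (gradD qG) tmkDr.
split=> // a m n.
have [k [s [sa sb pa qb]]] := pqB a.
rewrite sa (addmap_sum (hl n)) sb (addmap_sum (hr m)).
apply: eq_bigr => i _; set b := (s i).1; set c := (s i).2.
move: m; apply: (gext pG) => [x y|x y|e m].
- by rewrite alD hl.
- by rewrite hl.
rewrite pa !gfold_hom; [|exact: tgr_term_add|exact: tgr_term_add].
rewrite -pa tmkB; congr (tmk _ _ _ _).
by rewrite qb opprD addrA subrK.
Qed.

Lemma tgrD d : addmap (tgr d).
Proof. exact/tliftD/tgr_bal. Qed.

Lemma tgrE d m n :
  tgr d (tm m n) = \sum_(a <- gsupp pG m) tm (p a m) (q (d - a) n).
Proof. by rewrite /tgr (tliftE (tgr_bal d)). Qed.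

Lemma tgr_hom d a m b n : tgr d (tm (p a m) (q b n)) =
  if d == a + b then tm (p a m) (q b n) else 0.
Proof.
rewrite /tgr (tliftE (tgr_bal d)) gfold_hom; last exact: tgr_term_add.
rewrite (gradK qG) subr_eq addrC; case: eqP => // _.
by rewrite (addmap0 (tmkDr _ _ _)).
Qed.

Lemma tens_hom_ext (V : zmodType) (f g : T -> V) : addmap f -> addmap g ->
  (forall a m b n, f (tm (p a m) (q b n)) = g (tm (p a m) (q b n))) ->
  forall x, f x = g x.
Proof.
move=> fD gD fg; apply: tens_ext => // m n.
move: m; apply: (gext pG) => [x y|x y|a m].
- by rewrite tmkDl fD.
- by rewrite tmkDl gD.
move: n; apply: (gext qG) => [x y|x y|b n].
- by rewrite tmkDr fD.
- by rewrite tmkDr gD.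
exact: fg.
Qed.

Lemma tgrK d e x : tgr d (tgr e x) = if d == e then tgr e x else 0.
Proof.
move: x; apply: tens_hom_ext => [x y|x y|a m b n].
- by rewrite !tgrD.
- by rewrite tgrD; case: eqP; rewrite ?addr0.
rewrite tgr_hom; case: (e =P a + b) => [->|_].
  by rewrite tgr_hom.
by rewrite (addmap0 (tgrD d)) if_same.
Qed.

Lemma tgr_grading : is_grading tgr.
Proof.
split; [exact: tgrD|exact: tgrK|].
apply: tens_ind => [|x y|m n]; first exact: finsupp0.
  by apply: finsuppD; [exact: tgrD|exact: tgrK].
rewrite (gsuppE pG m) (gsuppE qG n) (addmap_sum (tmkDl _ _ _)).
apply: finsupp_sum => [||a]; [exact: tgrD|exact: tgrK|].
rewrite (addmap_sum (tmkDr _ _ _)).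
apply: finsupp_sum => [||b]; [exact: tgrD|exact: tgrK|].
by apply: (finsupp_hom (d := a + b)); rewrite tgr_hom eqxx.
Qed.

Lemma tgr_tmap f g (c c' : int) : compat f g ->
  (forall e m, f (p e m) = p (e + c) (f m)) ->
  (forall e n, g (q e n) = q (e + c') (g n)) ->
  forall d x, tmap f g (tgr d x) = tgr (d + (c + c')) (tmap f g x).
Proof.
move=> h fp gq d; apply: tens_hom_ext => [x y|x y|a m b n].
- by rewrite tgrD tmapD.
- by rewrite tmapD // tgrD.
rewrite tgr_hom tmapE // fp gq tgr_hom addrACA (inj_eq (addIr _)) -fp -gq.
by case: eqP => _; rewrite ?tmapE // (addmap0 (tmapD h)).
Qed.

Lemma tgr_tmap0 f g : compat f g ->
  (forall e m, f (p e m) = p e (f m)) ->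
  (forall e n, g (q e n) = q e (g n)) ->
  forall d x, tmap f g (tgr d x) = tgr d (tmap f g x).
Proof.
move=> h fp gq d x.
have := tgr_tmap (c := 0) (c' := 0) h _ _ d x; rewrite !addr0; apply=> e y.
  by rewrite addr0.
by rewrite addr0.
Qed.
End TGrading.

Lemma tgr_comm (p p' : int -> M -> M) (q q' : int -> N -> N)
  (pG : is_grading p) (qG : is_grading q)
  (pG' : is_grading p') (qG' : is_grading q') :
  (forall a, addmap (al a)) ->
  gr_balanced p q -> gr_balanced p' q' ->
  (forall d e m, p d (p' e m) = p' e (p d m)) ->
  (forall d e n, q d (q' e n) = q' e (q d n)) ->
  forall d e x, tgr q pG d (tgr q' pG' e x) = tgr q' pG' e (tgr q pG d x).
Proof.
move=> alD B B' pp qq d e.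
have D := tgrD pG qG alD B; have D' := tgrD pG' qG' alD B'.
apply: (tens_hom_ext pG qG) => [x y|x y|a m b n].
- by rewrite D' D.
- by rewrite D D'.
rewrite (tgr_hom pG qG alD B) (tgrE pG' qG' alD B') (addmap_sum (D d)).
transitivity (\sum_(c <- gsupp pG' (p a m))
   if d == a + b then tm (p' c (p a m)) (q' (e - c) (q b n)) else 0).
  apply: eq_bigr => c _.
  by rewrite -pp -qq (tgr_hom pG qG alD B).
case: eqP => _; first by rewrite (tgrE pG' qG' alD B').
by rewrite big1 // (addmap0 (D' e)).
Qed.
End TensorMaps.

Record is_action n (M : zmodType) (a : Rn n -> M -> M) : Prop := IsAction {
  actDr : forall f, addmap (a f);
  actDl : forall x, addmap (a^~ x);
  act1 : forall x, a 1 x = x;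
  actM : forall f g x, a (f * g) x = a f (a g x) }.

(* Graded (R, R)-bimodules for R = Z[x_1, ..., x_n], deg x_i = 2. As R is
   commutative the right action is also written on the left: [ract f x] is
   x . f . *)
Record gbimod n := GBimod {
  car :> zmodType;
  lact : Rn n -> car -> car;
  ract : Rn n -> car -> car;
  prt : int -> car -> car;
  lactP : is_action lact;
  ractP : is_action ract;
  lractC : forall f g x, lact f (ract g x) = ract g (lact f x);
  prtP : is_grading prt;
  lact_prt : forall d f, f \is d.-homog ->
    forall e x, lact f (prt e x) = prt (e + d.*2%:Z) (lact f x);
  ract_prt : forall d f, f \is d.-homog ->
    forall e x, ract f (prt e x) = prt (e + d.*2%:Z) (ract f x) }.

Record ghom n (M N : gbimod n) (f : M -> N) : Prop := GHom {
  ghomD : addmap f;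
  ghom_l : forall r x, f (lact r x) = lact r (f x);
  ghom_r : forall r x, f (ract r x) = ract r (f x);
  ghom_prt : forall d x, f (prt d x) = prt d (f x) }.

Definition giso n (M N : gbimod n) : Prop :=
  exists (f : M -> N) (g : N -> M),
    [/\ ghom f, ghom g, cancel f g & cancel g f].

Section Unit.
Variable n : nat.

Definition R_prt (e : int) (f : Rn n) : Rn n :=
  if e is Posz k then if odd k then 0 else pihomog mdeg k./2 f else 0.

Lemma R_prtD e : addmap (R_prt e).
Proof.
move=> f g; case: e => k /=; last by rewrite addr0.
by case: ifP => _; rewrite ?addr0 ?raddfD.
Qed.

Lemma R_prt_hom e k (f : Rn n) : f \is k.-homog ->
  R_prt e f = if e == k.*2%:Z then f else 0.
Proof.
move=> fk; case: e => j //=; rewrite eqz_nat.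
case: ifP => oj; first by case: eqP => // jE; rewrite jE odd_double in oj.
have -> : (j == k.*2) = (k == j./2).
  apply/eqP/eqP => [->|->]; first by rewrite doubleK.
  by rewrite -[LHS]odd_double_half oj.
case: eqP => [<-|/eqP h]; first exact: pihomog_dE.
exact: pihomog_ne0 h fk.
Qed.

Lemma R_prtE (f : Rn n) : f = \sum_(d < mmeasure mdeg f) R_prt d.*2%:Z f.
Proof.
rewrite {1}(pihomog_partitionE (leqnn (mmeasure mdeg f))).
by apply: eq_bigr => d _; rewrite /= odd_double doubleK.
Qed.

Lemma R_prt_cases e (f : Rn n) :
  R_prt e f = 0 \/ exists2 k, e = k.*2%:Z & R_prt e f \is k.-homog.
Proof.
case: e => k /=; last by left.
case: ifP => ok; [by left|right; exists k./2; last exact: pihomogP].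
by rewrite -[in LHS](odd_double_half k) ok.
Qed.

Lemma R_prtP : is_grading R_prt.
Proof.
have K d e x : R_prt d (R_prt e x) = if d == e then R_prt e x else 0.
  case: (R_prt_cases e x) => [->|[k -> kh]]; last exact: R_prt_hom.
  by rewrite (addmap0 (R_prtD _)) if_same.
split=> // [|x]; first exact: R_prtD.
have F : finsupp_at R_prt x.
  rewrite [X in finsupp_at _ X]R_prtE.
  apply: finsupp_sum => [||d]; [exact: R_prtD|exact: K|].
  by apply: (finsupp_hom (d := d.*2%:Z)); rewrite K eqxx.
exact: F.
Qed.

Lemma R_mul_prt d (f : Rn n) : f \is d.-homog ->
  forall e x, f * R_prt e x = R_prt (e + d.*2%:Z) (f * x).
Proof.
move=> fd e; apply: (gext R_prtP) => [x y|x y|c x].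
- by rewrite R_prtD mulrDr.
- by rewrite mulrDr R_prtD.
case: (R_prt_cases c x) => [->|[k -> kh]].
  by rewrite mulr0 !(addmap0 (R_prtD _)) mulr0.
rewrite (R_prt_hom _ kh) (R_prt_hom _ (dhomogM fd kh)).
rewrite doubleD PoszD [(d.*2)%:Z + _]addrC (inj_eq (addIr _)).
by case: eqP; rewrite ?mulr0.
Qed.

Lemma R_actP : is_action (fun f x : Rn n => f * x).
Proof.
split=> [f x y|x f g|x|f g x]; rewrite ?mulrDr ?mulrDl ?mul1r //.
by rewrite mulrA.
Qed.

Lemma R_lractC (f g x : Rn n) : f * (g * x) = g * (f * x).
Proof. by rewrite mulrCA. Qed.

Definition gunit : gbimod n :=
  GBimod R_actP R_actP R_lractC R_prtP R_mul_prt R_mul_prt.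
End Unit.

(* M(a)_d = M_(a+d) *)
Section Shift.
Variables (n : nat) (a : int) (M : gbimod n).
Definition shift_prt (d : int) (x : M) : M := prt (d + a) x.

Lemma shift_prtP : is_grading shift_prt.
Proof.
have P := prtP M.
split=> [d|d e x|x]; first exact: (gradD P).
  by rewrite /shift_prt (gradK P) (inj_eq (addIr _)).
have [s us xE] := gradE P x; exists [seq d - a | d <- s].
  by rewrite map_inj_uniq //; exact: addIr.
by rewrite big_map {1}xE; apply: eq_bigr => d _; rewrite /shift_prt subrK.
Qed.

Lemma shift_lact d (f : Rn n) : f \is d.-homog -> forall e x,
  lact f (shift_prt e x) = shift_prt (e + d.*2%:Z) (lact f x).
Proof. by move=> fd e x; rewrite /shift_prt (lact_prt fd) addrAC. Qed.

Lemma shift_ract d (f : Rn n) : f \is d.-homog -> forall e x,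
  ract f (shift_prt e x) = shift_prt (e + d.*2%:Z) (ract f x).
Proof. by move=> fd e x; rewrite /shift_prt (ract_prt fd) addrAC. Qed.

Definition gshift : gbimod n :=
  GBimod (lactP M) (ractP M) (@lractC _ M) shift_prtP shift_lact shift_ract.
End Shift.

Section Sum.
Variables (n : nat) (M N : gbimod n).
Notation MN := (M * N)%type.
Definition sum_lact f (x : MN) : MN := (lact f x.1, lact f x.2).
Definition sum_ract f (x : MN) : MN := (ract f x.1, ract f x.2).

Lemma pair_add (U V : zmodType) (u u' : U) (v v' : V) :
  (u, v) + (u', v') = (u + u', v + v').
Proof. by []. Qed.

Lemma sum_lactP : is_action sum_lact.
Proof.
have A := lactP M; have B := lactP N.
split=> [f [x y] [x' y']|[x y] f g|[x y]|f g [x y]]; rewrite /sum_lact /=.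
- by rewrite pair_add (actDr A) (actDr B).
- by rewrite pair_add (actDl A) (actDl B).
- by rewrite (act1 A) (act1 B).
- by rewrite (actM A) (actM B).
Qed.

Lemma sum_ractP : is_action sum_ract.
Proof.
have A := ractP M; have B := ractP N.
split=> [f [x y] [x' y']|[x y] f g|[x y]|f g [x y]]; rewrite /sum_ract /=.
- by rewrite pair_add (actDr A) (actDr B).
- by rewrite pair_add (actDl A) (actDl B).
- by rewrite (act1 A) (act1 B).
- by rewrite (actM A) (actM B).
Qed.

Lemma sum_lractC f g x : sum_lact f (sum_ract g x) = sum_ract g (sum_lact f x).
Proof. by rewrite /sum_lact /sum_ract /= !lractC. Qed.

Definition pair_gr (U V : zmodType) (p : int -> U -> U) (q : int -> V -> V)
  (d : int) (x : U * V) : U * V := (p d x.1, q d x.2).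

Lemma pair_grP (U V : zmodType) (p : int -> U -> U) (q : int -> V -> V) :
  is_grading p -> is_grading q -> is_grading (pair_gr p q).
Proof.
move=> P Q.
have D d : addmap (pair_gr p q d).
  by move=> [x y] [x' y']; rewrite /pair_gr /= pair_add (gradD P) (gradD Q).
have K d e x : pair_gr p q d (pair_gr p q e x) =
    if d == e then pair_gr p q e x else 0.
  by rewrite /pair_gr /= (gradK P) (gradK Q); case: eqP.
split=> // -[x y].
have F : finsupp_at (pair_gr p q) ((x, 0) + (0, y)).
  apply: (finsuppD D K).
    rewrite {1}(gsuppE P x).
    have -> : (\sum_(d <- gsupp P x) p d x, 0) =
        \sum_(d <- gsupp P x) (p d x, 0) :> U * V.
      by apply: (addmap_sum (f := fun u => (u, 0 : V))) => u u'; rewrite pair_add addr0.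
    apply: (finsupp_sum D K) => d; apply: (finsupp_hom (d := d)).
    by rewrite /pair_gr /= (gradK P) eqxx (addmap0 (gradD Q _)).
  rewrite {1}(gsuppE Q y).
  have -> : (0, \sum_(d <- gsupp Q y) q d y) =
      \sum_(d <- gsupp Q y) (0, q d y) :> U * V.
    by apply: (addmap_sum (f := fun v => (0 : U, v))) => v v'; rewrite pair_add addr0.
  apply: (finsupp_sum D K) => d; apply: (finsupp_hom (d := d)).
  by rewrite /pair_gr /= (gradK Q) eqxx (addmap0 (gradD P _)).
by rewrite pair_add addr0 add0r in F.
Qed.

Lemma sum_lact_prt d (f : Rn n) : f \is d.-homog -> forall e x,
  sum_lact f (pair_gr (@prt _ M) (@prt _ N) e x) =
  pair_gr (@prt _ M) (@prt _ N) (e + d.*2%:Z) (sum_lact f x).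
Proof. by move=> fd e x; rewrite /sum_lact /pair_gr /= !(lact_prt fd). Qed.

Lemma sum_ract_prt d (f : Rn n) : f \is d.-homog -> forall e x,
  sum_ract f (pair_gr (@prt _ M) (@prt _ N) e x) =
  pair_gr (@prt _ M) (@prt _ N) (e + d.*2%:Z) (sum_ract f x).
Proof. by move=> fd e x; rewrite /sum_ract /pair_gr /= !(ract_prt fd). Qed.

Definition gsum : gbimod n :=
  GBimod sum_lactP sum_ractP sum_lractC (pair_grP (prtP M) (prtP N))
    sum_lact_prt sum_ract_prt.
End Sum.

Section Zero.
Variable n : nat.
Notation Z := 'rV[int]_0.
Lemma zero_eq (x y : Z) : x = y.
Proof. by rewrite (thinmx0 x) (thinmx0 y). Qed.

Lemma zero_actP : is_action (fun (f : Rn n) (x : Z) => x).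
Proof. by split=> [f x y|x f g|x|f g x]; exact: zero_eq. Qed.

Lemma zero_grP : is_grading (fun (d : int) (x : Z) => x).
Proof.
split=> [d x y|d e x|x]; first by [].
  exact: zero_eq.
by exists [::] => //; exact: zero_eq.
Qed.

Definition gzero : gbimod n :=
  @GBimod n Z (fun _ x => x) (fun _ x => x) (fun _ x => x) zero_actP zero_actP
    (fun _ _ _ => erefl) zero_grP (fun _ _ _ _ _ => erefl)
    (fun _ _ _ _ _ => erefl).
End Zero.

(* M (x)_S N for a subring S of R which is graded; only the compatibility of
   S with homogeneous components is needed for the construction. *)
Section TensorBimod.
Variables (n : nat) (S : {pred Rn n}).
Hypothesis Shom : forall f d, f \in S -> pihomog mdeg d f \in S.
Variables (M N : gbimod n).

Definition sc : Type := {f : Rn n | f \in S}.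
Definition sc_r (f : sc) (x : M) : M := ract (sval f) x.
Definition sc_l (f : sc) (y : N) : N := lact (sval f) y.

Lemma sc_rD f : addmap (sc_r f).
Proof. exact: (actDr (ractP M)). Qed.

Lemma sc_balanced : gr_balanced sc_r sc_l (@prt _ M) (@prt _ N).
Proof.
move=> [f fS]; exists (mmeasure mdeg f).
exists (fun i : 'I__ => (exist _ (pihomog mdeg i f) (Shom i fS), i.*2%:Z)).
split=> [m|x|i e m|i e x]; rewrite /sc_r /sc_l /=.
- rewrite {1}(pihomog_partitionE (leqnn (mmeasure mdeg f))).
  exact: (addmap_sum (actDl (ractP M) m)).
- rewrite {1}(pihomog_partitionE (leqnn (mmeasure mdeg f))).
  exact: (addmap_sum (actDl (lactP N) x)).
- exact/ract_prt/pihomogP.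
- exact/lact_prt/pihomogP.
Qed.

Definition ot_lact f : tens sc_r sc_l -> tens sc_r sc_l := tmap (lact f) id.
Definition ot_ract f : tens sc_r sc_l -> tens sc_r sc_l := tmap id (ract f).

Lemma ot_lcompat f : compat sc_r sc_l (lact f) id.
Proof. by split=> // [|g m]; [exact: (actDr (lactP M))|exact: lractC]. Qed.

Lemma ot_rcompat f : compat sc_r sc_l id (ract f).
Proof.
by split=> // [|g m]; [exact: (actDr (ractP N))|rewrite /sc_l lractC].
Qed.

Lemma ot_lactP : is_action ot_lact.
Proof.
have A := lactP M; have C := ot_lcompat.
have D f : addmap (ot_lact f) by exact/tmapD/C.
have E f m k : ot_lact f (tmk sc_r sc_l m k) = tmk sc_r sc_l (lact f m) k.
  by rewrite /ot_lact tmapE.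
split=> // [x f g|x|f g x].
- move: x; apply: tens_ext => [x y|x y|m k]; first exact: D.
    by rewrite !D addrACA.
  by rewrite !E (actDl A) tmkDl.
- move: x; apply: tens_ext => // m k.
  by rewrite E (act1 A).
- rewrite /ot_lact tmap_comp //.
  by apply: eq_tmap => // m; rewrite /= (actM A).
Qed.

Lemma ot_ractP : is_action ot_ract.
Proof.
have A := ractP N; have C := ot_rcompat.
have D f : addmap (ot_ract f) by exact/tmapD/C.
have E f m k : ot_ract f (tmk sc_r sc_l m k) = tmk sc_r sc_l m (ract f k).
  by rewrite /ot_ract tmapE.
split=> // [x f g|x|f g x].
- move: x; apply: tens_ext => [x y|x y|m k]; first exact: D.
    by rewrite !D addrACA.
  by rewrite !E (actDl A) tmkDr.
- move: x; apply: tens_ext => // m k.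
  by rewrite E (act1 A).
- rewrite /ot_ract tmap_comp //.
  by apply: eq_tmap => // m; rewrite /= (actM A).
Qed.

Lemma ot_lractC f g x : ot_lact f (ot_ract g x) = ot_ract g (ot_lact f x).
Proof.
by rewrite /ot_lact /ot_ract !tmap_comp //;
  [exact: ot_rcompat|exact: ot_lcompat|exact: ot_lcompat|exact: ot_rcompat].
Qed.

Definition ot_prt : int -> tens sc_r sc_l -> tens sc_r sc_l :=
  tgr (@prt _ N) (prtP M).

Lemma ot_prtP : is_grading ot_prt.
Proof. exact: (tgr_grading (prtP M) (prtP N) sc_rD sc_balanced). Qed.

Lemma ot_lact_prt d (f : Rn n) : f \is d.-homog -> forall e x,
  ot_lact f (ot_prt e x) = ot_prt (e + d.*2%:Z) (ot_lact f x).
Proof.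
move=> fd e x.
have := tgr_tmap (prtP M) (prtP N) sc_rD sc_balanced (c := d.*2%:Z) (c' := 0)
  (ot_lcompat f) (lact_prt fd).
by rewrite addr0; apply=> c y; rewrite addr0.
Qed.

Lemma ot_ract_prt d (f : Rn n) : f \is d.-homog -> forall e x,
  ot_ract f (ot_prt e x) = ot_prt (e + d.*2%:Z) (ot_ract f x).
Proof.
move=> fd e x.
have := tgr_tmap (prtP M) (prtP N) sc_rD sc_balanced (c := 0) (c' := d.*2%:Z)
  (ot_rcompat f).
by rewrite add0r; apply=> [c y|]; [rewrite addr0|exact: ract_prt].
Qed.

Definition gtens_over : gbimod n :=
  GBimod ot_lactP ot_ractP ot_lractC ot_prtP ot_lact_prt ot_ract_prt.
End TensorBimod.

Section MonAct.
Context {n : nat} {V : zmodType} (L : 'X_{1..n} -> V -> V).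
Hypothesis LD : forall m, addmap (L m).
Hypothesis L0 : forall x, L 0%MM x = x.
Hypothesis LA : forall m m' x, L (m + m')%MM x = L m (L m' x).

Definition monact (f : Rn n) (x : V) : V := \sum_(m <- msupp f) L m x *~ f@_m.

Lemma monact_sub s f x : uniq s -> {subset msupp f <= s} ->
  monact f x = \sum_(m <- s) L m x *~ f@_m.
Proof.
move=> us fs; rewrite (bigID (mem (msupp f))) /= [X in _ + X]big1 ?addr0.
  rewrite -big_filter; apply: perm_big; apply: uniq_perm.
  - exact: msupp_uniq.
  - exact: filter_uniq.
  - by move=> m; rewrite mem_filter; case: (boolP (m \in msupp f)) => //= /fs ->.
by move=> m /memN_msupp_eq0 ->; rewrite mulr0z.
Qed.

Lemma monactDl x : addmap (monact^~ x).
Proof.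
move=> f g; set s := undup (msupp f ++ msupp g).
have us : uniq s by exact: undup_uniq.
have sf : {subset msupp f <= s} by move=> m; rewrite mem_undup mem_cat => ->.
have sg : {subset msupp g <= s}.
  by move=> m; rewrite mem_undup mem_cat orbC => ->.
rewrite (monact_sub _ us sf) (monact_sub _ us sg) (@monact_sub s) //.
  by rewrite -big_split; apply: eq_bigr => m _; rewrite mcoeffD mulrzDr.
by move=> m /msuppD_le; rewrite mem_undup.
Qed.

Lemma monactDr f : addmap (monact f).
Proof.
move=> x y; rewrite /monact -big_split; apply: eq_bigr => m _.
by rewrite LD mulrzDl.
Qed.

Lemma monactZX c m x : monact (c *: 'X_[m]) x = L m x *~ c.
Proof.
rewrite (@monact_sub [:: m]) ?big_seq1 //.
  by rewrite mcoeffZ mcoeffX eqxx mulr1.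
by move=> m' /msuppZ_le; rewrite msuppX.
Qed.

Lemma monactP : is_action monact.
Proof.
split=> [f|x|x|f g x]; [exact: monactDr|exact: monactDl| |].
  by rewrite -mpolyX0 -[X in monact X]scale1r monactZX L0.
elim/mpolyind: f => [|c m p _ _ IH] in g *.
  by rewrite mul0r !(addmap0 (monactDl _)).
rewrite mulrDl !monactDl IH; congr (_ + _).
elim/mpolyind: g => [|d m' q _ _ IHq].
  by rewrite mulr0 !(addmap0 (monactDl _)) (addmap0 (monactDr _)).
rewrite mulrDr !monactDl IHq monactDr; congr (_ + _).
rewrite -scalerAl -scalerAr scalerA -mpolyXD !monactZX LA.
by rewrite (addmapMz (LD _)) mulrzA mulrzAC.
Qed.

Lemma monact_comm (f : Rn n) (W : zmodType) (L' : 'X_{1..n} -> W -> W)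
  (u : V -> W) x : addmap u ->
  (forall m, m \in msupp f -> u (L m x) = L' m (u x)) ->
  u (monact f x) = \sum_(m <- msupp f) L' m (u x) *~ f@_m.
Proof.
move=> uD uL; rewrite (addmap_sum uD); apply: eq_big_seq => m mf.
by rewrite (addmapMz uD) uL.
Qed.
End MonAct.

(* The external tensor product M (x)_Z N.  A monomial of R_(k+l) is the
   product of a monomial in x_1, ..., x_k, which acts on M, and of one in
   x_(k+1), ..., x_(k+l), which acts on N. *)
Section External.
Variables (k l : nat).
Definition mleft (m : 'X_{1..k + l}) : 'X_{1..k} :=
  [multinom m (lshift l i) | i < k].
Definition mright (m : 'X_{1..k + l}) : 'X_{1..l} :=
  [multinom m (rshift k i) | i < l].

Lemma mleftD m m' : mleft (m + m')%MM = (mleft m + mleft m')%MM.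
Proof. by apply/mnmP => i; rewrite !(mnmE, mnmDE). Qed.

Lemma mrightD m m' : mright (m + m')%MM = (mright m + mright m')%MM.
Proof. by apply/mnmP => i; rewrite !(mnmE, mnmDE). Qed.

Lemma mleft0 : mleft 0%MM = 0%MM.
Proof. by apply/mnmP => i; rewrite !mnmE. Qed.

Lemma mright0 : mright 0%MM = 0%MM.
Proof. by apply/mnmP => i; rewrite !mnmE. Qed.

Lemma mdeg_split m : (mdeg (mleft m) + mdeg (mright m))%N = mdeg m.
Proof.
rewrite !mdegE big_split_ord /=; congr (_ + _)%N;
  by apply: eq_bigr => i _; rewrite mnmE.
Qed.

Variables (M : gbimod k) (N : gbimod l).
Definition zl : void -> M -> M := of_void _.
Definition zr : void -> N -> N := of_void _.
Local Notation T := (tens zl zr).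

Lemma z_compat f g : addmap f -> addmap g -> compat zl zr f g.
Proof. by move=> fD gD; split=> // -[]. Qed.

Lemma z_balanced p q : gr_balanced zl zr p q.
Proof. by case. Qed.

Lemma zlD a : addmap (zl a).
Proof. by case: a. Qed.

Section Act.
Variables (a : Rn k -> M -> M) (b : Rn l -> N -> N).
Hypotheses (aP : is_action a) (bP : is_action b).

Definition ext_mon (m : 'X_{1..k + l}) : T -> T :=
  tmap (a 'X_[mleft m]) (b 'X_[mright m]).

Definition ext_act : Rn (k + l) -> T -> T := monact ext_mon.

Lemma ext_mon_compat m :
  compat zl zr (a 'X_[mleft m]) (b 'X_[mright m]).
Proof. by apply: z_compat; [exact: (actDr aP)|exact: (actDr bP)]. Qed.

Lemma ext_monD m : addmap (ext_mon m).
Proof. exact/tmapD/ext_mon_compat. Qed.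

Lemma ext_actP : is_action ext_act.
Proof.
apply: monactP => [|x|m m' x]; first exact: ext_monD.
  move: x; apply: tens_ext => [|//|y z]; first exact: ext_monD.
  rewrite /ext_mon tmapE ?mleft0 ?mright0 ?mpolyX0 ?(act1 aP) ?(act1 bP) //.
  by apply: z_compat; [exact: (actDr aP)|exact: (actDr bP)].
rewrite /ext_mon tmap_comp; [|exact: ext_mon_compat|exact: ext_mon_compat].
apply: eq_tmap => y /=.
  by rewrite mleftD mpolyXD (actM aP).
by rewrite mrightD mpolyXD (actM bP).
Qed.

Lemma ext_act_tmap f u v x : addmap u -> addmap v ->
  (forall g y, u (a g y) = a g (u y)) -> (forall g y, v (b g y) = b g (v y)) ->
  tmap u v (ext_act f x) = ext_act f (tmap u v x).
Proof.
move=> uD vD ua vb; have C := z_compat uD vD.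
apply: (monact_comm (L' := ext_mon)) => [|m _]; first exact: tmapD.
have Cm := ext_mon_compat m.
by rewrite /ext_mon !tmap_comp //; apply: eq_tmap => y /=; rewrite ?ua ?vb.
Qed.

Lemma ext_act_tgr0 (p : int -> M -> M) (q : int -> N -> N)
  (pG : is_grading p) (qG : is_grading q) :
  (forall f e y, a f (p e y) = p e (a f y)) ->
  (forall f e y, b f (q e y) = q e (b f y)) ->
  forall f e x, ext_act f (tgr q pG e x) = tgr q pG e (ext_act f x).
Proof.
move=> ap bq f e x; symmetry.
apply: (monact_comm (L' := ext_mon)) => [|m _].
  exact: (tgrD pG qG zlD (z_balanced p q)).
have := tgr_tmap pG qG zlD (z_balanced p q) (c := 0) (c' := 0)
  (ext_mon_compat m).
rewrite !addr0 /ext_mon => -> //; first by rewrite addr0.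
- by move=> c y; rewrite addr0 ap.
- by move=> c y; rewrite addr0 bq.
Qed.

Lemma ext_act_tgr (p : int -> M -> M) (q : int -> N -> N)
  (pG : is_grading p) (qG : is_grading q) :
  (forall d f, f \is d.-homog ->
     forall e y, a f (p e y) = p (e + d.*2%:Z) (a f y)) ->
  (forall d f, f \is d.-homog ->
     forall e y, b f (q e y) = q (e + d.*2%:Z) (b f y)) ->
  forall d f, f \is d.-homog ->
  forall e x, ext_act f (tgr q pG e x) = tgr q pG (e + d.*2%:Z) (ext_act f x).
Proof.
move=> ap bq d f /dhomogP fd e x; rewrite /ext_act /monact.
have D := tgrD pG qG zlD (z_balanced p q).
rewrite (addmap_sum (D _)); apply: eq_big_seq => m mf.
rewrite (addmapMz (D _)); congr (_ *~ _).
have hX j (n : 'X_{1..j}) : 'X_[n] \is [in int[j], (mdeg n).-homog].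
  by rewrite dhomogX.
rewrite /ext_mon (tgr_tmap pG qG zlD (z_balanced p q) (ext_mon_compat m)
  (ap _ _ (hX _ _)) (bq _ _ (hX _ _))).
by rewrite -PoszD -doubleD mdeg_split (fd m mf).
Qed.
End Act.

Lemma ext_lractC f g x : ext_act (@lact _ M) (@lact _ N) f
    (ext_act (@ract _ M) (@ract _ N) g x) =
  ext_act (@ract _ M) (@ract _ N) g (ext_act (@lact _ M) (@lact _ N) f x).
Proof.
apply: (monact_comm (L' := ext_mon (@ract _ M) (@ract _ N))) => [|m _].
  exact: (actDr (ext_actP (lactP M) (lactP N))).
symmetry; apply: (ext_act_tmap (lactP M) (lactP N)) => [||h y|h y].
- exact: (actDr (ractP M)).
- exact: (actDr (ractP N)).
- by rewrite lractC.
- by rewrite lractC.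
Qed.

Definition gsqcup : gbimod (k + l) :=
  GBimod (ext_actP (lactP M) (lactP N)) (ext_actP (ractP M) (ractP N))
    ext_lractC (tgr_grading (prtP M) (prtP N) zlD (z_balanced _ _))
    (ext_act_tgr (lactP M) (lactP N) (prtP M) (prtP N)
       (@lact_prt _ M) (@lact_prt _ N))
    (ext_act_tgr (ractP M) (ractP N) (prtP M) (prtP N)
       (@ract_prt _ M) (@ract_prt _ N)).
End External.

Section Koszul.
Context {M : zmodType} {h : int -> M -> M} (hG : is_grading h).

(* x |-> (-1)^k x in homological degree k *)
Definition koszul : M -> M := gfold hG (fun k x => x *~ (-1) ^+ absz k).

Lemma koszul_term (k : int) : addmap (fun x : M => x *~ (-1) ^+ absz k).
Proof. by move=> x y; rewrite mulrzDl. Qed.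

Lemma koszulD : addmap koszul.
Proof. exact/gfoldD/koszul_term. Qed.

Lemma koszul_hom k x : koszul (h k x) = h k x *~ (-1) ^+ absz k.
Proof. exact/gfold_hom/koszul_term. Qed.

Lemma koszul_comm u : addmap u -> (forall k x, u (h k x) = h k (u x)) ->
  forall x, koszul (u x) = u (koszul x).
Proof.
move=> uD uh; apply: (gext hG) => [x y|x y|k x].
- by rewrite uD koszulD.
- by rewrite koszulD uD.
by rewrite uh !koszul_hom (addmapMz uD) uh.
Qed.

Lemma sgnS (k : int) : (-1) ^+ absz (k + 1) = - (-1) ^+ absz k :> int.
Proof.
have E (j : int) : (-1) ^+ absz j = (-1) ^ j :> int.
  by case: j => j //; rewrite NegzE abszN absz_nat -exprnN exprVn invrN1.
by rewrite !E exprzDr ?unitrN1 // mulrN1.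
Qed.

Lemma koszul_anti u : addmap u -> (forall k x, u (h k x) = h (k + 1) (u x)) ->
  forall x, koszul (u x) = - u (koszul x).
Proof.
move=> uD uh; apply: (gext hG) => [x y|x y|k x].
- by rewrite uD koszulD.
- by rewrite koszulD uD opprD.
by rewrite uh !koszul_hom (addmapMz uD) uh sgnS mulrNz.
Qed.
End Koszul.

Section TensorDiff.
Context {M N : zmodType} {A : Type} (al : A -> M -> M) (be : A -> N -> N).
Variables (hp : int -> M -> M) (hq : int -> N -> N).
Hypotheses (hpG : is_grading hp) (hqG : is_grading hq).
Variables (dM : M -> M) (dN : N -> N).
Hypotheses (dMD : addmap dM) (dND : addmap dN).
Hypothesis alD : forall a, addmap (al a).
Hypothesis al_h : forall a k x, al a (hp k x) = hp k (al a x).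
Hypothesis be_h : forall a k x, be a (hq k x) = hq k (be a x).
Hypothesis al_d : forall a x, dM (al a x) = al a (dM x).
Hypothesis be_d : forall a x, dN (be a x) = be a (dN x).
Hypothesis dMh : forall k x, dM (hp k x) = hp (k + 1) (dM x).
Hypothesis dNh : forall k x, dN (hq k x) = hq (k + 1) (dN x).
Hypothesis dM2 : forall x, dM (dM x) = 0.
Hypothesis dN2 : forall x, dN (dN x) = 0.
Local Notation T := (tens al be).
Local Notation eps := (koszul hpG).

Lemma h_balanced : gr_balanced al be hp hq.
Proof.
move=> a; exists 1, (fun _ => (a, 0)); split=> [m|n|_ k x|_ k x] /=.
- by rewrite big_ord1.
- by rewrite big_ord1.
- by rewrite addr0 al_h.
- by rewrite addr0 be_h.
Qed.

Local Notation th := (tgr (al := al) (be := be) hq hpG).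
Let thP : is_grading th := tgr_grading hpG hqG alD h_balanced.

(* d(m (x) n) = dm (x) n + (-1)^|m| m (x) dn *)
Definition tdif (x : T) : T := tmap dM id x + tmap eps dN x.

Lemma tdif_c1 : compat al be dM id. Proof. by split. Qed.

Lemma tdif_c2 : compat al be eps dN.
Proof. by split=> // [|a m]; [exact: koszulD|exact: koszul_comm]. Qed.

Lemma tdifD : addmap tdif.
Proof.
move=> x y; rewrite /tdif (tmapD tdif_c1) (tmapD tdif_c2).
exact: addrACA.
Qed.

Lemma tdif_th k x : tdif (th k x) = th (k + 1) (tdif x).
Proof.
rewrite /tdif (gradD thP); congr (_ + _).
  have := tgr_tmap hpG hqG alD h_balanced (c := 1) (c' := 0) tdif_c1.
  by rewrite addr0; apply=> // c y; rewrite addr0.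
have := tgr_tmap hpG hqG alD h_balanced (c := 0) (c' := 1) tdif_c2.
rewrite add0r; apply=> // c y; rewrite addr0.
by apply: koszul_comm => [|k' z]; [exact: (gradD hpG)|rewrite !(gradK hpG) eq_sym; case: eqP => // ->].
Qed.

Lemma tdif2 x : tdif (tdif x) = 0.
Proof.
move: x; apply: tens_ext => [x y|x y|m n]; first by rewrite !tdifD.
  by rewrite addr0.
have E m' n' : tdif (tmk al be m' n') =
    tmk al be (dM m') n' + tmk al be (eps m') (dN n').
  by rewrite /tdif (tmapE _ _ tdif_c1) (tmapE _ _ tdif_c2).
rewrite E tdifD !E dM2 dN2 (koszul_anti hpG dMD dMh).
rewrite (addmap0 (tmkDl _ _ _)) (addmap0 (tmkDr _ _ _)) add0r addr0.
by rewrite -tmkDl addNr (addmap0 (tmkDl _ _ _)).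
Qed.

Lemma tdif_tmap u v : compat al be u v ->
  (forall x, u (dM x) = dM (u x)) -> (forall k x, u (hp k x) = hp k (u x)) ->
  (forall x, v (dN x) = dN (v x)) ->
  forall x, tdif (tmap u v x) = tmap u v (tdif x).
Proof.
move=> C ud uh vd x; rewrite /tdif (tmapD C).
have c1 := tdif_c1; have c2 := tdif_c2; have uD : addmap u by case: C.
rewrite !tmap_comp //; congr (_ + _); apply: eq_tmap => y //=.
exact: koszul_comm.
Qed.

Lemma tdif_tgr (p : int -> M -> M) (q : int -> N -> N)
  (pG : is_grading p) (qG : is_grading q) : gr_balanced al be p q ->
  (forall k x, dM (p k x) = p k (dM x)) ->
  (forall k j x, p k (hp j x) = hp j (p k x)) ->
  (forall k x, dN (q k x) = q k (dN x)) ->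
  forall k x, tdif (tgr (al := al) (be := be) q pG k x) = tgr q pG k (tdif x).
Proof.
move=> B pd ph qd k x.
have D := tgrD pG qG alD B.
move: x; apply: (tens_hom_ext pG qG) => [x y|x y|a m b n].
- by rewrite D tdifD.
- by rewrite tdifD D.
have E m' n' : tdif (tmk al be m' n') =
    tmk al be (dM m') n' + tmk al be (eps m') (dN n').
  by rewrite /tdif (tmapE _ _ tdif_c1) (tmapE _ _ tdif_c2).
rewrite E (tgr_hom pG qG alD B) D pd qd koszul_comm; [|exact: (gradD pG)|exact: ph].
rewrite !(tgr_hom pG qG alD B); case: eqP => _.
  by rewrite E pd qd koszul_comm //; exact: (gradD pG).
by rewrite (addmap0 tdifD) addr0.
Qed.
End TensorDiff.

(* A complex C of graded bimodules is given by its total bimodule, the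
   direct sum of all its chain bimodules C_k, together with the homological
   grading [hpr] by graded sub-bimodules and the differential of degree +1.
   With the internal grading [prt] this is a Z x Z-graded bimodule.  Giving C
   is the same as giving the C_k and the maps C_k -> C_(k+1), and tensor
   products of complexes become tensor products of total bimodules. *)
Record cpx n := Cpx {
  tot :> gbimod n;
  hpr : int -> tot -> tot;
  hprP : is_grading hpr;
  hpr_hom : forall k, ghom (hpr k);
  dif : tot -> tot;
  dif_hom : ghom dif;
  dif_hpr : forall k x, dif (hpr k x) = hpr (k + 1) (dif x);
  dif_dif : forall x, dif (dif x) = 0 }.

Lemma ghom_comp n (M N P : gbimod n) (f : N -> P) (g : M -> N) :
  ghom f -> ghom g -> ghom (f \o g).
Proof.
move=> [fD fl fr fp] [gD gl gr gp]; split=> [x y|r x|r x|d x] /=.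
- by rewrite gD fD.
- by rewrite gl fl.
- by rewrite gr fr.
- by rewrite gp fp.
Qed.

Section Chain.
Variables (n : nat) (C : cpx n) (k : int).
Definition chain_pred : pred C := fun x => hpr k x == x.

Lemma chain_closed : zmod_closed chain_pred.
Proof.
have D := ghomD (hpr_hom C k).
split=> [|x y]; rewrite !unfold_in; first by rewrite (addmap0 D).
by move=> /eqP hx /eqP hy; rewrite (addmapB D) hx hy.
Qed.

Definition chain_sub : zmodClosed C := HB.pack chain_pred
  (GRing.isZmodClosed.Build C chain_pred chain_closed).

Definition chain_car : Type := {x : C | x \in chain_sub}.
HB.instance Definition _ := SubChoice.on chain_car.
HB.instance Definition _ := [SubChoice_isSubZmodule of chain_car by <:].

Lemma chainP (x : chain_car) : hpr k (val x) = val x.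
Proof. by apply/eqP; case: x. Qed.

Lemma chain_stable (f : C -> C) (fh : forall x, f (hpr k x) = hpr k (f x))
  (x : chain_car) : f (val x) \in chain_sub.
Proof. by rewrite unfold_in /= /chain_pred -fh chainP. Qed.

Definition chain_map (f : C -> C) (fh : forall x, f (hpr k x) = hpr k (f x))
  (x : chain_car) : chain_car := Sub (f (val x)) (chain_stable fh x).

Lemma chain_mapE f fh x : val (@chain_map f fh x) = f (val x).
Proof. by rewrite SubK. Qed.

Lemma l_h f (x : C) : lact f (hpr k x) = hpr k (lact f x).
Proof. by rewrite (ghom_l (hpr_hom C k)). Qed.
Lemma r_h f (x : C) : ract f (hpr k x) = hpr k (ract f x).
Proof. by rewrite (ghom_r (hpr_hom C k)). Qed.
Lemma p_h d (x : C) : prt d (hpr k x) = hpr k (prt d x).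
Proof. by rewrite (ghom_prt (hpr_hom C k)). Qed.

Definition chain_lact f : chain_car -> chain_car := chain_map (l_h f).
Definition chain_ract f : chain_car -> chain_car := chain_map (r_h f).
Definition chain_prt d : chain_car -> chain_car := chain_map (p_h d).

Lemma chain_lactP : is_action chain_lact.
Proof.
have A := lactP C.
split=> [f x y|x f g|x|f g x]; apply: val_inj; rewrite /= ?raddfD /=.
- exact: (actDr A).
- exact: (actDl A).
- exact: (act1 A).
- exact: (actM A).
Qed.

Lemma chain_ractP : is_action chain_ract.
Proof.
have A := ractP C.
split=> [f x y|x f g|x|f g x]; apply: val_inj; rewrite /= ?raddfD /=.
- exact: (actDr A).
- exact: (actDl A).
- exact: (act1 A).
- exact: (actM A).
Qed.

Lemma chain_lractC f g x :
  chain_lact f (chain_ract g x) = chain_ract g (chain_lact f x).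
Proof. by apply: val_inj; rewrite /= lractC. Qed.

Lemma chain_prtP : is_grading chain_prt.
Proof.
have P := prtP C.
split=> [d x y|d e x|x].
- by apply: val_inj; rewrite /= (gradD P).
- by apply: val_inj; rewrite /= (gradK P); case: eqP.
have [s us xE] := gradE P (val x); exists s => //.
by apply: val_inj; rewrite raddf_sum.
Qed.

Lemma chain_lact_prt d (f : Rn n) : f \is d.-homog -> forall e x,
  chain_lact f (chain_prt e x) = chain_prt (e + d.*2%:Z) (chain_lact f x).
Proof. by move=> fd e x; apply: val_inj; rewrite /= (lact_prt fd). Qed.

Lemma chain_ract_prt d (f : Rn n) : f \is d.-homog -> forall e x,
  chain_ract f (chain_prt e x) = chain_prt (e + d.*2%:Z) (chain_ract f x).
Proof. by move=> fd e x; apply: val_inj; rewrite /= (ract_prt fd). Qed.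

Definition chain : gbimod n :=
  GBimod chain_lactP chain_ractP chain_lractC chain_prtP chain_lact_prt
    chain_ract_prt.
End Chain.

(* M sits in homological degree 0 and N in degree 1. *)
Section TwoTerm.
Variables (n : nat) (M N : gbimod n) (f : M -> N) (fH : ghom f).
Definition tt_hpr (k : int) (x : gsum M N) : gsum M N :=
  (if k == 0 then x.1 else 0, if k == 1 then x.2 else 0).
Definition tt_dif (x : gsum M N) : gsum M N := (0, f x.1).

Lemma conc_grading (U : zmodType) (c : int) :
  is_grading (fun (k : int) (x : U) => if k == c then x else 0).
Proof.
split=> [k x y|k j x|x]; first by case: ifP; rewrite ?addr0.
  case: (k =P j) => [->|kj]; first by case: eqP.
  by case: (k =P c) => // kc; case: (j =P c) => // jc; case: kj; rewrite kc jc.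
by exists [:: c]; rewrite // big_seq1 eqxx.
Qed.

Lemma tt_hprP : is_grading tt_hpr.
Proof. exact: pair_grP (conc_grading _ 0) (conc_grading _ 1). Qed.

Lemma if_morph (U V : zmodType) (b : bool) (g : U -> V) x : addmap g ->
  g (if b then x else 0) = if b then g x else 0.
Proof. by move=> gD; case: b; rewrite ?(addmap0 gD). Qed.

Lemma conc_hom (L : gbimod n) b : ghom (fun x : L => if b then x else 0).
Proof.
split=> [x y|r x|r x|d x]; first by case: b; rewrite ?addr0.
- by rewrite (if_morph _ _ (actDr (lactP L) r)).
- by rewrite (if_morph _ _ (actDr (ractP L) r)).
- by rewrite (if_morph _ _ (gradD (prtP L) d)).
Qed.

Lemma tt_hpr_hom k : ghom (tt_hpr k).
Proof.
have [aD al ar ap] := conc_hom M (k == 0).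
have [bD bl br bp] := conc_hom N (k == 1).
split=> [[x y] [x' y']|r [x y]|r [x y]|d [x y]]; rewrite /tt_hpr /=.
- by rewrite aD bD.
- by rewrite al bl.
- by rewrite ar br.
- by rewrite ap bp.
Qed.

Lemma tt_dif_hom : ghom tt_dif.
Proof.
have [aD al ar ap] := fH.
split=> [[x y] [x' y']|r [x y]|r [x y]|d [x y]]; rewrite /tt_dif /=.
- by rewrite aD pair_add addr0.
- by rewrite al /sum_lact /= (addmap0 (actDr (lactP M) r)).
- by rewrite ar /sum_ract /= (addmap0 (actDr (ractP M) r)).
- by rewrite ap /pair_gr /= (addmap0 (gradD (prtP M) d)).
Qed.

Lemma tt_dif_hpr k x : tt_dif (tt_hpr k x) = tt_hpr (k + 1) (tt_dif x).
Proof.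
rewrite /tt_dif /tt_hpr /= if_same (if_morph _ _ (ghomD fH)).
by have -> : (k + 1 == 1) = (k == 0) by rewrite -subr_eq0 addrK.
Qed.

Lemma tt_dif2 x : tt_dif (tt_dif x) = 0.
Proof. by rewrite /tt_dif /= (addmap0 (ghomD fH)). Qed.

Definition twoterm : cpx n :=
  Cpx tt_hprP tt_hpr_hom tt_dif_hom tt_dif_hpr tt_dif2.
End TwoTerm.

Section Conc.
Variables (n : nat) (M : gbimod n).
Lemma conc_dif_hom : ghom (fun _ : M => 0 : M).
Proof.
split=> [x y|r x|r x|d x]; rewrite ?addr0 //.
- by rewrite (addmap0 (actDr (lactP M) r)).
- by rewrite (addmap0 (actDr (ractP M) r)).
- by rewrite (addmap0 (gradD (prtP M) d)).
Qed.

Definition conc : cpx n := @Cpx n M _ (conc_grading M 0)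
  (fun k => conc_hom M (k == 0)) (fun _ => 0) conc_dif_hom
  (fun k _ => esym (if_same (k + 1 == 0) (0 : M))) (fun _ => erefl).
End Conc.

Definition cunit n : cpx n := conc (gunit n).
Definition czero n : cpx n := conc (gzero n).

(* C(a)[b] *)
Section ShiftCpx.
Variables (n : nat) (a b : int) (C : cpx n).
Definition sh_hpr (k : int) (x : gshift a C) : gshift a C := hpr (k + b) x.
Definition sh_dif (x : gshift a C) : gshift a C := dif x *~ (-1) ^+ absz b.

Lemma sh_hprP : is_grading sh_hpr.
Proof.
have P := hprP C.
split=> [k|k j x|x]; first exact: (gradD P).
  by rewrite /sh_hpr (gradK P) (inj_eq (addIr _)).
have [s us xE] := gradE P x; exists [seq k - b | k <- s].
  by rewrite map_inj_uniq //; exact: addIr.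
by rewrite big_map {1}xE; apply: eq_bigr => k _; rewrite /sh_hpr subrK.
Qed.

Lemma sh_hpr_hom k : ghom (sh_hpr k).
Proof.
have [aD al ar ap] := hpr_hom C (k + b).
by split=> // d x; exact: ap.
Qed.

Lemma sh_dif_hom : ghom sh_dif.
Proof.
have [aD al ar ap] := dif_hom C; rewrite /sh_dif.
split=> [x y|r x|r x|d x].
- by rewrite aD mulrzDl.
- by rewrite /= al (addmapMz (actDr (lactP C) r)).
- by rewrite /= ar (addmapMz (actDr (ractP C) r)).
- by rewrite /= /shift_prt ap (addmapMz (gradD (prtP C) _)).
Qed.

Lemma sh_dif_hpr k x : sh_dif (sh_hpr k x) = sh_hpr (k + 1) (sh_dif x).
Proof.
rewrite /sh_dif /sh_hpr dif_hpr (addmapMz (ghomD (hpr_hom C _))).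
by rewrite addrAC.
Qed.

Lemma sh_dif2 x : sh_dif (sh_dif x) = 0.
Proof.
by rewrite /sh_dif (addmapMz (ghomD (dif_hom C))) dif_dif !mul0rz.
Qed.

Definition csh : cpx n := Cpx sh_hprP sh_hpr_hom sh_dif_hom sh_dif_hpr sh_dif2.
End ShiftCpx.

Record is_chmap n (C D : cpx n) (f : C -> D) : Prop := IsChmap {
  chmap_hom : ghom f;
  chmap_hpr : forall k x, f (hpr k x) = hpr k (f x);
  chmap_dif : forall x, f (dif x) = dif (f x) }.

Definition homotopic n (C D : cpx n) (f g : C -> D) : Prop :=
  exists2 h : C -> D, ghom h /\ (forall k x, h (hpr k x) = hpr (k - 1) (h x))
    & forall x, f x - g x = dif (h x) + h (dif x).

Definition heq n (C D : cpx n) : Prop :=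
  exists (f : C -> D) (g : D -> C), [/\ is_chmap f, is_chmap g,
    homotopic (g \o f) id & homotopic (f \o g) id].

Section Cone.
Variables (n : nat) (C D : cpx n) (f : C -> D) (fC : is_chmap f).

Definition cone_hpr (k : int) (x : gsum C D) : gsum C D :=
  (hpr (k + 1) x.1, hpr k x.2).
Definition cone_dif (x : gsum C D) : gsum C D :=
  (- dif x.1, f x.1 + dif x.2).

Lemma cone_hprP : is_grading cone_hpr.
Proof. exact: (pair_grP (sh_hprP 0 1 C) (hprP D)). Qed.

Lemma cone_hpr_hom k : ghom (cone_hpr k).
Proof.
have [aD al ar ap] := hpr_hom C (k + 1).
have [bD bl br bp] := hpr_hom D k.
split=> [[x y] [x' y']|r [x y]|r [x y]|d [x y]]; rewrite /cone_hpr /=.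
- by rewrite aD bD.
- by rewrite al bl.
- by rewrite ar br.
- by rewrite ap bp.
Qed.

Lemma cone_dif_hom : ghom cone_dif.
Proof.
have [aD al ar ap] := dif_hom C.
have [bD bl br bp] := dif_hom D.
have [cD cl cr cp] := chmap_hom fC.
split=> [[x y] [x' y']|r [x y]|r [x y]|d [x y]]; rewrite /cone_dif /=.
- by rewrite aD bD cD pair_add opprD addrACA.
- rewrite al bl cl /sum_lact /= (addmapN (actDr (lactP C) r)).
  by rewrite (actDr (lactP D)).
- rewrite ar br cr /sum_ract /= (addmapN (actDr (ractP C) r)).
  by rewrite (actDr (ractP D)).
- rewrite ap bp cp /pair_gr /= (addmapN (gradD (prtP C) d)).
  by rewrite (gradD (prtP D)).
Qed.

Lemma cone_dif_hpr k x : cone_dif (cone_hpr k x) = cone_hpr (k + 1) (cone_dif x).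
Proof.
rewrite /cone_dif /cone_hpr /= !dif_hpr (chmap_hpr fC).
by rewrite (addmapN (ghomD (hpr_hom C _))) (ghomD (hpr_hom D _)).
Qed.

Lemma cone_dif2 x : cone_dif (cone_dif x) = 0.
Proof.
rewrite /cone_dif /= (addmapN (ghomD (dif_hom C))) dif_dif !oppr0.
rewrite (ghomD (dif_hom D)) dif_dif addr0 -(chmap_dif fC).
by rewrite (addmapN (ghomD (chmap_hom fC))) addNr.
Qed.

Definition cone : cpx n :=
  Cpx cone_hprP cone_hpr_hom cone_dif_hom cone_dif_hpr cone_dif2.
End Cone.

Section TensorCpx.
Variables (n : nat) (C D : cpx n).
Lemma predT_hom (f : Rn n) d : f \in predT -> pihomog mdeg d f \in predT.
Proof. by []. Qed.

Notation S := (predT : {pred Rn n}).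
Definition ct_tot : gbimod n := gtens_over predT_hom C D.

Lemma ct_alh (a : sc S) k (x : C) : sc_r a (hpr k x) = hpr k (sc_r a x).
Proof. by rewrite /sc_r (ghom_r (hpr_hom C k)). Qed.
Lemma ct_beh (a : sc S) k (x : D) : sc_l a (hpr k x) = hpr k (sc_l a x).
Proof. by rewrite /sc_l (ghom_l (hpr_hom D k)). Qed.
Lemma ct_ald (a : sc S) (x : C) : dif (sc_r a x) = sc_r a (dif x).
Proof. by rewrite /sc_r (ghom_r (dif_hom C)). Qed.
Lemma ct_bed (a : sc S) (x : D) : dif (sc_l a x) = sc_l a (dif x).
Proof. by rewrite /sc_l (ghom_l (dif_hom D)). Qed.

Definition ct_hpr : int -> ct_tot -> ct_tot := tgr (@hpr _ D) (hprP C).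
Definition ct_dif : ct_tot -> ct_tot := tdif (hprP C) (@dif _ C) (@dif _ D).

Let hb := h_balanced ct_alh ct_beh.

Lemma ct_hprP : is_grading ct_hpr.
Proof. exact: (tgr_grading (hprP C) (hprP D) (@sc_rD n S C) hb). Qed.

Lemma ct_hpr_hom k : ghom (ct_hpr k).
Proof.
have T := tgr_tmap0 (hprP C) (hprP D) (@sc_rD n S C) hb.
split=> [|r x|r x|d x]; first exact: (gradD ct_hprP).
- symmetry; apply: T => [|j y|//].
  + exact: ot_lcompat.
  + by rewrite (ghom_l (hpr_hom C j)).
- symmetry; apply: T => [|//|j y].
  + exact: ot_rcompat.
  + by rewrite (ghom_r (hpr_hom D j)).
- apply: (tgr_comm (hprP C) (hprP D) (prtP C) (prtP D) (@sc_rD n S C) hb).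
  + exact: sc_balanced predT_hom C D.
  + by move=> j e y; exact: (ghom_prt (hpr_hom C j)).
  + by move=> j e y; exact: (ghom_prt (hpr_hom D j)).
Qed.

Lemma ct_dif_hom : ghom ct_dif.
Proof.
have dC := ghomD (dif_hom C); have dD := ghomD (dif_hom D).
have T := tdif_tmap (hprP C) dC dD (@sc_rD n S C) ct_alh ct_ald ct_bed.
split=> [|r x|r x|d x].
- exact: (tdifD (hprP C) dC dD (@sc_rD n S C) ct_alh ct_ald ct_bed).
- apply: T => [|y|j y|//]; first exact: ot_lcompat.
    by rewrite (ghom_l (dif_hom C)).
  by rewrite (ghom_l (hpr_hom C j)).
- apply: T => [|//|//|y]; first exact: ot_rcompat.
  by rewrite (ghom_r (dif_hom D)).
- apply: (tdif_tgr (hprP C) dC dD (@sc_rD n S C) ct_alh ct_ald ct_bed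
    (prtP C) (prtP D) (sc_balanced predT_hom C D)).
  + by move=> j y; exact: (ghom_prt (dif_hom C)).
  + by move=> k j y; rewrite (ghom_prt (hpr_hom C j)).
  + by move=> j y; exact: (ghom_prt (dif_hom D)).
Qed.

Lemma ct_dif_hpr k x : ct_dif (ct_hpr k x) = ct_hpr (k + 1) (ct_dif x).
Proof.
have dC := ghomD (dif_hom C); have dD := ghomD (dif_hom D).
exact: (tdif_th (hprP C) (hprP D) dC dD (@sc_rD n S C) ct_alh ct_beh ct_ald
  ct_bed (@dif_hpr _ C) (@dif_hpr _ D)).
Qed.

Lemma ct_dif2 x : ct_dif (ct_dif x) = 0.
Proof.
have dC := ghomD (dif_hom C); have dD := ghomD (dif_hom D).
exact: (tdif2 (hprP C) dC dD (@sc_rD n S C) ct_alh ct_ald ct_bed (@dif_hpr _ C)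
  (@dif_dif _ C) (@dif_dif _ D)).
Qed.

Definition ctens : cpx n :=
  Cpx ct_hprP ct_hpr_hom ct_dif_hom ct_dif_hpr ct_dif2.
End TensorCpx.

Section ExternalCpx.
Variables (k l : nat) (C : cpx k) (D : cpx l).
Local Notation zC := (@zl k C).
Local Notation zD := (@zr l D).
Definition cs_hpr : int -> gsqcup C D -> gsqcup C D := tgr (@hpr _ D) (hprP C).
Definition cs_dif : gsqcup C D -> gsqcup C D :=
  tdif (hprP C) (@dif _ C) (@dif _ D).

Lemma cs_alh a j (x : C) : zC a (hpr j x) = hpr j (zC a x).
Proof. by case: a. Qed.
Lemma cs_beh a j (x : D) : zD a (hpr j x) = hpr j (zD a x).
Proof. by case: a. Qed.
Lemma cs_ald a (x : C) : dif (zC a x) = zC a (dif x).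
Proof. by case: a. Qed.
Lemma cs_bed a (x : D) : dif (zD a x) = zD a (dif x).
Proof. by case: a. Qed.

Lemma cs_hprP : is_grading cs_hpr.
Proof.
exact: (tgr_grading (hprP C) (hprP D) (@zlD _ C) (z_balanced _ _)).
Qed.

Lemma cs_hpr_hom j : ghom (cs_hpr j).
Proof.
split=> [|r x|r x|d x]; first exact: (gradD cs_hprP).
- symmetry; apply: (ext_act_tgr0 (lactP C) (lactP D) (hprP C) (hprP D)) => f e y.
    by rewrite (ghom_l (hpr_hom C e)).
  by rewrite (ghom_l (hpr_hom D e)).
- symmetry; apply: (ext_act_tgr0 (ractP C) (ractP D) (hprP C) (hprP D)) => f e y.
    by rewrite (ghom_r (hpr_hom C e)).
  by rewrite (ghom_r (hpr_hom D e)).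
- apply: (tgr_comm (hprP C) (hprP D) (prtP C) (prtP D) (@zlD _ C)).
  + exact: z_balanced.
  + exact: z_balanced.
  + by move=> i e y; exact: (ghom_prt (hpr_hom C i)).
  + by move=> i e y; exact: (ghom_prt (hpr_hom D i)).
Qed.

Lemma cs_dif_hom : ghom cs_dif.
Proof.
have dC := ghomD (dif_hom C); have dD := ghomD (dif_hom D).
have eD := koszulD (hprP C).
have E (a : Rn (k + l) -> gsqcup C D -> gsqcup C D) r x : addmap (a r) ->
    (forall u v y, addmap u -> addmap v ->
     (u = @dif _ C /\ v = id) \/ (u = koszul (hprP C) /\ v = @dif _ D) ->
     tmap u v (a r y) = a r (tmap u v y)) ->
    cs_dif (a r x) = a r (cs_dif x).
  move=> aD H; rewrite /cs_dif /tdif aD.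
  by rewrite !H //; [right|left].
split=> [|r x|r x|d x].
- exact: (tdifD (hprP C) dC dD (@zlD _ C) cs_alh cs_ald cs_bed).
- apply: E => [|u v y uD vD uv].
    exact: (actDr (ext_actP (lactP C) (lactP D))).
  apply: (ext_act_tmap (lactP C) (lactP D) _ _ uD vD) => g z;
    case: uv => -[uE vE]; rewrite ?uE ?vE ?(ghom_l (dif_hom _)) //.
  apply: koszul_comm; first exact: (actDr (lactP C)).
  by move=> i w; rewrite (ghom_l (hpr_hom C i)).
- apply: E => [|u v y uD vD uv].
    exact: (actDr (ext_actP (ractP C) (ractP D))).
  apply: (ext_act_tmap (ractP C) (ractP D) _ _ uD vD) => g z;
    case: uv => -[uE vE]; rewrite ?uE ?vE ?(ghom_r (dif_hom _)) //.
  apply: koszul_comm; first exact: (actDr (ractP C)).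
  by move=> i w; rewrite (ghom_r (hpr_hom C i)).
- apply: (tdif_tgr (hprP C) dC dD (@zlD _ C) cs_alh cs_ald cs_bed
    (prtP C) (prtP D) (z_balanced _ _)).
  + by move=> i y; exact: (ghom_prt (dif_hom C)).
  + by move=> i j y; rewrite (ghom_prt (hpr_hom C j)).
  + by move=> i y; exact: (ghom_prt (dif_hom D)).
Qed.

Lemma cs_dif_hpr j x : cs_dif (cs_hpr j x) = cs_hpr (j + 1) (cs_dif x).
Proof.
have dC := ghomD (dif_hom C); have dD := ghomD (dif_hom D).
exact: (tdif_th (hprP C) (hprP D) dC dD (@zlD _ C) cs_alh cs_beh cs_ald
  cs_bed (@dif_hpr _ C) (@dif_hpr _ D)).
Qed.

Lemma cs_dif2 x : cs_dif (cs_dif x) = 0.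
Proof.
have dC := ghomD (dif_hom C); have dD := ghomD (dif_hom D).
exact: (tdif2 (hprP C) dC dD (@zlD _ C) cs_alh cs_ald cs_bed (@dif_hpr _ C)
  (@dif_dif _ C) (@dif_dif _ D)).
Qed.

Definition csqcup : cpx (k + l) :=
  Cpx cs_hprP cs_hpr_hom cs_dif_hom cs_dif_hpr cs_dif2.
End ExternalCpx.

Section Rouquier.
Variable n : nat.

(* Generators are indexed by i : 'I_n.-1, counted from 0: s_ i exchanges the
   positions (variables, strands, entries) [lo i] = i and [hi i] = i + 1. *)
Lemma hi_proof (i : 'I_n.-1) : (i.+1 < n)%N.
Proof. by rewrite -ltn_predRL. Qed.

Definition lo (i : 'I_n.-1) : 'I_n := widen_ord (leq_pred n) i.
Definition hi (i : 'I_n.-1) : 'I_n := Ordinal (hi_proof i).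
Definition s_ (i : 'I_n.-1) : {perm 'I_n} := tperm (lo i) (hi i).

Definition Rinv (i : 'I_n.-1) : {pred Rn n} := fun f => msym (s_ i) f == f.

Lemma Rinv_hom i f d : f \in Rinv i -> pihomog mdeg d f \in Rinv i.
Proof. by rewrite !unfold_in /Rinv => /eqP h; rewrite msym_pihomog h. Qed.

Definition Bs (i : 'I_n.-1) : gbimod n :=
  gshift 1 (gtens_over (@Rinv_hom i) (gunit n) (gunit n)).

Definition B_mul (i : 'I_n.-1) : Bs i -> gshift 1 (gunit n) :=
  tlift (fun f g : Rn n => f * g).

Lemma B_mul_bal i : balanced (@sc_r n (Rinv i) (gunit n))
  (@sc_l n (Rinv i) (gunit n)) (fun f g : Rn n => f * g).
Proof.
split=> [g f f'|f g g'|a f g]; rewrite ?mulrDl ?mulrDr //.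
by rewrite /sc_r /sc_l /= mulrCA mulrA.
Qed.

Lemma B_mul_hom i : ghom (@B_mul i).
Proof.
have bal := B_mul_bal i; have D : addmap (@B_mul i) := tliftD bal.
have E f g : @B_mul i (tmk _ _ f g) = f * g := tliftE bal f g.
split=> [|r x|r x|d x]; first exact: D.
- have C := @ot_lcompat n (Rinv i) (gunit n) (gunit n) r.
  have L : addmap (@lact _ (Bs i) r) := actDr (lactP (Bs i)) r.
  move: x; apply: tens_ext => [x y|x y|f g].
  + by rewrite L D.
  + by rewrite D (actDr (lactP (gshift 1 (gunit n)))).
  by rewrite [lact r _](tmapE _ _ C) !E /= mulrA.
- have C := @ot_rcompat n (Rinv i) (gunit n) (gunit n) r.
  have L : addmap (@ract _ (Bs i) r) := actDr (ractP (Bs i)) r.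
  move: x; apply: tens_ext => [x y|x y|f g].
  + by rewrite L D.
  + by rewrite D (actDr (ractP (gshift 1 (gunit n)))).
  by rewrite [ract r _](tmapE _ _ C) !E /= mulrCA.
pose G := R_prtP n.
have SB := sc_balanced (@Rinv_hom i) (gunit n) (gunit n).
have L : addmap (@prt _ (Bs i) d) := gradD (prtP (Bs i)) d.
move: x; apply: (tens_hom_ext G G) => [x y|x y|a f b g].
- by rewrite L D.
- by rewrite D (gradD (prtP (gshift 1 (gunit n)))).
have T := tgr_hom G G (@sc_rD n (Rinv i) (gunit n)) SB (d + 1) a f b g.
rewrite [prt d _]T (if_morph _ _ D) E [RHS]/= /shift_prt /=.
case: (R_prt_cases a f) => [->|[k -> fk]].
  by rewrite mul0r (addmap0 (R_prtD _)) if_same.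
case: (R_prt_cases b g) => [->|[l -> gl]].
  by rewrite mulr0 (addmap0 (R_prtD _)) if_same.
by rewrite (R_prt_hom _ (dhomogM fk gl)) doubleD PoszD.
Qed.

Definition Fsigma (i : 'I_n.-1) : cpx n := twoterm (B_mul_hom i).

(* Products carry a trailing unit, so the empty one is R. *)
Definition cprod (s : seq (cpx n)) : cpx n := foldr (@ctens n) (cunit n) s.

(* Only positive braids occur; a braid is given by a word in the sigma_i,
   with Fsigma i = F(sigma_(i+1)). *)
Definition rouquier (w : seq 'I_n.-1) : cpx n := cprod [seq Fsigma i | i <- w].

(* sigma_(n-1) ... sigma_1 *)
Definition cox : seq 'I_n.-1 := rev (enum 'I_n.-1).

Definition FT : cpx n := rouquier (flatten (nseq n cox)).

Definition gtens (M N : gbimod n) : gbimod n := gtens_over (@predT_hom n) M N.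

Inductive SBim : gbimod n -> Prop :=
| SBim_R : SBim (gunit n)
| SBim_B i : SBim (Bs i)
| SBim_tens M N : SBim M -> SBim N -> SBim (gtens M N)
| SBim_sum M N : SBim M -> SBim N -> SBim (gsum M N)
| SBim_shift a M : SBim M -> SBim (gshift a M)
| SBim_summand M M' N : SBim N -> giso N (gsum M M') -> SBim M.

Definition bounded_above (C : cpx n) : Prop :=
  exists N : int, forall k, N < k -> forall x : C, hpr k x = 0.

Definition bounded (C : cpx n) : Prop :=
  exists N : int, forall k, N < `|k| -> forall x : C, hpr k x = 0.

Definition in_Kminus (C : cpx n) : Prop :=
  bounded_above C /\ forall k, SBim (chain C k).

Definition in_Kb (C : cpx n) : Prop :=
  bounded C /\ forall k, SBim (chain C k).

Definition Kb_equiv (C D : cpx n) : Prop := [/\ in_Kb C, in_Kb D & heq C D].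

(* q, t^(a/2) and t^a *)
Definition qsh (C : cpx n) : cpx n := csh (-2) 0 C.
Definition thalf (a : int) (C : cpx n) : cpx n := csh a (- a) C.
Definition tsh (a : int) (C : cpx n) : cpx n := thalf (2 * a) C.

Definition Xn : cpx n := thalf (1 - n%:Z) (rouquier cox).

(* a finite direct sum of shifts of products of r >= 1 of the B_i *)
Definition is_Bsum (M : gbimod n) : Prop :=
  exists2 s : seq (seq 'I_n.-1 * int), all (fun wa => wa.1 != [::]) s &
    giso M (foldr (@gsum n) (gzero n)
      [seq gshift wa.2 (foldr gtens (gunit n) [seq Bs i | i <- wa.1])
         | wa <- s]).

Record is_symmetrizer (P : cpx n) : Prop := IsSymmetrizer {
  symm_Kminus : in_Kminus P;
  symm_Bl : forall i, heq (ctens (conc (Bs i)) P) (czero n);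
  symm_Br : forall i, heq (ctens P (conc (Bs i))) (czero n);
  symm_unit : exists (f : cunit n -> P) (fC : is_chmap f) (D : cpx n),
    [/\ bounded_above D, forall k, is_Bsum (chain D k) & heq (cone fC) D] }.

(* u generates the group of homotopy classes of chain maps C -> D *)
Definition is_generator (C D : cpx n) (u : C -> D) : Prop :=
  forall f : C -> D, is_chmap f ->
    exists z : int, homotopic f (fun x => u x *~ z).
End Rouquier.

Definition ccast (a b : nat) (e : a = b) (C : cpx a) : cpx b :=
  ecast i (cpx i) e C.

(* K_n from a family Q; the factor number j (from 0) is Q_(j+1) |_| 1 *)
Definition Kn (Q : forall j, cpx j) (n : nat) : cpx n :=
  cprod [seq ccast (subnKC (ltn_ord j)) (csqcup (Q j.+1) (cunit (n - j.+1)))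
           | j <- enum 'I_n].

Section Cv.
Variables (m n : nat).
Implicit Types v : n.-tuple 'I_m.+1.

Definition mult v (j : 'I_m.+1) : nat := #|[set i | tnth v i == j]|.

(* r_0 + ... + r_(j-1) and r_j + ... + r_m *)
Definition low v (j : nat) : nat := (\sum_(i < m.+1 | i < j) mult v i)%N.
Definition high v (j : nat) : nat := (\sum_(i < m.+1 | j <= i) mult v i)%N.

Lemma low_high v j : (low v j + high v j)%N = n.
Proof.
have -> : high v j = (\sum_(i < m.+1 | ~~ (i < j)) mult v i)%N.
  by apply: eq_bigl => i; rewrite -leqNgt.
have -> : (low v j + \sum_(i < m.+1 | ~~ (i < j)) mult v i)%N =
    (\sum_(i < m.+1) mult v i)%N.
  by rewrite [RHS](bigID (fun i : 'I_m.+1 => (i < j)%N)).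
rewrite -[RHS](card_ord n) -sum1_card (partition_big (tnth v) predT) //=.
by apply: eq_bigr => i _; rewrite /mult -sum1dep_card.
Qed.

(* exchanging the entries of v in the positions given by w, each time
   exchanging x, y with x > y, sorts v *)
Fixpoint sorts (w : seq 'I_n.-1) v : Prop :=
  if w is i :: w' then
    (tnth v (hi i) < tnth v (lo i))%N /\
    sorts w' [tuple tnth v (s_ i j) | j < n]
  else sorted leq [seq val a | a <- v].

(* C_v^(m), computed from a word w for gamma_v *)
Definition Cv (Q : forall j, cpx j) v (w : seq 'I_n.-1) : cpx n :=
  cprod (rouquier w
    :: ccast (low_high v m) (csqcup (Kn Q (low v m)) (FT (high v m)))
    :: [seq ccast (low_high v j) (csqcup (cunit (low v j)) (FT (high v j)))
          | j <- rev (iota 1 m.-1)]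
    ++ [:: rouquier (rev w)]).
End Cv.

(* Main.v *)
(* If B_i (x) Z is contractible then F(sigma_i) (x) Z = (B_i (x) Z -> Z(1)) is
   equivalent to Z(1)[-1] = t^(1/2) Z.  This holds for Z = K_a |_| FT and all
   i < a: B_i kills P_a, hence Q_a, by (i), and by (ii) tensoring with P_j |_| 1,
   hence with Q_j |_| 1, preserves the complexes killed by the B_i.

   Let u sort v and let L be the number of v_i < k.  Words sorting kv and v(k-1)
   are shift(u) s_1 ... s_L and u s_n ... s_(L+1), any two sorting words being
   equal in the braid monoid, and with c = s_n ... s_1 the relation
   c s_(i+1) = s_i c moves c past shift(u).  On the left of K_a this leaves
   s_L ... s_1 s_1 ... s_L, whose 2L letters are absorbed by K_a and give t^L.
   On the right of K_a the two products of full twists differ in one factor, and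
   the full twist on the last n + 1 - L strands is the one on the last n - L
   strands times s_(L+1) ... s_n s_n ... s_(L+1).

   To compute with Rouquier complexes, B_i (x) C is replaced by C (+) C with
   1 (x) m + x_i (x) m' corresponding to (m, m'); the braid relation then becomes
   a finite computation with explicit 27 x 27 matrices. *)
Require Import Defs.
From HB Require Import structures.
From mathcomp Require Import all_boot all_order perm all_algebra.
From mathcomp Require Import boolp freeg mpoly ring zify.
Set Implicit Arguments.
Unset Strict Implicit.
Unset Printing Implicit Defensive.
Import Order.TTheory GRing.Theory Num.Theory.
Local Open Scope ring_scope.

(** * Reflection for abelian groups *)

(** The complexes P_j may be infinite in negative degrees, so contractibility must survive infinite
    constructions. A complex is stored as its total bimodule, a direct sum. A homotopy that
    contracts up to a locally nilpotent error can therefore be corrected by a geometric series,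
    finite on each element ([contr_nilpotent]). Split extensions and bounded above complexes with
    contractible columns reduce to this, and tensoring is packaged as a dg functor so that it can be
    applied to the cone of the unit map of P_j.

    No general interchange law between (x) and |_| is proved. The comparisons needed involve a
    factor B_i or F(sigma_i), which in the coordinate model only repeats the other factor two or
    three times.

    Two counts drive the combinatorics. As k < m, the entry k of kv is itself counted in r_0 + ... +
    r_(m-1), so K has more than L strands and absorbs all letters below L. The partial sums r_0 +
    ... + r_(j-1) of kv and v(k-1) agree except at j = k, where they are L and L + 1; this is the
    one twist that differs. *)

Inductive zexp := ZVar of nat | ZAdd of zexp & zexp | ZOpp of zexp | ZZero.

Fixpoint zeval (V : zmodType) (l : seq V) (e : zexp) : V :=
  match e with
  | ZVar i => nth 0 l i
  | ZAdd e f => zeval l e + zeval l f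
  | ZOpp e => - zeval l e
  | ZZero => 0
  end.

Fixpoint zcoef (e : zexp) (i : nat) : int :=
  match e with
  | ZVar j => if i == j then 1 else 0
  | ZAdd e f => zcoef e i + zcoef f i
  | ZOpp e => - zcoef e i
  | ZZero => 0
  end.

Lemma zevalE (V : zmodType) (l : seq V) e :
  zeval l e = \sum_(i < size l) nth 0 l i *~ zcoef e i.
Proof.
elim: e => [j|e IHe f IHf|e IH|] /=.
- have [jl|lj] := ltnP j (size l).
    rewrite (bigD1 (Ordinal jl)) //= eqxx big1 ?addr0 // => i.
    by rewrite -val_eqE /= => /negPf->.
  rewrite nth_default // big1 // => i _.
  by case: eqP => // ij; rewrite -ij leqNgt ltn_ord in lj.
- by rewrite IHe IHf -big_split; apply: eq_bigr => i _; rewrite mulrzDr.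
- by rewrite IH -sumrN; apply: eq_bigr => i _; rewrite mulrNz.
- by rewrite big1.
Qed.

(** The number of atoms is passed as a numeral, so that the side condition is closed and computes
    without touching the atoms themselves. *)
Lemma zeval_eq (V : zmodType) (m : nat) (l : seq V) e f : size l = m ->
  all (fun i => zcoef e i == zcoef f i) (iota 0 m) -> zeval l e = zeval l f.
Proof.
move=> <- /allP h; rewrite !zevalE; apply: eq_bigr => i _.
by rewrite (eqP (h i _)) // mem_iota /=.
Qed.

(* syntactic equality up to the choice of canonical instances *)
Ltac zsame x y :=
  first [ constr_eq x y
        | lazymatch x with
          | ?f ?u => lazymatch y with ?g ?v => zsame f g; zsame u v end
          end
        | lazymatch type of x with
          | Algebra.BaseAddMagma.type => unify x y
          | Algebra.BaseZmodule.type => unify x y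
          | Algebra.Nmodule.type => unify x y
          | Algebra.Zmodule.type => unify x y
          | GRing.PzSemiRing.type => unify x y
          | GRing.NzSemiRing.type => unify x y
          | GRing.PzRing.type => unify x y
          | GRing.NzRing.type => unify x y
          | GRing.UnitRing.type => unify x y
          end ].

Ltac zmem x l :=
  match l with
  | nil => constr:(false)
  | cons ?y ?l' => let u := match goal with _ => constr:(ltac:(first [zsame x y;
    exact true | exact false])) end in
     match u with true => constr:(true) | false => zmem x l' end
  end.

Ltac zatoms t l :=
  match t with
  | (?x + ?y)%R => let l1 := zatoms x l in zatoms y l1
  | (- ?x)%R => zatoms x l
  | 0%R => l
  | _ => let b := zmem t l in match b with true => l | false => constr:(cons t l) end
  end.

Ltac zidx x l :=
  match l with
  | cons ?y ?l' =>
     let u := match goal with _ => constr:(ltac:(first [zsame x y;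
       exact true | exact false])) end in
     match u with true => constr:(O) | false => let i := zidx x l' in constr:(S i) end
  end.

Ltac zreify t l :=
  match t with
  | (?x + ?y)%R => let a := zreify x l in let b := zreify y l in constr:(ZAdd a b)
  | (- ?x)%R => let a := zreify x l in constr:(ZOpp a)
  | 0%R => constr:(ZZero)
  | _ => let i := zidx t l in constr:(ZVar i)
  end.

Ltac zlen l :=
  match l with
  | nil => constr:(O)
  | cons _ ?l' => let i := zlen l' in constr:(S i)
  end.

(* identities between sums in an abelian group, by comparing the integer
   coefficients of the atoms on both sides *)
Ltac zmod :=
  match goal with |- @eq ?V ?a ?b =>
    let l0 := zatoms a (@nil V) in let l := zatoms b l0 in
    let e := zreify a l in let f := zreify b l in
    let m := zlen l in
    refine (@zeval_eq _ m l e f (erefl m) _); vm_compute; reflexivity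
  end.

(** * Homs and homotopies *)

Definition sg (s : int) : int := (-1) ^+ absz s.

Lemma sgE s : sg s = (-1) ^ s.
Proof. by case: s => j; rewrite /sg //= NegzE abszN absz_nat -exprnN exprVn invrN1. Qed.

Lemma sgD s t : sg (s + t) = sg s * sg t.
Proof. by rewrite !sgE exprzDr ?unitrN1. Qed.

Lemma sg_sq s : sg s * sg s = 1.
Proof. by rewrite /sg -exprMn mulrNN mulr1 expr1n. Qed.

Lemma mulzsgK (V : zmodType) s (x : V) : x *~ sg s *~ sg s = x.
Proof. by rewrite -mulrzA sg_sq mulr1z. Qed.

Lemma addmap_mulz (V : zmodType) (c : int) : addmap (fun x : V => x *~ c).
Proof. by move=> x y; rewrite mulrzDl. Qed.

Section Ghom.
Variable n : nat.
Implicit Types M N : gbimod n.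

Lemma ghom_add M N (f g : M -> N) : ghom f -> ghom g -> ghom (f \+ g).
Proof.
move=> [fD fl fr fp] [gD gl gr gp]; split=> [x y|r x|r x|d x] /=.
- by rewrite fD gD addrACA.
- by rewrite fl gl (actDr (lactP N)).
- by rewrite fr gr (actDr (ractP N)).
- by rewrite fp gp (gradD (prtP N)).
Qed.

Lemma ghom_mulz M N (f : M -> N) (c : int) :
  ghom f -> ghom (fun x => f x *~ c).
Proof.
move=> [fD fl fr fp]; split=> [x y|r x|r x|d x] /=.
- by rewrite fD mulrzDl.
- by rewrite fl (addmapMz (actDr (lactP N) r)).
- by rewrite fr (addmapMz (actDr (ractP N) r)).
- by rewrite fp (addmapMz (gradD (prtP N) d)).
Qed.

Lemma ghom_zero M N : ghom (fun _ : M => 0 : N).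
Proof.
split=> [x y|r x|r x|d x]; rewrite ?addr0 //.
- by rewrite (addmap0 (actDr (lactP N) r)).
- by rewrite (addmap0 (actDr (ractP N) r)).
- by rewrite (addmap0 (gradD (prtP N) d)).
Qed.
End Ghom.

Section Hom.
Variable n : nat.
Implicit Types C D E : cpx n.

(** Elements of degree s of the Hom complex, not necessarily cycles. Chain maps are the cycles of
    degree 0 and homotopies have degree -1, so that a functor can be described on all of them at
    once. *)
Record chom (s : int) C D (f : C -> D) : Prop := CHom {
  chom_g : ghom f;
  chom_hpr : forall k x, f (hpr k x) = hpr (k + s) (f x) }.

(* the differential [d, f] = d f - (-1)^s f d of the Hom complex *)
Definition dg (s : int) C D (f : C -> D) (x : C) : D :=
  dif (f x) - f (dif x) *~ sg s.

Lemma dgN1 C D (f : C -> D) x : dg (-1) f x = dif (f x) + f (dif x).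
Proof. by rewrite /dg mulrN1z opprK. Qed.

Lemma difD C : addmap (@dif _ C). Proof. exact: ghomD (dif_hom C). Qed.
Lemma hprD C k : addmap (@hpr _ C k). Proof. exact: ghomD (hpr_hom C k). Qed.

Lemma chomD s C D (f : C -> D) : chom s f -> addmap f.
Proof. by case=> /ghomD. Qed.

Lemma chom_comp s t u C D E (f : D -> E) (g : C -> D) :
  chom s f -> chom t g -> u = t + s -> chom u (f \o g).
Proof.
move=> [fg fh] [gg gh] ->; split=> [|k x] /=; first exact: ghom_comp.
by rewrite gh fh addrA.
Qed.

Lemma chom_id C : chom 0 (@id C).
Proof. by split=> // k x; rewrite addr0. Qed.

Lemma chom_add s C D (f g : C -> D) : chom s f -> chom s g -> chom s (f \+ g).
Proof.
move=> [fg fh] [gg gh]; split=> [|k x]; first exact: ghom_add.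
by rewrite /= fh gh hprD.
Qed.

Lemma chom_mulz s C D (f : C -> D) (c : int) :
  chom s f -> chom s (fun x => f x *~ c).
Proof.
move=> [fg fh]; split=> [|k x]; first exact: ghom_mulz.
by rewrite /= fh (addmapMz (@hprD _ _)).
Qed.

Lemma chom_zero s C D : chom s (fun _ : C => 0 : D).
Proof. by split=> [|k x]; [exact: ghom_zero|rewrite (addmap0 (@hprD _ _))]. Qed.

Lemma chom_dif C : chom 1 (@dif _ C).
Proof. by split=> [|k x]; [exact: dif_hom|rewrite dif_hpr]. Qed.

Lemma chom_hpr0 C k : chom 0 (@hpr _ C k).
Proof.
split=> [|j x]; first exact: hpr_hom.
by rewrite addr0 !(gradK (hprP C)) eq_sym; case: eqP => // ->.
Qed.

Lemma chom_sub s C D (f g : C -> D) :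
  chom s f -> chom s g -> chom s (fun x => f x - g x).
Proof.
move=> fH gH; have := chom_add fH (chom_mulz (-1) gH).
by congr chom; apply/funext => x; rewrite /= mulrN1z.
Qed.

Lemma chom_dg s C D (f : C -> D) : chom s f -> chom (s + 1) (dg s f).
Proof.
move=> fH; apply: chom_sub; first exact: (chom_comp (chom_dif D) fH).
apply: chom_mulz; apply: (chom_comp fH (chom_dif C)); exact: addrC.
Qed.

Lemma chmap_homP C D (f : C -> D) :
  is_chmap f <-> chom 0 f /\ forall x, dg 0 f x = 0.
Proof.
split=> [[fg fh fd]|[[fg fh] fd]].
  split=> [|x]; first by split=> // k x; rewrite fh addr0.
  by rewrite /dg fd subrr.
split=> // [k x|x]; first by rewrite fh addr0.
by have /eqP := fd x; rewrite subr_eq0 => /eqP->.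
Qed.

Lemma chmap_hom0 C D (f : C -> D) : is_chmap f -> chom 0 f.
Proof. by move/chmap_homP => []. Qed.

Lemma chmap_D C D (f : C -> D) : is_chmap f -> addmap f.
Proof. by case=> /ghomD. Qed.

Lemma chmap_comp C D E (f : D -> E) (g : C -> D) :
  is_chmap f -> is_chmap g -> is_chmap (f \o g).
Proof.
move=> [fg fh fd] [gg gh gd]; split=> [|k x|x] /=; first exact: ghom_comp.
  by rewrite gh fh.
by rewrite gd fd.
Qed.

Lemma chmap_inv C D (f : C -> D) (g : D -> C) :
  is_chmap f -> cancel f g -> cancel g f -> is_chmap g.
Proof.
move=> [[fD fl fr fp] fh fd] fK gK.
split=> [|k x|x]; [split=> [x y|r x|r x|d x]|..]; apply: (can_inj fK).
- by rewrite fD !gK.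
- by rewrite fl !gK.
- by rewrite fr !gK.
- by rewrite fp !gK.
- by rewrite fh !gK.
- by rewrite fd !gK.
Qed.

Lemma homotopicE C D (f g : C -> D) : homotopic f g <->
  exists2 h : C -> D, chom (-1) h & forall x, f x - g x = dg (-1) h x.
Proof.
have E (h : C -> D) x : dg (-1) h x = dif (h x) + h (dif x).
  by rewrite /dg mulrN1z opprK.
split=> [[h [hg hh] hE]|[h [hg hh] hE]]; exists h => //.
- by move=> x; rewrite hE E.
- by move=> x; rewrite hE E.
Qed.

Lemma homotopic_refl C D (f : C -> D) : homotopic f f.
Proof.
apply/homotopicE; exists (fun _ => 0); first exact: chom_zero.
by move=> x; rewrite /dg (addmap0 (@difD _)) mul0rz subr0 subrr.
Qed.

Lemma homotopic_trans C D (f g e : C -> D) :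
  homotopic f g -> homotopic g e -> homotopic f e.
Proof.
move=> [h [hg hh] hE] [h' [hg' hh'] hE']; exists (h \+ h').
  by split=> [|k x]; [exact: ghom_add|rewrite /= hh hh' hprD].
by move=> x; rewrite -(subrKA (g x)) hE hE' /= difD addrACA.
Qed.

Lemma homotopic_compl C D E (f : D -> E) (g g' : C -> D) :
  is_chmap f -> homotopic g g' -> homotopic (f \o g) (f \o g').
Proof.
move=> [fg fh fd] [h [hg hh] hE]; exists (f \o h).
  by split=> [|k x]; [exact: ghom_comp|rewrite /= hh fh].
move=> x /=; rewrite -(addmapB (ghomD fg)) hE (ghomD fg) fd; done.
Qed.

Lemma homotopic_compr C D E (f f' : D -> E) (g : C -> D) :
  is_chmap g -> homotopic f f' -> homotopic (f \o g) (f' \o g).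
Proof.
move=> [gg gh gd] [h [hg hh] hE]; exists (h \o g).
  by split=> [|k x]; [exact: ghom_comp|rewrite /= gh hh].
by move=> x /=; rewrite hE gd.
Qed.

Lemma heq_refl C : heq C C.
Proof. by exists id, id; split=> //; exact: homotopic_refl. Qed.

Lemma heq_sym C D : heq C D -> heq D C.
Proof. by move=> [f [g [fC gC fg gf]]]; exists g, f. Qed.

Lemma heq_trans D C E : heq C D -> heq D E -> heq C E.
Proof.
move=> [f [g [fC gC gf fg]]] [f' [g' [fC' gC' gf' fg']]].
exists (f' \o f), (g \o g'); split; [exact: chmap_comp..| |].
- apply: homotopic_trans gf.
  exact: (homotopic_compl gC (homotopic_compr fC gf')).
- apply: homotopic_trans fg'.
  exact: (homotopic_compl fC' (homotopic_compr gC' fg)).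
Qed.

Definition ciso C D : Prop := exists (f : C -> D) (g : D -> C),
  [/\ is_chmap f, cancel f g & cancel g f].

Lemma ciso_heq C D : ciso C D -> heq C D.
Proof.
move=> [f [g [fC fK gK]]]; exists f, g.
have gC := chmap_inv fC fK gK; split=> //.
  have -> : g \o f = id by apply/funext => x /=; rewrite fK.
  exact: homotopic_refl.
have -> : f \o g = id by apply/funext => x /=; rewrite gK.
exact: homotopic_refl.
Qed.

Lemma ciso_sym C D : ciso C D -> ciso D C.
Proof. by move=> [f [g [fC fK gK]]]; exists g, f; split=> //; exact: chmap_inv fC _ _. Qed.

Lemma ciso_trans D C E : ciso C D -> ciso D E -> ciso C E.
Proof.
move=> [f [g [fC fK gK]]] [f' [g' [fC' fK' gK']]].
exists (f' \o f), (g \o g'); split; first exact: chmap_comp.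
  exact: can_comp.
exact: can_comp.
Qed.

Lemma giso_sym (M N : gbimod n) : giso M N -> giso N M.
Proof. by move=> [f [g [fH gH fK gK]]]; exists g, f. Qed.

Lemma giso_trans (N M P : gbimod n) : giso M N -> giso N P -> giso M P.
Proof.
move=> [f [g [fC gC fK gK]]] [f' [g' [fC' gC' fK' gK']]].
exists (f' \o f), (g \o g'); split; try exact: ghom_comp.
  exact: can_comp.
exact: can_comp.
Qed.

Lemma ciso_giso C D : ciso C D -> giso C D.
Proof.
by move=> [f [g [fC fK gK]]]; exists f, g; split=> //; apply: chmap_hom => //;
  apply: chmap_inv fC _ _.
Qed.

Lemma giso_conc (M N : gbimod n) : giso M N -> ciso (conc M) (conc N).
Proof.
move=> [f [g [fC gC fK gK]]]; exists f, g; split=> //.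
split=> // [k x|x] /=; first by rewrite (if_morph _ _ (ghomD fC)).
exact: (addmap0 (ghomD fC)).
Qed.

Definition contr C : Prop :=
  exists2 h : C -> C, chom (-1) h & forall x, x = dg (-1) h x.

(** With id = [d, h] on C and f g - id = [d, k] on D, the map f h g - k contracts D. *)
Lemma contr_heq C D : heq C D -> contr C -> contr D.
Proof.
move=> [f [g [fC gC gf /homotopicE [k kH kE]]]] [h hH hE].
exists (fun x => f (h (g x)) - k x).
  apply: chom_sub kH; apply: (@chom_comp (-1) 0 _ _ _ _ (f \o h) g) => //.
    by apply: (chom_comp (chmap_hom0 fC) hH); rewrite addr0.
  exact: chmap_hom0.
move=> x; have E : f (g x) = dif (f (h (g x))) + f (h (g (dif x))).
  rewrite -(chmap_dif fC) (chmap_dif gC) -(chmap_D fC) {1}[g x]hE.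
  by rewrite /dg mulrN1z opprK.
have := kE x; rewrite /= E /dg !mulrN1z !opprK => {}kE.
rewrite (addmapB (@difD _)).
set u := dif (f _) in kE *; set v := f (h _) in kE *.
have -> : u - dif (k x) + (v - k (dif x)) = u + v - (dif (k x) + k (dif x)).
  by zmod.
by rewrite -kE; zmod.
Qed.

Lemma contr_czero : contr (czero n).
Proof. by exists (fun _ => 0); [exact: chom_zero|move=> x; exact: zero_eq]. Qed.

Lemma heq_contr C : heq C (czero n) -> contr C.
Proof. by move=> /heq_sym/contr_heq; apply; exact: contr_czero. Qed.
End Hom.

(** * Contractible complexes and split extensions *)

Section Perturbation.
Variables (n : nat) (C : cpx n) (h : C -> C).
Hypothesis hH : chom (-1) h.
Let A (x : C) : C := x - dg (-1) h x.
Hypothesis Anil : forall x, exists m, forall m', (m <= m')%N -> iter m' A x = 0.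

Let AD : addmap A.
Proof.
move=> x y; rewrite /A /dg !(difD, chomD hH) mulrzDl; zmod.
Qed.

Let iterD m : addmap (iter m A).
Proof. by elim: m => [|m IH] x y //=; rewrite IH AD. Qed.

(** The Neumann series for the inverse of [dg (-1) h] = 1 - A. The number of terms depends on the
    element, and by [geomE] any larger number gives the same value. *)
Let geom x : C := \sum_(i < projT1 (cid (Anil x))) iter i A x.

Let geomE x m : (forall m', (m <= m')%N -> iter m' A x = 0) ->
  geom x = \sum_(i < m) iter i A x.
Proof.
rewrite /geom; case: (cid _) => /= k hk hm.
have E a b : (forall m', (a <= m')%N -> iter m' A x = 0) -> (a <= b)%N ->
    \sum_(i < b) iter i A x = \sum_(i < a) iter i A x.
  move=> ha ab; rewrite -!(big_mkord predT (fun i => iter i A x)).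
  rewrite (@big_cat_nat _ _ _ a) //= [X in _ + X]big_nat_cond [X in _ + X]big1 ?addr0 //.
  by move=> i /andP[/andP[ai _] _]; exact: ha.
by have [km|mk] := leqP k m; [rewrite (E k m)|rewrite (E m k) // ltnW].
Qed.

Let geom_comm (f : C -> C) : addmap f -> (forall x, A (f x) = f (A x)) ->
  forall x, geom (f x) = f (geom x).
Proof.
move=> fD fA x; have fI m y : iter m A (f y) = f (iter m A y).
  by elim: m => //= m ->.
have [m hm] := Anil x; rewrite (geomE hm) (@geomE _ m); last first.
  by move=> m' mm; rewrite fI hm // (addmap0 fD).
by rewrite (addmap_sum fD); apply: eq_bigr => i _; rewrite fI.
Qed.

Let geomD : addmap geom.
Proof.
move=> x y; have [m hm] := Anil x; have [k hk] := Anil y.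
have hm' m' : (m + k <= m')%N -> iter m' A x = 0.
  by move=> h'; apply: hm; exact: leq_trans (leq_addr _ _) h'.
have hk' m' : (m + k <= m')%N -> iter m' A y = 0.
  by move=> h'; apply: hk; exact: leq_trans (leq_addl _ _) h'.
rewrite (geomE hm') (geomE hk') (@geomE _ (m + k)).
  by rewrite -big_split; apply: eq_bigr => i _; rewrite iterD.
by move=> m' h'; rewrite iterD hm' // hk' // addr0.
Qed.

(** Since A = 1 - [d, h] is locally nilpotent, [d, h] is invertible, with inverse [geom]. This
    inverse commutes with d, the gradings and both actions because [d, h] does, so h composed with
    it is a homotopy whose boundary is the identity. *)
Lemma contr_nilpotent : contr C.
Proof.
have dgH : chom (-1 + 1) (dg (-1) h) := chom_dg hH.
have AC (f : C -> C) : addmap f -> (forall x, dg (-1) h (f x) = f (dg (-1) h x)) ->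
    forall x, A (f x) = f (A x).
  by move=> fD fd x; rewrite /A fd [RHS](addmapB fD).
have [[_ dl dr dp] dh] := dgH; rewrite addNr in dh.
have gH : chom 0 geom.
  split; [split=> [|r x|r x|d x]|move=> k x].
  - exact: geomD.
  - apply: geom_comm; first exact: (actDr (lactP C)).
    by apply: AC => [|y]; [exact: (actDr (lactP C))|rewrite dl].
  - apply: geom_comm; first exact: (actDr (ractP C)).
    by apply: AC => [|y]; [exact: (actDr (ractP C))|rewrite dr].
  - apply: geom_comm; first exact: (gradD (prtP C)).
    by apply: AC => [|y]; [exact: (gradD (prtP C))|rewrite dp].
  - rewrite addr0; apply: geom_comm; first exact: hprD.
    by apply: AC => [|y]; [exact: hprD|rewrite dh addr0].
exists (h \o geom); first by apply: (chom_comp hH gH); rewrite add0r.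
move=> x; have gd : geom (dif x) = dif (geom x).
  apply: geom_comm; first exact: difD.
  apply: AC => [|y]; first exact: difD.
  by rewrite !dgN1 difD !dif_dif (addmap0 (chomD hH)) addr0 add0r.
rewrite dgN1 /= gd -dgN1.
have -> : dg (-1) h (geom x) = geom x - A (geom x) by rewrite /A; zmod.
have [m hm] := Anil x; rewrite (geomE hm).
suff -> : \sum_(i < m) iter i A x - A (\sum_(i < m) iter i A x) = x - iter m A x.
  by rewrite hm // subr0.
elim: m {hm} => [|m IH]; first by rewrite big_ord0 (addmap0 AD) /= !subrr.
rewrite big_ord_recr AD.
have -> (a b c d : C) : a + b - (c + d) = (a - c) + (b - d) by zmod.
by rewrite IH /= subrKA.
Qed.
End Perturbation.

Lemma contr_csh n (C : cpx n) a b : contr C -> contr (csh a b C).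
Proof.
move=> [h hH hE]; exists (fun x => h x *~ sg b).
  have [[hD hl hr hp] hh] := chom_mulz (sg b) hH; split.
    split=> // d x; exact: hp.
  by move=> k x; rewrite /= /sh_hpr hh addrAC.
move=> x; rewrite {1}[x]hE /dg /= /sh_dif -/(sg b).
rewrite (addmapMz (@difD _ _)) (addmapMz (chomD hH)) /=.
congr (_ - _ *~ _); exact: esym (mulzsgK b _).
Qed.

(* an extension of B by A which splits as an extension of bigraded bimodules *)
Record sext n (A W B : cpx n) (i : A -> W) (r : W -> A) (p : W -> B)
    (s : B -> W) : Prop := Sext {
  sext_i : is_chmap i;
  sext_r : chom 0 r;
  sext_p : is_chmap p;
  sext_s : chom 0 s;
  sext_ri : forall x, r (i x) = x;
  sext_ps : forall x, p (s x) = x;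
  sext_sum : forall x, i (r x) + s (p x) = x }.

Section Extension.
Variables (n : nat) (A W B : cpx n).
Variables (i : A -> W) (r : W -> A) (p : W -> B) (s : B -> W).
Hypothesis E : sext i r p s.
Let iD : addmap i := chmap_D (sext_i E).
Let rD : addmap r := chomD (sext_r E).
Let pD : addmap p := chmap_D (sext_p E).
Let sD : addmap s := chomD (sext_s E).

Lemma sext_pi x : p (i x) = 0.
Proof.
have := congr1 p (sext_sum E (i x)); rewrite pD (sext_ps E) (sext_ri E).
by rewrite -{3}[p (i x)]addr0 => /addrI.
Qed.

(** In the coordinates A + B the differential of W is triangular, and t is its off-diagonal entry
    from B to A. *)
Let t x := r (dif (s x)).
Let tD : addmap t. Proof. by move=> x y; rewrite /t sD difD rD. Qed.

Let ds x : dif (s x) = s (dif x) + i (t x).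
Proof.
rewrite -{1}(sext_sum E (dif (s x))) addrC (chmap_dif (sext_p E)).
by rewrite (sext_ps E).
Qed.

Let rd x : r (dif x) = dif (r x) + t (p x).
Proof.
rewrite -{1}(sext_sum E x) difD rD -(chmap_dif (sext_i E)) (sext_ri E).
by [].
Qed.

(** The diagonal homotopy i a r + s b p contracts W up to an error that factors through p and lands
    in the image of i. As p i = 0, the error has square zero and [contr_nilpotent] applies. *)
Lemma contr_mid : contr A -> contr B -> contr W.
Proof.
move=> [a aH aE] [b bH bE].
have aD := chomD aH; have bD := chomD bH.
pose h x := i (a (r x)) + s (b (p x)).
have hH : chom (-1) h.
  apply: chom_add.
    apply: (@chom_comp _ (-1) 0 _ _ _ _ (i \o a)) => //; last exact: sext_r E.
    by apply: (chom_comp (chmap_hom0 (sext_i E)) aH); rewrite addr0.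
  apply: (@chom_comp _ (-1) 0 _ _ _ _ (s \o b)) => //.
    by apply: (chom_comp (sext_s E) bH); rewrite addr0.
  exact: chmap_hom0 (sext_p E).
have aE' x : dif (a x) + a (dif x) = x by rewrite [RHS]aE dgN1.
have bE' x : dif (b x) + b (dif x) = x by rewrite [RHS]bE dgN1.
have eE x : x - dg (-1) h x = i (- (t (b (p x)) + a (t (p x)))).
  rewrite dgN1 /h difD -(chmap_dif (sext_i E)) ds rd.
  rewrite (chmap_dif (sext_p E)) aD iD.
  rewrite (addmapN iD) (iD (t _)).
  rewrite -[X in X - _](sext_sum E x) -{1}(aE' (r x)) -{1}(bE' (p x)) iD sD.
  zmod.
apply: (contr_nilpotent hH) => x; exists 2 => m.
case: m => [|[|m]] // _; elim: m => [|m IH]; last first.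
  rewrite iterS IH !eE (addmap0 pD) (addmap0 bD) (addmap0 tD) (addmap0 aD).
  by rewrite addr0 oppr0 (addmap0 iD).
rewrite /= [X in X - _]eE [in X in _ - X]eE -[LHS]/(_ - dg (-1) h _) eE.
by rewrite sext_pi (addmap0 bD) (addmap0 tD) (addmap0 aD) addr0 oppr0 (addmap0 iD).
Qed.

(** The boundary of r h i is 1 - t q, where q = p h i anticommutes with d. Since b contracts B, q is
    the boundary of b q up to sign, and subtracting t b q removes the defect t q. *)
Lemma contr_sub : contr W -> contr B -> contr A.
Proof.
move=> [h hH hE] [b bH bE].
have hD := chomD hH; have bD := chomD bH.
have hE' x : dif (h x) + h (dif x) = x by rewrite [RHS]hE dgN1.
have bE' x : dif (b x) + b (dif x) = x by rewrite [RHS]bE dgN1.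
have tH : chom 1 t.
  apply: (@chom_comp _ 0 1 _ _ _ _ r (fun x => dif (s x))) => //; first exact: sext_r E.
  by apply: (chom_comp (chom_dif W) (sext_s E)).
pose q x := p (h (i x)).
have qH : chom (-1) q.
  apply: (@chom_comp _ (-1) 0 _ _ _ _ (p \o h)) => //; last exact: chmap_hom0 (sext_i E).
  by apply: (chom_comp (chmap_hom0 (sext_p E)) hH); rewrite addr0.
have qd x : dif (q x) + q (dif x) = 0.
  rewrite /q -(chmap_dif (sext_p E)) (chmap_dif (sext_i E)) -pD hE'.
  exact: sext_pi.
have td x : dif (t x) + t (dif x) = 0.
  have H := dif_dif (s x); rewrite ds difD ds dif_dif (addmap0 sD) add0r in H.
  move: H; rewrite -(chmap_dif (sext_i E)) -iD => /(congr1 r).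
  by rewrite (sext_ri E) (addmap0 rD) addrC.
exists (fun x => r (h (i x)) - t (b (q x))).
  apply: chom_sub.
    apply: (@chom_comp _ (-1) 0 _ _ _ _ (r \o h)) => //; last exact: chmap_hom0 (sext_i E).
    by apply: (chom_comp (sext_r E) hH); rewrite addr0.
  apply: (@chom_comp _ 0 (-1) _ _ _ _ (fun x => t (b x))) => //.
  by apply: (chom_comp tH bH).
move=> x; rewrite dgN1 (addmapB (@difD _ _)).
have t1 : dif (t (b (q x))) = - t (dif (b (q x))).
  by apply/eqP; rewrite -subr_eq0 opprK td.
have q1 : q (dif x) = - dif (q x).
  by apply/eqP; rewrite -subr_eq0 opprK addrC qd.
have r1 : dif (r (h (i x))) = r (dif (h (i x))) - t (q x) by rewrite rd addrK.
rewrite t1 q1 r1 (addmapN bD) (addmapN tD) (chmap_dif (sext_i E)).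
have e1 : r (dif (h (i x))) + r (h (dif (i x))) = x.
  by rewrite -rD hE' (sext_ri E).
have e2 : t (dif (b (q x))) + t (b (dif (q x))) = t (q x) by rewrite -tD bE'.
by rewrite -{1}e1 -e2; zmod.
Qed.
End Extension.

Lemma cone_sext n (C D : cpx n) (f : C -> D) (fC : is_chmap f) :
  sext (A := D) (W := cone fC) (B := csh 0 1 C)
    (fun y => (0, y)) (fun x => x.2) (fun x => x.1) (fun x => (x, 0)).
Proof.
split=> //.
- split=> [|k y|y] /=.
  + split=> [x y|r x|r x|d x]; first by rewrite pair_add addr0.
    * by rewrite /= /sum_lact /= (addmap0 (actDr (lactP C) r)).
    * by rewrite /= /sum_ract /= (addmap0 (actDr (ractP C) r)).
    * by rewrite /= /pair_gr /= (addmap0 (gradD (prtP C) d)).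
  + by rewrite /cone_hpr /= (addmap0 (@hprD _ _ _)).
  + rewrite /cone_dif /= (addmap0 (@difD _ _)) oppr0.
    by rewrite (addmap0 (chmap_D fC)) add0r.
- by split=> [|k y] //=; rewrite addr0.
- split=> [|k y|[x y]] //=.
  by split=> // d x; rewrite /= /shift_prt addr0.
- split=> [|k y] /=.
  + split=> [x y|r x|r x|d x]; first by rewrite pair_add addr0.
    * by rewrite /= /sum_lact /= (addmap0 (actDr (lactP D) r)).
    * by rewrite /= /sum_ract /= (addmap0 (actDr (ractP D) r)).
    * by rewrite /= /pair_gr /shift_prt /= addr0 (addmap0 (gradD (prtP D) d)).
  + by rewrite /cone_hpr /= addr0 (addmap0 (@hprD _ _ _)).
- by move=> [x y] /=; rewrite pair_add addr0 add0r.
Qed.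

(** * Functors between categories of complexes *)

(* A dg functor from complexes over R_j to complexes over R_n which commutes
   with shifts and with possibly infinite direct sum decompositions. *)
Record dgfun (j n : nat) := Dgfun {
  ob :> cpx j -> cpx n;
  mp : int -> forall C D : cpx j, (C -> D) -> ob C -> ob D;
  mp_hom : forall s (C D : cpx j) (f : C -> D), chom s f -> chom s (mp s f);
  mp_id : forall (C : cpx j) (x : ob C), mp 0 (@id C) x = x;
  mp_comp : forall s t (C D E : cpx j) (f : D -> E) (g : C -> D),
    chom s f -> chom t g -> forall x, mp (t + s) (f \o g) x = mp s f (mp t g x);
  mp_add : forall s (C D : cpx j) (f g : C -> D), chom s f -> chom s g ->
    forall x, mp s (f \+ g) x = mp s f x + mp s g x;
  mp_dg : forall s (C D : cpx j) (f : C -> D), chom s f ->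
    forall x, mp (s + 1) (dg s f) x = dg s (mp s f) x;
  mp_gr : forall (C : cpx j) (p : int -> C -> C), is_grading p ->
    (forall k, chom 0 (p k)) -> is_grading (fun k => mp 0 (p k));
  mp_sh : forall a b (C : cpx j), ciso (ob (csh a b C)) (csh a b (ob C)) }.
Arguments mp {j n} _ _ {C D}.
Arguments mp_hom {j n} _ {s C D f}.
Arguments mp_id {j n} _ {C}.
Arguments mp_comp {j n} _ {s t C D E f g}.
Arguments mp_add {j n} _ {s C D f g}.
Arguments mp_dg {j n} _ {s C D f}.
Arguments mp_gr {j n} _ {C p}.

Section DgfunTheory.
Variables (j n : nat) (F : dgfun j n).
Implicit Types A B C D E W : cpx j.

Lemma mp0 s C D x : mp F s (fun _ : C => 0 : D) x = 0.
Proof.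
have := mp_add F (chom_zero s C D) (chom_zero s C D) x.
have -> : (fun _ : C => 0 : D) \+ (fun _ => 0) = fun _ => 0.
  by apply/funext => y /=; rewrite addr0.
by rewrite -{1}[mp _ _ _ _]addr0 => /addrI.
Qed.

Lemma mpN s C D (f : C -> D) x : chom s f ->
  mp F s (fun x => - f x) x = - mp F s f x.
Proof.
move=> fH; have gH : chom s (fun x => - f x).
  have := chom_mulz (-1) fH; congr chom; apply/funext => y; exact: mulrN1z.
apply/eqP; rewrite -subr_eq0 opprK -(mp_add F gH fH).
have -> : (fun x => - f x) \+ f = fun _ => 0.
  by apply/funext => y /=; rewrite addNr.
by rewrite mp0.
Qed.

Lemma mpB s C D (f g : C -> D) x : chom s f -> chom s g ->
  mp F s (fun x => f x - g x) x = mp F s f x - mp F s g x.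
Proof.
move=> fH gH; rewrite -mpN //; apply: (mp_add F) => //.
have := chom_mulz (-1) gH; congr chom; apply/funext => y; exact: mulrN1z.
Qed.

Lemma mp_chmap C D (f : C -> D) : is_chmap f -> is_chmap (mp F 0 f).
Proof.
move=> /chmap_homP[fH fd]; apply/chmap_homP; split=> [|x]; first exact: mp_hom.
rewrite -mp_dg //; have -> : dg 0 f = fun _ => 0 by exact/funext.
exact: mp0.
Qed.

Lemma mp_homotopic C D (f g : C -> D) : chom 0 f -> chom 0 g -> homotopic f g ->
  homotopic (mp F 0 f) (mp F 0 g).
Proof.
move=> fH gH /homotopicE[h hH hE]; apply/homotopicE.
exists (mp F (-1) h); first exact: mp_hom.
move=> x; rewrite -mpB // -(mp_dg F hH) addNr; congr (mp F 0 _ x).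
exact/funext.
Qed.

Lemma mp_compE C D E (f : D -> E) (g : C -> D) : chom 0 f -> chom 0 g ->
  mp F 0 f \o mp F 0 g = mp F 0 (f \o g).
Proof. by move=> fH gH; apply/funext => x /=; rewrite -mp_comp. Qed.

Lemma ob_heq C D : heq C D -> heq (F C) (F D).
Proof.
move=> [f [g [fC gC gf fg]]]; have fH := chmap_hom0 fC; have gH := chmap_hom0 gC.
have I B : mp F 0 (@id B) = id by apply/funext => x; exact: mp_id.
exists (mp F 0 f), (mp F 0 g); split; [exact: mp_chmap..| |].
  rewrite mp_compE // -I; apply: mp_homotopic => //; last exact: chom_id.
  exact: (chom_comp gH fH).
rewrite mp_compE // -I; apply: mp_homotopic => //; last exact: chom_id.
exact: (chom_comp fH gH).
Qed.

Lemma ob_ciso C D : ciso C D -> ciso (F C) (F D).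
Proof.
move=> [f [g [fC fK gK]]]; exists (mp F 0 f), (mp F 0 g).
have gC := chmap_inv fC fK gK.
have fH := chmap_hom0 fC; have gH := chmap_hom0 gC.
split; first exact: mp_chmap.
  move=> x; rewrite -[LHS]/((mp F 0 g \o mp F 0 f) x) mp_compE //.
  have -> : g \o f = id by apply/funext => y /=.
  exact: mp_id.
move=> x; rewrite -[LHS]/((mp F 0 f \o mp F 0 g) x) mp_compE //.
have -> : f \o g = id by apply/funext => y /=.
exact: mp_id.
Qed.

Lemma ob_contr C : contr C -> contr (F C).
Proof.
move=> [h hH hE]; exists (mp F (-1) h); first exact: mp_hom.
move=> x; rewrite -(mp_dg F hH) addNr -[LHS](mp_id F); congr (mp F 0 _ x).
exact/funext.
Qed.

Lemma ob_sext A W B (i : A -> W) r (p : W -> B) s :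
  sext i r p s -> sext (mp F 0 i) (mp F 0 r) (mp F 0 p) (mp F 0 s).
Proof.
move=> [iC rH pC sH ri ps irsp].
have iH := chmap_hom0 iC; have pH := chmap_hom0 pC.
split; try exact: mp_chmap; try exact: mp_hom.
- move=> x; rewrite -[LHS]/((mp F 0 r \o mp F 0 i) x) mp_compE //.
  by have -> : r \o i = id by [apply/funext]; exact: mp_id.
- move=> x; rewrite -[LHS]/((mp F 0 p \o mp F 0 s) x) mp_compE //.
  by have -> : p \o s = id by [apply/funext]; exact: mp_id.
- move=> x; rewrite -[X in X + _]/((mp F 0 i \o mp F 0 r) x).
  rewrite -[X in _ + X]/((mp F 0 s \o mp F 0 p) x) !mp_compE //.
  have H1 : chom 0 (i \o r) by apply: (chom_comp iH rH).
  have H2 : chom 0 (s \o p) by apply: (chom_comp sH pH).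
  rewrite -mp_add // -[RHS](mp_id F); congr (mp F 0 _ x).
  exact/funext.
Qed.

Lemma ob_csh a b C : contr (F C) -> contr (F (csh a b C)).
Proof.
move=> /(contr_csh a b); apply: contr_heq; apply/ciso_heq/ciso_sym; exact: mp_sh.
Qed.

Lemma ob_cone C D (f : C -> D) (fC : is_chmap f) :
  contr (F C) -> contr (F D) -> contr (F (cone fC)).
Proof.
move=> hC hD; apply: (contr_mid (ob_sext (cone_sext fC))) => //.
exact: ob_csh.
Qed.

Lemma ob_cone_target C D (f : C -> D) (fC : is_chmap f) :
  contr (F (cone fC)) -> contr (F C) -> contr (F D).
Proof.
move=> hc hC; apply: (contr_sub (ob_sext (cone_sext fC))) => //.
exact: ob_csh.
Qed.
End DgfunTheory.

Unset Implicit Arguments.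

(** * Bounded above complexes with contractible columns *)

Section Columns.
Variables (j n : nat) (F : dgfun j n) (D : cpx j).
Hypothesis Dbd : bounded_above D.
Hypothesis Dk : forall k, contr (F (conc (chain D k))).

(** Column k is placed in degree 0, so its inclusion has degree k. It is not a chain map: its
    boundary is the part of the differential that leaves the column. *)
Let ik k : conc (chain D k) -> D := fun x => val (x : chain_car D k).

Lemma chain_pr_subproof k (x : D) : hpr k x \in chain_sub D k.
Proof. by rewrite unfold_in /= /chain_pred (gradK (hprP D)) eqxx. Qed.

Definition chain_pr k (x : D) : chain D k := Sub (hpr k x) (chain_pr_subproof k x).

Lemma chain_prE k x : val (chain_pr k x : chain_car D k) = hpr k x.
Proof. exact: SubK. Qed.

Lemma ik_hom k : chom k (@ik k).
Proof.
split=> [|l x]; first by split.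
rewrite /ik /=; have -> : hpr (l + k) (val x) = if l == 0 then val x else 0.
  rewrite -[in LHS](chainP x) (gradK (hprP D)) -subr_eq0 addrK chainP.
  by [].
by case: ifP.
Qed.

Lemma chain_pr_ghom k : ghom (chain_pr k).
Proof.
split=> [x y|r x|r x|d x]; apply: val_inj; rewrite [LHS]chain_prE.
- by rewrite hprD raddfD.
- by rewrite (ghom_l (hpr_hom D k)).
- by rewrite (ghom_r (hpr_hom D k)).
- by rewrite (ghom_prt (hpr_hom D k)).
Qed.

Lemma chain_pr_hom k : chom (- k) (chain_pr k : D -> conc (chain D k)).
Proof.
split=> [|l x]; first exact: chain_pr_ghom.
apply: val_inj; rewrite [LHS]chain_prE (gradK (hprP D)) [RHS]/=.
rewrite subr_eq0 eq_sym; case: eqP => [->|_] //.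
Qed.

Let I k := mp F k (@ik k).
Let P k := mp F (- k) (chain_pr k : D -> conc (chain D k)).
Let c k := mp F 0 (@hpr _ D k).

Let cG : is_grading c := mp_gr F (hprP D) (@chom_hpr0 _ D).
Let IH k : chom k (I k) := mp_hom F (ik_hom k).
Let PH k : chom (- k) (P k) := mp_hom F (chain_pr_hom k).
Let cH k : chom 0 (c k) := mp_hom F (chom_hpr0 D k).

Let IP k x : I k (P k x) = c k x.
Proof.
rewrite /I /P -(mp_comp F (ik_hom k) (chain_pr_hom k)) addNr.
by congr (mp F 0 _ x); apply/funext => y; rewrite /ik /= chain_prE.
Qed.

Let PI k x : P k (I k x) = x.
Proof.
rewrite /I /P -(mp_comp F (chain_pr_hom k) (ik_hom k)) subrr -[RHS](mp_id F).
by congr (mp F 0 _ x); apply/funext => y; apply: val_inj; rewrite [LHS]chain_prE [LHS]chainP.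
Qed.

Let cI k x : c k (I k x) = I k x. Proof. by rewrite -IP PI. Qed.

Let hk k : F (conc (chain D k)) -> F (conc (chain D k)) := projT1 (cid2 (Dk k)).
Let hkH k : chom (-1) (hk k). Proof. by rewrite /hk; case: (cid2 _). Qed.
Let hkE k x : dif (hk k x) + hk k (dif x) = x.
Proof. by rewrite -dgN1 /hk; case: (cid2 _). Qed.

(** The inclusion [I k] has degree k and commutes with d up to (-1)^k; the sign makes the column
    homotopies contract after inclusion. *)
Let term k x := I k (hk k (P k x)) *~ sg k.
Let termH k : chom (-1) (term k).
Proof.
apply: chom_mulz; apply: (chom_comp (IH k) (t := -1 - k)); last by lia.
by apply: (chom_comp (hkH k) (PH k)); lia.
Qed.
Let h := gfold cG term.
Let termD k : addmap (term k). Proof. exact: chomD (termH k). Qed.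
Let hD : addmap h. Proof. exact: gfoldD. Qed.
Let hc k x : h (c k x) = term k (c k x). Proof. exact: gfold_hom. Qed.

Let hH : chom (-1) h.
Proof.

split; [split=> [|r|r|d]|move=> l]; first exact: hD.
- apply: (gext cG) => [x y|x y|k x].
  + by rewrite (actDr (lactP _)) hD.
  + by rewrite hD (actDr (lactP _)).
  + by rewrite hc -(ghom_l (chom_g (cH k))) hc -(ghom_l (chom_g (termH k))) (ghom_l (chom_g (cH
      k))).
- apply: (gext cG) => [x y|x y|k x].
  + by rewrite (actDr (ractP _)) hD.
  + by rewrite hD (actDr (ractP _)).
  + by rewrite hc -(ghom_r (chom_g (cH k))) hc -(ghom_r (chom_g (termH k))) (ghom_r (chom_g (cH
      k))).
- apply: (gext cG) => [x y|x y|k x].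
  + by rewrite (gradD (prtP _)) hD.
  + by rewrite hD (gradD (prtP _)).
  + by rewrite hc -(ghom_prt (chom_g (cH k))) hc -(ghom_prt (chom_g (termH k))) (ghom_prt
      (chom_g (cH k))).
- apply: (gext cG) => [x y|x y|k x].
  + by rewrite hprD hD.
  + by rewrite hD hprD.
  + have E y : hpr l (c k y) = c k (hpr l y) by rewrite (chom_hpr (cH k)) addr0.
    by rewrite hc E hc -(chom_hpr (termH k)) E.
Qed.

Let ID k : addmap (I k) := chomD (IH k).
Let cD k : addmap (c k) := chomD (cH k).
Let A x := x - dg (-1) h x.

Let hI k x : h (I k x) = I k (hk k x) *~ sg k.
Proof. by rewrite -cI hc cI /term PI. Qed.

Let J k := mp F (k + 1) (dg k (@ik k)).
Let dI k x : dif (I k x) = I k (dif x) *~ sg k + J k x.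
Proof. by rewrite /J (mp_dg F (ik_hom k)) /dg addrC subrK. Qed.

Let cJ k x : c (k + 1) (J k x) = J k x.
Proof.
rewrite /c /J -(mp_comp F (chom_hpr0 D (k + 1)) (chom_dg (ik_hom k))) addr0.
congr (mp F _ _ x); apply/funext => y; rewrite /= /dg /ik /=.
by rewrite mul0rz subr0 -dif_hpr chainP.
Qed.

(** The homotopy h contracts column k on the nose, so the only error comes from [J k], which takes
    values in column k + 1; h itself stays within each column. *)
Let AI k x : c (k + 1) (A (I k x)) = A (I k x).
Proof.
have -> : A (I k x) = - (J k (hk k x) *~ sg k + h (J k x)).
  rewrite /A dgN1 hI (addmapMz (@difD _ _)) !dI hD mulrzDl mulzsgK.
  rewrite (addmapMz hD) hI mulzsgK -{1}(hkE k x) ID; zmod.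
rewrite (addmapN (cD _)) cD (addmapMz (cD _)) cJ; congr (- (_ + _)).
by rewrite -cJ hc (addmapMz (cD _)) cI.
Qed.

Let AD : addmap A.
Proof. by move=> x y; rewrite /A (chomD (chom_dg hH)); zmod. Qed.

Let Ac k x : c (k + 1) (A (c k x)) = A (c k x). Proof. by rewrite -[c k x]IP AI. Qed.

Let Aiter k x m : c (k + m%:Z) (iter m A (c k x)) = iter m A (c k x).
Proof.
elim: m => [|m IHm]; first by rewrite addr0 (gradK cG) eqxx.
by rewrite iterS -IHm -addn1 PoszD addrA Ac.
Qed.

(** The error 1 - [d, h] raises the column index by one, and the columns above the bound N vanish.
    An element has finitely many nonzero columns, so the error is locally nilpotent. *)
Lemma contr_columns : contr (F D).
Proof.
have [N hN] := Dbd; apply: (contr_nilpotent hH) => x.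
have c0 k y : N < k -> c k y = 0.
  move=> /hN h0; rewrite /c -[RHS](@mp0 _ _ F 0 D D y); congr (mp F 0 _ y).
  exact/funext.
have AiD m : addmap (iter m A).
  by elim: m => [|m IHm] y z //=; rewrite IHm AD.
rewrite (gsuppE cG x).
elim: (gsupp cG x) => [|k s [m hm]].
  by exists 0 => m _; rewrite big_nil (addmap0 (AiD m)).
(* After |N - k| + 1 steps column k has passed N; m steps are enough for the remaining columns. *)
exists (m + `|N - k|.+1)%N => m' hm'; rewrite big_cons AiD hm ?addr0; last by lia.
by rewrite -Aiter c0 //; lia.
Qed.
End Columns.
Set Implicit Arguments.
Arguments contr_columns {j n F D}.

(** * Biadditive functors *)

(** No grading is preserved, so that the identity between C and a shift of C, which moves degrees,
    is also allowed in [bmap]. *)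
Record blin n (M N : gbimod n) (f : M -> N) : Prop := Blin {
  blinD : addmap f;
  blin_l : forall r x, f (lact r x) = lact r (f x);
  blin_r : forall r x, f (ract r x) = ract r (f x) }.

Lemma ghom_blin n (M N : gbimod n) (f : M -> N) : ghom f -> blin f.
Proof. by case. Qed.

Section KoszulPower.
Variables (n : nat) (C : cpx n).

(* x |-> (-1)^(b k) x in homological degree k *)
Definition kz (b : int) : C -> C :=
  gfold (hprP C) (fun k x => x *~ sg (b * k)).

Lemma kzD b : addmap (kz b).
Proof. by apply: gfoldD => k; exact: addmap_mulz. Qed.

Lemma kz_hpr b k x : kz b (hpr k x) = hpr k x *~ sg (b * k).
Proof. by apply: gfold_hom => {}k; exact: addmap_mulz. Qed.

Lemma kz1 x : koszul (hprP C) x = kz 1 x.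
Proof.
move: x; apply: (gext (hprP C)) => [||k x]; [exact: koszulD|exact: kzD|].
by rewrite koszul_hom kz_hpr mul1r.
Qed.

Lemma kz0 x : kz 0 x = x.
Proof.
move: x; apply: (gext (hprP C)) => [||k x]; [exact: kzD|by []|].
by rewrite kz_hpr mul0r mulr1z.
Qed.

Lemma kzDr a b x : kz (a + b) x = kz a (kz b x).
Proof.
move: x; apply: (gext (hprP C)) => [|x y|k x]; first exact: kzD.
  by rewrite !kzD.
by rewrite !kz_hpr (addmapMz (@kzD _)) kz_hpr -mulrzA mulrDl sgD mulrC.
Qed.

Lemma kzK b x : kz b (kz b x) = x.
Proof.
move: x; apply: (gext (hprP C)) => [x y|//|k x]; first by rewrite !kzD.
by rewrite !kz_hpr (addmapMz (@kzD _)) kz_hpr mulzsgK.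
Qed.

Lemma kz_comm (f : C -> C) b x : addmap f ->
  (forall k x, f (hpr k x) = hpr k (f x)) -> kz b (f x) = f (kz b x).
Proof.
move=> fD fh; move: x; apply: (gext (hprP C)) => [x y|x y|k x].
- by rewrite fD kzD.
- by rewrite kzD fD.
by rewrite fh !kz_hpr (addmapMz fD) fh.
Qed.

Lemma kz_hom b : chom 0 (kz b).
Proof.
split; [split=> [|r x|r x|d x]|move=> k x]; rewrite ?addr0.
- exact: kzD.
- apply: kz_comm => [|k y]; first exact: (actDr (lactP C)).
  by rewrite (ghom_l (hpr_hom C k)).
- apply: kz_comm => [|k y]; first exact: (actDr (ractP C)).
  by rewrite (ghom_r (hpr_hom C k)).
- apply: kz_comm => [|k y]; first exact: (gradD (prtP C)).
  by rewrite (ghom_prt (hpr_hom C k)).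
- apply: kz_comm => [|l y]; first exact: hprD.
  by rewrite !(gradK (hprP C)) eq_sym; case: eqP => // ->.
Qed.
End KoszulPower.

Lemma kz_chom n (C D : cpx n) (f : C -> D) s b x : chom s f ->
  kz b (f x) = f (kz b x) *~ sg (b * s).
Proof.
move=> fH; have fD := chomD fH.
move: x; apply: (gext (hprP C)) => [x y|x y|k x].
- by rewrite fD kzD.
- by rewrite kzD fD mulrzDl.
rewrite (chom_hpr fH) !kz_hpr (addmapMz fD) (chom_hpr fH) -mulrzA.
by rewrite mulrDr sgD.
Qed.

Lemma kz_csh n (C : cpx n) a b s x :
  kz s (x : csh a b C) = kz s (x : C) *~ sg (s * b).
Proof.
move: x; apply: (gext (hprP (csh a b C))) => [|x y|k x]; first exact: kzD.
  by rewrite [RHS in _ = RHS]/= kzD mulrzDl.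
rewrite kz_hpr /= /sh_hpr kz_hpr -mulrzA mulrDr sgD -mulrA sg_sq mulr1.
by [].
Qed.

Lemma kz_blin n (C : cpx n) s : blin (@kz _ C s).
Proof. exact: ghom_blin (chom_g (kz_hom C s)). Qed.

(* What the tensor products over R and over Z have in common. *)
Record bifun (a b n : nat) := Bifun {
  bob :> cpx a -> cpx b -> cpx n;
  pt : forall (C : cpx a) (D : cpx b), C -> D -> bob C D;
  ptDl : forall (C : cpx a) (D : cpx b) (y : D), addmap (fun x : C => pt x y);
  ptDr : forall (C : cpx a) (D : cpx b) (x : C), addmap (fun y : D => pt x y);
  pt_ind : forall (C : cpx a) (D : cpx b) (P : bob C D -> Prop), P 0 ->
    (forall x y, P x -> P y -> P (x + y)) ->
    (forall (x : C) (y : D), P (pt x y)) -> forall x, P x;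
  pt_dif : forall (C : cpx a) (D : cpx b) (x : C) (y : D),
    dif (pt x y) = pt (dif x) y + pt (kz 1 x) (dif y);
  pt_hpr : forall (C : cpx a) (D : cpx b) k e e' (x : C) (y : D),
    hpr k (pt (hpr e x) (hpr e' y)) =
    if k == e + e' then pt (hpr e x) (hpr e' y) else 0;
  pt_prt : forall (C : cpx a) (D : cpx b) k e e' (x : C) (y : D),
    prt k (pt (prt e x) (prt e' y)) =
    if k == e + e' then pt (prt e x) (prt e' y) else 0;
  bmap : forall (C C' : cpx a) (D D' : cpx b), (C -> C') -> (D -> D') -> bob C D -> bob C' D';
  bmap_blin : forall (C C' : cpx a) (D D' : cpx b) (f : C -> C') (g : D -> D'),
    blin f -> blin g -> blin (bmap f g);
  bmap_pt : forall (C C' : cpx a) (D D' : cpx b) (f : C -> C') (g : D -> D'),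
    blin f -> blin g -> forall x y, bmap f g (pt x y) = pt (f x) (g y) }.
Arguments pt {a b n} _ {C D}.
Arguments bmap_pt {a b n} _ {C C' D D' f g}.
Arguments ptDl {a b n} _ C {D}.
Arguments ptDr {a b n} _ {C} D.
Arguments bmap {a b n} _ {C C' D D'}.
Arguments pt_ind {a b n} _ {C D}.

Section BifunTheory.
Variables (a b n : nat) (B : bifun a b n).
Implicit Types (C : cpx a) (D : cpx b).

Lemma pt_ext C D (V : zmodType) (f g : B C D -> V) : addmap f -> addmap g ->
  (forall x y, f (pt B x y) = g (pt B x y)) -> forall x, f x = g x.
Proof.
move=> fD gD fg; apply: (pt_ind B) => [|x y hx hy|//].
  by rewrite (addmap0 fD) (addmap0 gD).
by rewrite fD gD hx hy.
Qed.

Lemma pt_hom_ext C D (p : int -> C -> C) (q : int -> D -> D)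
  (V : zmodType) (f g : B C D -> V) : is_grading p -> is_grading q ->
  addmap f -> addmap g ->
  (forall e e' x y, f (pt B (p e x) (q e' y)) = g (pt B (p e x) (q e' y))) ->
  forall x, f x = g x.
Proof.
move=> pG qG fD gD fg; apply: pt_ext => // x y.
move: x; apply: (gext pG) => [x x'|x x'|e x].
- by rewrite ptDl fD.
- by rewrite ptDl gD.
move: y; apply: (gext qG) => [y y'|y y'|e' y].
- by rewrite ptDr fD.
- by rewrite ptDr gD.
exact: fg.
Qed.

Lemma pt0l C D (y : D) : pt B (0 : C) y = 0.
Proof. exact: (addmap0 (ptDl B C y)). Qed.

Lemma pt0r C D (x : C) : pt B x (0 : D) = 0.
Proof. exact: (addmap0 (ptDr B D x)). Qed.

Lemma ptMzl C D (x : C) (y : D) c : pt B (x *~ c) y = pt B x y *~ c.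
Proof. exact: (addmapMz (ptDl B C y)). Qed.

Lemma ptMzr C D (x : C) (y : D) c : pt B x (y *~ c) = pt B x y *~ c.
Proof. exact: (addmapMz (ptDr B D x)). Qed.

Lemma bmapD C C' D D' (f : C -> C') (g : D -> D') :
  blin f -> blin g -> addmap (bmap B f g).
Proof. by move=> fB gB; case: (bmap_blin B fB gB). Qed.

(** The gradings are arbitrary, so the statement serves the internal and the homological grading,
    and with s, t nonzero also the comparison with shifts. *)
Lemma bmap_gr C C' D D' (f : C -> C') (g : D -> D')
  (p : int -> C -> C) (q : int -> D -> D) (p' : int -> C' -> C')
  (q' : int -> D' -> D') (R : int -> B C D -> B C D)
  (R' : int -> B C' D' -> B C' D') s t :
  is_grading p -> is_grading q -> is_grading R -> is_grading R' ->
  (forall k e e' x y, R k (pt B (p e x) (q e' y)) =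
     if k == e + e' then pt B (p e x) (q e' y) else 0) ->
  (forall k e e' x y, R' k (pt B (p' e x) (q' e' y)) =
     if k == e + e' then pt B (p' e x) (q' e' y) else 0) ->
  blin f -> blin g ->
  (forall e x, f (p e x) = p' (e + s) (f x)) ->
  (forall e y, g (q e y) = q' (e + t) (g y)) ->
  forall k x, bmap B f g (R k x) = R' (k + (s + t)) (bmap B f g x).
Proof.
move=> pG qG RG RG' HR HR' fB gB fp gq k; have D1 := bmapD fB gB.
apply: (pt_hom_ext pG qG) => [x y|x y|e e' x y].
- by rewrite (gradD RG) D1.
- by rewrite D1 (gradD RG').
rewrite HR bmap_pt // fp gq HR' addrACA (inj_eq (addIr _)) -fp -gq.
by case: eqP => _; rewrite ?bmap_pt // (addmap0 D1).
Qed.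

Lemma bmap_chom C C' D D' (f : C -> C') (g : D -> D') s t :
  chom s f -> chom t g -> chom (s + t) (bmap B f g).
Proof.
move=> fH gH; have fB := ghom_blin (chom_g fH); have gB := ghom_blin (chom_g gH).
have [hD hl hr] := bmap_blin B fB gB.
split; [split=> // d x|move=> k x].
  have := bmap_gr (s := 0) (t := 0) (prtP C) (prtP D) (prtP (B C D))
    (prtP (B C' D')) (@pt_prt _ _ _ B _ _) (@pt_prt _ _ _ B _ _) fB gB.
  rewrite addr0 => -> //; first by rewrite addr0.
  - by move=> e y; rewrite addr0 (ghom_prt (chom_g fH)).
  - by move=> e y; rewrite addr0 (ghom_prt (chom_g gH)).
apply: (bmap_gr (hprP C) (hprP D) (hprP (B C D))
    (hprP (B C' D')) (@pt_hpr _ _ _ B _ _) (@pt_hpr _ _ _ B _ _) fB gB).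
- by move=> e y; rewrite (chom_hpr fH).
- by move=> e y; rewrite (chom_hpr gH).
Qed.

Lemma bmap_id C D x : bmap B (@id C) (@id D) x = x.
Proof.
move: x; apply: pt_ext => [|//|x y]; first exact: bmapD.
by rewrite bmap_pt.
Qed.

Lemma bmap_comp C C' C'' D D' D'' (f : C' -> C'') (f' : C -> C')
  (g : D' -> D'') (g' : D -> D') : blin f -> blin f' -> blin g -> blin g' ->
  forall x, bmap B (f \o f') (g \o g') x = bmap B f g (bmap B f' g' x).
Proof.
have comp m (M N P : gbimod m) (u : N -> P) (v : M -> N) :
    blin u -> blin v -> blin (u \o v).
  move=> [uD ul ur] [vD vl vr]; split=> [x y|r x|r x] /=.
  - by rewrite vD uD.
  - by rewrite vl ul.
  - by rewrite vr ur.
move=> fB fB' gB gB'; have fB'' := comp _ _ _ _ _ _ fB fB'.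
have gB'' := comp _ _ _ _ _ _ gB gB'.
apply: pt_ext => [|x y|x y]; first exact: bmapD.
  by rewrite (bmapD fB' gB') (bmapD fB gB).
by rewrite !bmap_pt.
Qed.

Section Left.
Variable D : cpx b.
Definition bl_mp (s : int) C C' (f : C -> C') : B C D -> B C' D := bmap B f id.

Lemma bl_hom s C C' (f : C -> C') : chom s f -> chom s (bl_mp s f).
Proof. by move=> fH; rewrite -[s]addr0; apply: bmap_chom (chom_id _). Qed.

Lemma bl_comp s t C C' C'' (f : C' -> C'') (g : C -> C') :
  chom s f -> chom t g -> forall x,
  bl_mp (t + s) (f \o g) x = bl_mp s f (bl_mp t g x).
Proof.
by move=> fH gH x; rewrite /bl_mp -bmap_comp //; apply: ghom_blin;
  [exact: (chom_g fH)|exact: (chom_g gH)].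
Qed.

Lemma bl_add s C C' (f g : C -> C') : chom s f -> chom s g ->
  forall x, bl_mp s (f \+ g) x = bl_mp s f x + bl_mp s g x.
Proof.
move=> fH gH; have fB := ghom_blin (chom_g fH); have gB := ghom_blin (chom_g gH).
have B1 := ghom_blin (chom_g (chom_add fH gH)).
rewrite /bl_mp; apply: pt_ext => [|x y|x y]; first exact: bmapD.
  by rewrite !(bmapD (g := id)) // addrACA.
by rewrite !bmap_pt //= ptDl.
Qed.

Lemma bl_dg s C C' (f : C -> C') : chom s f ->
  forall x, bl_mp (s + 1) (dg s f) x = dg s (bl_mp s f) x.
Proof.
move=> fH; have fB := ghom_blin (chom_g fH).
have dB := ghom_blin (chom_g (chom_dg fH)).
have H := bl_hom fH; have H1 := bl_hom (chom_dg fH).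
rewrite /bl_mp; apply: pt_ext; [exact: chomD H1|exact: chomD (chom_dg H)|].
move=> x y; rewrite {2}/dg !bmap_pt // !pt_dif (bmapD fB) // !bmap_pt //.
rewrite (kz_chom _ _ fH) mul1r ptMzl mulrzDl /dg.
rewrite (addmapB (ptDl B C' y)) ptMzl; zmod.
Qed.

Lemma bl_gr C (p : int -> C -> C) : is_grading p -> (forall k, chom 0 (p k)) ->
  is_grading (fun k => bl_mp 0 (p k)).
Proof.
move=> pG pH; have pB k := ghom_blin (chom_g (pH k)).
have D1 k : addmap (bl_mp 0 (p k)) by exact: bmapD.
have K d e x : bl_mp 0 (p d) (bl_mp 0 (p e) x) =
    if d == e then bl_mp 0 (p e) x else 0.
  rewrite -bl_comp // addr0; have -> : p d \o p e = fun x => if d == e then p e x else 0.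
    by apply/funext => z /=; rewrite (gradK pG).
  case: eqP => // _; have Z : blin (fun _ : C => 0 : C) := ghom_blin (ghom_zero C C).
  move: x; apply: pt_ext => [|? ?|x y]; [exact: bmapD|by rewrite addr0|].
  by rewrite /bl_mp bmap_pt // pt0l.
split=> //; apply: (pt_ind B) => [|x y|x y].
- exact: (finsupp0 (fun k => bl_mp 0 (p k))).
- exact: (finsuppD (p := fun k => bl_mp 0 (p k)) D1 K).
- rewrite (gsuppE pG x) (addmap_sum (ptDl B C y)).
  apply: (finsupp_sum (p := fun k => bl_mp 0 (p k)) D1 K) => d;
    apply: (finsupp_hom (p := fun k => bl_mp 0 (p k)) (d := d)).
  by rewrite /bl_mp bmap_pt // (gradK pG) eqxx.
Qed.

Lemma bl_sh s t C : ciso (B (csh s t C) D) (csh s t (B C D)).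
Proof.
have B1 : blin (id : csh s t C -> C) by [].
have B2 : blin (id : C -> csh s t C) by [].
have B0 : blin (id : D -> D) by [].
exists (bmap B (id : csh s t C -> C) id), (bmap B (id : C -> csh s t C) id); split.
- have [hD hl hr] := bmap_blin B B1 B0; split; [split=> // d x|move=> k x|].
  + have := bmap_gr (s := s) (t := 0) (prtP (csh s t C)) (prtP D)
      (prtP (B (csh s t C) D)) (prtP (B C D)) (@pt_prt _ _ _ B _ _)
      (@pt_prt _ _ _ B _ _) B1 B0.
    by rewrite addr0; apply=> // e y; rewrite addr0.
  + have := bmap_gr (s := t) (t := 0) (hprP (csh s t C)) (hprP D)
      (hprP (B (csh s t C) D)) (hprP (B C D)) (@pt_hpr _ _ _ B _ _)
      (@pt_hpr _ _ _ B _ _) B1 B0.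
    by rewrite addr0; apply=> // e y; rewrite addr0.
  + apply: pt_ext => [x y|x y|x y]; first by rewrite difD hD.
      by rewrite hD (@difD _ (csh s t (B C D))).
    rewrite pt_dif hD !bmap_pt // kz_csh mul1r ptMzl.
    rewrite [in X in X + _]/dif /= /sh_dif (ptMzl (C := C)) -/(sg t) pt_dif.
    by rewrite mulrzDl.
- move=> x; rewrite -bmap_comp //; exact: bmap_id.
- move=> x; rewrite -bmap_comp //; exact: bmap_id.
Qed.

Definition bifun_left : dgfun a n :=
  @Dgfun a n (fun C => B C D) bl_mp bl_hom (fun C x => bmap_id x) bl_comp
    bl_add bl_dg bl_gr bl_sh.
End Left.

Section Right.
Variable C : cpx a.
(** A map of degree s that passes an element of C of degree k picks up (-1)^(s k). This Koszul sign
    is the reason why [mp] takes the degree as an argument. *)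
Definition br_mp (s : int) D D' (f : D -> D') : B C D -> B C D' :=
  bmap B (@kz _ C s) f.

Lemma br_hom s D D' (f : D -> D') : chom s f -> chom s (br_mp s f).
Proof. by move=> fH; rewrite -{1}[s]add0r; apply: bmap_chom => //; exact: kz_hom. Qed.

Lemma br_id D x : br_mp 0 (@id D) x = x.
Proof.
rewrite /br_mp; have -> : @kz _ C 0 = id by apply/funext => y; exact: kz0.
exact: bmap_id.
Qed.

Lemma br_comp s t D D' D'' (f : D' -> D'') (g : D -> D') :
  chom s f -> chom t g -> forall x,
  br_mp (t + s) (f \o g) x = br_mp s f (br_mp t g x).
Proof.
move=> fH gH x; have fB := ghom_blin (chom_g fH); have gB := ghom_blin (chom_g gH).
rewrite /br_mp -(bmap_comp (kz_blin C s) (kz_blin C t) fB gB); congr (bmap B _ _ x).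
by apply/funext => y /=; rewrite addrC kzDr.
Qed.

Lemma br_add s D D' (f g : D -> D') : chom s f -> chom s g ->
  forall x, br_mp s (f \+ g) x = br_mp s f x + br_mp s g x.
Proof.
move=> fH gH; have fB := ghom_blin (chom_g fH); have gB := ghom_blin (chom_g gH).
have B1 := ghom_blin (chom_g (chom_add fH gH)).
rewrite /br_mp; apply: pt_ext => [|x y|x y]; first exact: (bmapD (kz_blin C s)).
  by rewrite !(bmapD (kz_blin C s)) // addrACA.
by rewrite !(bmap_pt B (kz_blin C _)) //= ptDr.
Qed.

Lemma br_dg s D D' (f : D -> D') : chom s f ->
  forall x, br_mp (s + 1) (dg s f) x = dg s (br_mp s f) x.
Proof.
move=> fH; have fB := ghom_blin (chom_g fH).
have dB := ghom_blin (chom_g (chom_dg fH)).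
have H := br_hom fH; have H1 := br_hom (chom_dg fH).
rewrite /br_mp; apply: pt_ext; [exact: chomD H1|exact: chomD (chom_dg H)|].
move=> x y; rewrite {2}/dg !(bmap_pt B (kz_blin C _)) // !pt_dif (bmapD (kz_blin C s)) //
  !(bmap_pt B (kz_blin C _)) //.
rewrite (kz_chom _ _ (chom_dif C)) mulr1 mulrzDl ptMzl mulzsgK.
rewrite -(kzDr 1 s) -(kzDr s 1) [1 + s]addrC /dg.
rewrite (addmapB (ptDr B D' _)) ptMzr.
set u := pt _ _ (dif (f y)); set v := pt _ _ (f (dif y)); zmod.
Qed.

Lemma br_gr D (p : int -> D -> D) : is_grading p -> (forall k, chom 0 (p k)) ->
  is_grading (fun k => br_mp 0 (p k)).
Proof.
move=> pG pH; have pB k := ghom_blin (chom_g (pH k)).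
have D1 k : addmap (br_mp 0 (p k)) by exact: (bmapD (kz_blin C 0)).
have K d e x : br_mp 0 (p d) (br_mp 0 (p e) x) =
    if d == e then br_mp 0 (p e) x else 0.
  rewrite -br_comp // addr0; have -> : p d \o p e = fun x => if d == e then p e x else 0.
    by apply/funext => z /=; rewrite (gradK pG).
  case: eqP => // _; have Z : blin (fun _ : D => 0 : D) := ghom_blin (ghom_zero D D).
  move: x; apply: pt_ext => [|? ?|x y]; [exact: (bmapD (kz_blin C 0))|by rewrite addr0|].
  by rewrite /br_mp (bmap_pt B (kz_blin C _)) // pt0r.
split=> //; apply: (pt_ind B) => [|x y|x y].
- exact: (finsupp0 (fun k => br_mp 0 (p k))).
- exact: (finsuppD (p := fun k => br_mp 0 (p k)) D1 K).
- rewrite (gsuppE pG y) (addmap_sum (ptDr B D x)).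
  apply: (finsupp_sum (p := fun k => br_mp 0 (p k)) D1 K) => d;
    apply: (finsupp_hom (p := fun k => br_mp 0 (p k)) (d := d)).
  by rewrite /br_mp (bmap_pt B (kz_blin C _)) // kz0 (gradK pG) eqxx.
Qed.

Lemma br_sh s t D : ciso (B C (csh s t D)) (csh s t (B C D)).
Proof.
have B1 : blin (id : csh s t D -> D) by [].
have B2 : blin (id : D -> csh s t D) by [].
have B0 := kz_blin C t.
(* Moving the shift [t] past C costs (-1)^(t k) in degree k; [kz t] inserts this sign and is its own
   inverse. *)
exists (bmap B (@kz _ C t) (id : csh s t D -> D)),
       (bmap B (@kz _ C t) (id : D -> csh s t D)); split.
- have [hD hl hr] := bmap_blin B B0 B1; split; [split=> // d x|move=> k x|].
  + have := bmap_gr (s := 0) (t := s) (prtP C) (prtP (csh s t D))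
      (prtP (B C (csh s t D))) (prtP (B C D)) (@pt_prt _ _ _ B _ _)
      (@pt_prt _ _ _ B _ _) B0 B1.
    rewrite add0r; apply=> // e y.
    by rewrite addr0 (ghom_prt (chom_g (kz_hom C t))).
  + have := bmap_gr (s := 0) (t := t) (hprP C) (hprP (csh s t D))
      (hprP (B C (csh s t D))) (hprP (B C D)) (@pt_hpr _ _ _ B _ _)
      (@pt_hpr _ _ _ B _ _) B0 B1.
    by rewrite add0r; apply=> // e y; rewrite (chom_hpr (kz_hom C t)).
  + apply: pt_ext => [x y|x y|x y]; first by rewrite difD hD.
      by rewrite hD (@difD _ (csh s t (B C D))).
    rewrite pt_dif hD !(bmap_pt B (kz_blin C _)) // [RHS]/= /sh_dif -/(sg t) pt_dif mulrzDl.
    rewrite [in X in _ + X]/dif /= /sh_dif (ptMzr (D := D)) -/(sg t).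
    rewrite (kz_chom _ _ (chom_dif C)) mulr1 ptMzl.
    by rewrite -(kzDr 1 t) -(kzDr t 1) [1 + t]addrC.
- move=> x; rewrite -bmap_comp //.
  have -> : @kz _ C t \o @kz _ C t = id by apply/funext => y /=; rewrite kzK.
  exact: bmap_id.
- move=> x; rewrite -bmap_comp //.
  have -> : @kz _ C t \o @kz _ C t = id by apply/funext => y /=; rewrite kzK.
  exact: bmap_id.
Qed.

Definition bifun_right : dgfun b n :=
  @Dgfun b n (fun D => B C D) br_mp br_hom br_id br_comp
    br_add br_dg br_gr br_sh.
End Right.
End BifunTheory.

(** * The two tensor products *)

(** The polynomial ring is generated by its variables as a ring over the integers. Linearity of an
    additive map thus only has to be checked on variables ([act_ext]), and likewise homogeneity of
    an action ([act_homog]). *)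
Lemma mpoly_int_ind n (P : Rn n -> Prop) : P 1 ->
  (forall f g, P f -> P g -> P (f - g)) ->
  (forall f u, P f -> P ('X_u * f)) -> forall f, P f.
Proof.
move=> P1 PB PX.
have P0 : P 0 by rewrite -(subrr 1); apply: PB.
have PN f : P f -> P (- f) by rewrite -sub0r; exact: PB.
have PD f g : P f -> P g -> P (f + g).
  by move=> hf hg; rewrite -[g]opprK; apply: PB => //; exact: PN.
have PMn f k : P f -> P (f *+ k).
  by move=> hf; elim: k => [|k IH]; rewrite ?mulr0n // mulrS; apply: PD.
have PMz f (c : int) : P f -> P (f *~ c).
  by move=> hf; case: c => k; rewrite /intmul; [|apply: PN]; exact: PMn.
have PXn u k f : P f -> P ('X_u ^+ k * f).
  by move=> hf; elim: k => [|k IH]; rewrite ?mul1r // exprS -mulrA; apply: PX.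
have PXm m : P 'X_[m].
  rewrite mpolyXE_id -[\prod_(_ < _) _]mulr1.
  elim/big_rec: _ => [|u x _ IH]; first by rewrite mul1r.
  by rewrite -mulrA; apply: PXn.
elim/mpolyind => // c m p _ _ hp; apply: PD => //.
by rewrite -[c]intz scaler_int; exact: PMz.
Qed.

Section ActionExt.
Variables (n : nat) (V W : zmodType).
Variables (a : Rn n -> V -> V) (b : Rn n -> W -> W).
Hypotheses (aP : is_action a) (bP : is_action b).

Lemma act_ext (f : V -> W) : addmap f ->
  (forall u x, f (a 'X_u x) = b 'X_u (f x)) ->
  forall r x, f (a r x) = b r (f x).
Proof.
move=> fD fX; apply: (@mpoly_int_ind n) => [x|r s hr hs x|r u hr x].
- by rewrite (act1 aP) (act1 bP).
- rewrite (addmapB (actDl aP x)) (addmapB (actDl bP _)) (addmapB fD).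
  by rewrite hr hs.
- by rewrite (actM aP) (actM bP) fX hr.
Qed.

Lemma act_homog (p : int -> V -> V) : (forall d, addmap (p d)) ->
  (forall u e x, a 'X_u (p e x) = p (e + 2) (a 'X_u x)) ->
  forall d r, r \is d.-homog ->
  forall e x, a r (p e x) = p (e + d.*2%:Z) (a r x).
Proof.
move=> pD aX.
have X u k e x : a ('X_u ^+ k) (p e x) = p (e + k.*2%:Z) (a ('X_u ^+ k) x).
  elim: k e => [|k IH] e; first by rewrite expr0 !(act1 aP) addr0.
  by rewrite exprS !(actM aP) IH aX; congr p; lia.
have Xm m e x : a 'X_[m] (p e x) = p (e + (mdeg m).*2%:Z) (a 'X_[m] x).
  rewrite mpolyXE_id mdegE.
  elim/big_rec2: _ e x => [|u d q _ IH] e x; first by rewrite !(act1 aP) addr0.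
  by rewrite !(actM aP) IH X; congr p; lia.
move=> d r /dhomogP rd e x; rewrite [r]mpolyE.
rewrite (addmap_sum (actDl aP _)) (addmap_sum (actDl aP _)) (addmap_sum (pD _)).
apply: eq_big_seq => m mr.
have Z y : a (r@_m *: 'X_[m]) y = a 'X_[m] y *~ r@_m.
  by rewrite -{1}[r@_m]intz scaler_int (addmapMz (actDl aP y)).
by rewrite !Z Xm (rd m mr) (addmapMz (pD _)).
Qed.
End ActionExt.

Lemma tensor_gr (M N : zmodType) A (al : A -> M -> M) (be : A -> N -> N)
  (p : int -> M -> M) (q : int -> N -> N) (pG : is_grading p)
  (qG : is_grading q) k e e' x y :
  (forall a, addmap (al a)) -> gr_balanced al be p q ->
  tgr q pG k (tmk al be (p e x) (q e' y)) =
  if k == e + e' then tmk al be (p e x) (q e' y) else 0.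
Proof. by move=> alD B; rewrite (tgr_hom pG qG alD B). Qed.

Section CtensBifun.
Variable n : nat.
Implicit Types C D : cpx n.
Notation SR := (predT : {pred Rn n}).

Definition ctm C D (x : C) (y : D) : ctens C D :=
  tmk (@sc_r n SR C) (@sc_l n SR D) x y.

Lemma ctmB C D r (x : C) (y : D) : ctm (ract r x) y = ctm x (lact r y).
Proof. exact: (tmkB (@sc_r n SR C) (@sc_l n SR D) (exist _ r isT)). Qed.

Lemma ct_lact C D r (x : C) (y : D) : lact r (ctm x y) = ctm (lact r x) y.
Proof. exact: (tmapE x y (@ot_lcompat n SR C D r)). Qed.

Lemma ct_ract C D r (x : C) (y : D) : ract r (ctm x y) = ctm x (ract r y).
Proof. exact: (tmapE x y (@ot_rcompat n SR C D r)). Qed.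

Lemma ct_difE C D (x : C) (y : D) :
  dif (ctm x y) = ctm (dif x) y + ctm (kz 1 x) (dif y).
Proof.
have c1 := tdif_c1 (@sc_l n SR D) (@difD _ C) (@ct_ald _ C).
have c2 := tdif_c2 (hprP C) (@difD _ D) (@sc_rD n SR C) (@ct_alh _ C)
  (@ct_bed _ D).
rewrite -kz1 -[LHS]/(tdif (hprP C) (@dif _ C) (@dif _ D) (ctm x y)) /tdif.
by rewrite (tmapE x y c1) (tmapE x y c2).
Qed.

Definition ct_bmap C C' D D' (f : C -> C') (g : D -> D') :
  ctens C D -> ctens C' D' := tlift (fun x y => ctm (f x) (g y)).

Section Map.
Variables (C C' D D' : cpx n) (f : C -> C') (g : D -> D').
Hypotheses (fB : blin f) (gB : blin g).

Let bal : balanced (@sc_r n SR C) (@sc_l n SR D) (fun x y => ctm (f x) (g y)).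
Proof.
split=> [y x x'|x y y'|r x y].
- by rewrite (blinD fB) /ctm tmkDl.
- by rewrite (blinD gB) /ctm tmkDr.
- by rewrite /sc_r /sc_l (blin_r fB) ctmB (blin_l gB).
Qed.

Lemma ct_bmap_pt x y : ct_bmap f g (ctm x y) = ctm (f x) (g y).
Proof. exact: (tliftE bal). Qed.

Lemma ct_bmap_blin : blin (ct_bmap f g).
Proof.
have D1 : addmap (ct_bmap f g) := tliftD bal.
split=> // r; apply: tens_ext => [x y|x y|x y].
- by rewrite (actDr (lactP (ctens C D))) D1.
- by rewrite D1 (actDr (lactP (ctens C' D'))).
- by rewrite ct_lact !ct_bmap_pt ct_lact (blin_l fB).
- by rewrite (actDr (ractP (ctens C D))) D1.
- by rewrite D1 (actDr (ractP (ctens C' D'))).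
- by rewrite ct_ract !ct_bmap_pt ct_ract (blin_r gB).
Qed.
End Map.

Lemma ct_hprE C D k e e' (x : C) (y : D) :
  hpr k (ctm (hpr e x) (hpr e' y)) =
  if k == e + e' then ctm (hpr e x) (hpr e' y) else 0.
Proof.
apply: tensor_gr; [exact: hprP|exact: sc_rD|].
exact: (h_balanced (@ct_alh _ _) (@ct_beh _ _)).
Qed.

Lemma ct_prtE C D k e e' (x : C) (y : D) :
  prt k (ctm (prt e x) (prt e' y)) =
  if k == e + e' then ctm (prt e x) (prt e' y) else 0.
Proof.
apply: tensor_gr; [exact: prtP|exact: sc_rD|].
exact: (sc_balanced (@predT_hom n) C D).
Qed.

Lemma ct_ind C D (P : ctens C D -> Prop) : P 0 ->
  (forall x y, P x -> P y -> P (x + y)) ->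
  (forall (x : C) (y : D), P (ctm x y)) -> forall x, P x.
Proof. exact: tens_ind. Qed.

Lemma ctmDl C D (y : D) : addmap (fun x : C => ctm x y).
Proof. exact: tmkDl. Qed.

Lemma ctmDr C D (x : C) : addmap (fun y : D => ctm x y).
Proof. exact: tmkDr. Qed.

Lemma ct_ext C D (V : zmodType) (f g : ctens C D -> V) :
  addmap f -> addmap g ->
  (forall x y, f (ctm x y) = g (ctm x y)) -> forall x, f x = g x.
Proof. exact: tens_ext. Qed.

Definition ctens_bifun : bifun n n n :=
  @Bifun n n n (@ctens n) ctm ctmDl ctmDr ct_ind ct_difE ct_hprE ct_prtE
    ct_bmap ct_bmap_blin ct_bmap_pt.
End CtensBifun.

Section CsqcupBifun.
Variables k l : nat.
Implicit Types (C : cpx k) (D : cpx l).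

Definition csm C D (x : C) (y : D) : csqcup C D := tmk (@zl k C) (@zr l D) x y.

Lemma ext_act_lshift (M : gbimod k) (N : gbimod l) a b (u : 'I_k) x y :
  is_action a -> is_action b ->
  @ext_act k l M N a b 'X_(lshift l u) (tmk (@zl k M) (@zr l N) x y) =
  tmk (@zl k M) (@zr l N) (a 'X_u x) y.
Proof.
move=> aP bP; rewrite /ext_act -[X in monact _ X]scale1r.
rewrite monactZX mulr1z /ext_mon tmapE; last exact: ext_mon_compat.
have -> : mleft U_(lshift l u) = U_(u)%MM :> 'X_{1..k}.
  by apply/mnmP => i; rewrite !mnmE (inj_eq (@lshift_inj _ _)).
have -> : mright U_(lshift l u) = 0%MM :> 'X_{1..l}.
  by apply/mnmP => i; rewrite !mnmE -val_eqE /= ltn_eqF // ltn_addr.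
by rewrite mpolyX0 (act1 bP).
Qed.

Lemma ext_act_rshift (M : gbimod k) (N : gbimod l) a b (u : 'I_l) x y :
  is_action a -> is_action b ->
  @ext_act k l M N a b 'X_(rshift k u) (tmk (@zl k M) (@zr l N) x y) =
  tmk (@zl k M) (@zr l N) x (b 'X_u y).
Proof.
move=> aP bP; rewrite /ext_act -[X in monact _ X]scale1r.
rewrite monactZX mulr1z /ext_mon tmapE; last exact: ext_mon_compat.
have -> : mright U_(rshift k u) = U_(u)%MM :> 'X_{1..l}.
  by apply/mnmP => i; rewrite !mnmE (inj_eq (@rshift_inj _ _)).
have -> : mleft U_(rshift k u) = 0%MM :> 'X_{1..k}.
  by apply/mnmP => i; rewrite !mnmE -val_eqE /= gtn_eqF // ltn_addr.
by rewrite mpolyX0 (act1 aP).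
Qed.

Lemma cs_lactl C D u (x : C) (y : D) :
  lact 'X_(lshift l u) (csm x y) = csm (lact 'X_u x) y.
Proof. exact: ext_act_lshift (lactP C) (lactP D). Qed.

Lemma cs_lactr C D u (x : C) (y : D) :
  lact 'X_(rshift k u) (csm x y) = csm x (lact 'X_u y).
Proof. exact: ext_act_rshift (lactP C) (lactP D). Qed.

Lemma cs_ractl C D u (x : C) (y : D) :
  ract 'X_(lshift l u) (csm x y) = csm (ract 'X_u x) y.
Proof. exact: ext_act_lshift (ractP C) (ractP D). Qed.

Lemma cs_ractr C D u (x : C) (y : D) :
  ract 'X_(rshift k u) (csm x y) = csm x (ract 'X_u y).
Proof. exact: ext_act_rshift (ractP C) (ractP D). Qed.

Lemma cs_difE C D (x : C) (y : D) :
  dif (csm x y) = csm (dif x) y + csm (kz 1 x) (dif y).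
Proof.
have c1 := tdif_c1 (@zr l D) (@difD _ C) (@cs_ald _ C).
have c2 := tdif_c2 (hprP C) (@difD _ D) (@zlD _ C) (@cs_alh _ C)
  (@cs_bed _ D).
rewrite -kz1 -[LHS]/(tdif (hprP C) (@dif _ C) (@dif _ D) (csm x y)) /tdif.
by rewrite (tmapE x y c1) (tmapE x y c2).
Qed.

Lemma csmDl C D (y : D) : addmap (fun x : C => csm x y).
Proof. exact: tmkDl. Qed.

Lemma csmDr C D (x : C) : addmap (fun y : D => csm x y).
Proof. exact: tmkDr. Qed.

(** Every variable of R_(k+l) belongs to exactly one factor, so linearity over the variables of each
    factor suffices. *)
Lemma cs_blin C D (M : gbimod (k + l)) (f : csqcup C D -> M) : addmap f ->
  (forall u x y, f (csm (lact 'X_u x) y) = lact 'X_(lshift l u) (f (csm x y))) ->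
  (forall u x y, f (csm x (lact 'X_u y)) = lact 'X_(rshift k u) (f (csm x y))) ->
  (forall u x y, f (csm (ract 'X_u x) y) = ract 'X_(lshift l u) (f (csm x y))) ->
  (forall u x y, f (csm x (ract 'X_u y)) = ract 'X_(rshift k u) (f (csm x y))) ->
  blin f.
Proof.
move=> fD f1 f2 f3 f4.
split=> //; [apply: (act_ext (lactP _) (lactP _)) => // u|
             apply: (act_ext (ractP _) (ractP _)) => // u];
  apply: tens_ext => [x y|x y|x y].
- by rewrite (actDr (lactP (csqcup C D))) fD.
- by rewrite fD (actDr (lactP M)).
- rewrite -/(csm x y); case: (splitP u) => i ui.
    have -> : u = lshift l i by exact: val_inj.
    by rewrite cs_lactl f1.
  have -> : u = rshift k i by exact: val_inj.
  by rewrite cs_lactr f2.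
- by rewrite (actDr (ractP (csqcup C D))) fD.
- by rewrite fD (actDr (ractP M)).
- rewrite -/(csm x y); case: (splitP u) => i ui.
    have -> : u = lshift l i by exact: val_inj.
    by rewrite cs_ractl f3.
  have -> : u = rshift k i by exact: val_inj.
  by rewrite cs_ractr f4.
Qed.

Definition cs_bmap C C' D D' (f : C -> C') (g : D -> D') :
  csqcup C D -> csqcup C' D' := tlift (fun x y => csm (f x) (g y)).

Section Map.
Variables (C C' : cpx k) (D D' : cpx l) (f : C -> C') (g : D -> D').
Hypotheses (fB : blin f) (gB : blin g).

Let bal : balanced (@zl k C) (@zr l D) (fun x y => csm (f x) (g y)).
Proof.
split=> [y x x'|x y y'|[] //].
- by rewrite (blinD fB) /csm tmkDl.
- by rewrite (blinD gB) /csm tmkDr.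
Qed.

Lemma cs_bmap_pt x y : cs_bmap f g (csm x y) = csm (f x) (g y).
Proof. exact: (tliftE bal). Qed.

Lemma cs_bmap_blin : blin (cs_bmap f g).
Proof.
apply: cs_blin => [|u x y|u x y|u x y|u x y]; first exact: tliftD bal.
- by rewrite !cs_bmap_pt cs_lactl (blin_l fB).
- by rewrite !cs_bmap_pt cs_lactr (blin_l gB).
- by rewrite !cs_bmap_pt cs_ractl (blin_r fB).
- by rewrite !cs_bmap_pt cs_ractr (blin_r gB).
Qed.
End Map.

Lemma cs_hprE C D d e e' (x : C) (y : D) :
  hpr d (csm (hpr e x) (hpr e' y)) =
  if d == e + e' then csm (hpr e x) (hpr e' y) else 0.
Proof.
apply: tensor_gr; [exact: hprP|exact: zlD|exact: z_balanced].
Qed.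

Lemma cs_prtE C D d e e' (x : C) (y : D) :
  prt d (csm (prt e x) (prt e' y)) =
  if d == e + e' then csm (prt e x) (prt e' y) else 0.
Proof.
apply: tensor_gr; [exact: prtP|exact: zlD|exact: z_balanced].
Qed.

Lemma cs_ind C D (P : csqcup C D -> Prop) : P 0 ->
  (forall x y, P x -> P y -> P (x + y)) ->
  (forall (x : C) (y : D), P (csm x y)) -> forall x, P x.
Proof. exact: tens_ind. Qed.

Lemma cs_ext C D (V : zmodType) (f g : csqcup C D -> V) :
  addmap f -> addmap g ->
  (forall x y, f (csm x y) = g (csm x y)) -> forall x, f x = g x.
Proof. exact: tens_ext. Qed.

Definition csqcup_bifun : bifun k l (k + l) :=
  @Bifun k l (k + l) (@csqcup k l) csm csmDl csmDr cs_ind cs_difE cs_hprE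
    cs_prtE cs_bmap cs_bmap_blin cs_bmap_pt.
End CsqcupBifun.

(** * Units and associativity *)

Lemma kz_pt a b n (B : bifun a b n) (C : cpx a) (D : cpx b) s x y :
  kz s (pt B (x : C) (y : D)) = pt B (kz s x) (kz s y).
Proof.
have D1 : addmap (fun z : C => pt B (kz s z) (kz s y)).
  by move=> u v; rewrite kzD ptDl.
move: x; apply: (gext (hprP C)) => [u v|//|e x]; first by rewrite ptDl kzD.
have D2 : addmap (fun z : D => pt B (kz s (hpr e x)) (kz s z)).
  by move=> u v; rewrite kzD ptDr.
move: y {D1}; apply: (gext (hprP D)) => [u v|//|e' y]; first by rewrite ptDr kzD.
have E : pt B (hpr e x) (hpr e' y) = hpr (e + e') (pt B (hpr e x) (hpr e' y)).
  by rewrite pt_hpr eqxx.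
by rewrite E !kz_hpr -E ptMzl ptMzr -mulrzA mulrDr sgD mulrC.
Qed.

Lemma kz_conc n (M : gbimod n) s (x : conc M) : kz s x = x.
Proof.
have E : x = hpr 0 x by [].
by rewrite {1}E kz_hpr mulr0 mulr1z.
Qed.

Section Homogeneous.
Variables (n : nat) (C D : cpx n).

Lemma ctm_prt_l c d (z : C) (x : D) : prt c z = z ->
  ctm z (prt (d - c) x) = prt d (ctm z x).
Proof.
move=> h; move: x; apply: (gext (prtP D)) => [x y|x y|e x].
- by rewrite (gradD (prtP D)) ctmDr.
- by rewrite ctmDr (gradD (prtP _)).
rewrite -h ct_prtE (gradK (prtP D)) subr_eq [e + c]addrC.
by case: eqP => // _; exact: (addmap0 (@ctmDr _ _ _ _)).
Qed.

Lemma ctm_hpr_l c k (z : C) (x : D) : hpr c z = z ->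
  ctm z (hpr (k - c) x) = hpr k (ctm z x).
Proof.
move=> h; move: x; apply: (gext (hprP D)) => [x y|x y|e x].
- by rewrite hprD ctmDr.
- by rewrite ctmDr hprD.
rewrite -h ct_hprE (gradK (hprP D)) subr_eq [e + c]addrC.
by case: eqP => // _; exact: (addmap0 (@ctmDr _ _ _ _)).
Qed.
End Homogeneous.

Section Unit.
Variables (n : nat) (D : cpx n).

Lemma prt_one : prt 0 (1 : gunit n) = 1.
Proof.
have h : (1 : Rn n) \is 0.-homog by exact: dhomog1.
exact: (R_prt_hom 0 h).
Qed.

Let f (y : D) : ctens (cunit n) D := ctm (1 : cunit n) y.
Let g : ctens (cunit n) D -> D := @tlift _ _ _ (@sc_r n predT (cunit n)) (@sc_l n predT D) _
  (fun (r : cunit n) (y : D) => lact (r : Rn n) y).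

Let bal : balanced (@sc_r n predT (cunit n)) (@sc_l n predT D)
  (fun (r : Rn n) (y : D) => lact r y).
Proof.
have A := lactP D; split=> [y|r|[r rr] s y]; [exact: (actDl A)|exact: (actDr A)|].
by rewrite /sc_r /sc_l /= -(actM A) mulrC.
Qed.

Lemma ctens_unitl : ciso (ctens (cunit n) D) D.
Proof.
apply: ciso_sym; exists f, g; rewrite /f /g.
have gE (r : cunit n) (y : D) : @tlift _ _ _ (@sc_r n predT (cunit n)) (@sc_l n predT D) _
  (fun (r : cunit n) (y : D) => lact (r : Rn n) y) (ctm r y) = lact (r : Rn n) y.
  exact: (tliftE bal).
split.
- split; [split=> [x y|r y|r y|d]|move=> k|move=> y].
  + exact: ctmDr.
  + by rewrite ct_lact -ctmB.
  + by rewrite ct_ract.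
  + move=> y; rewrite -{1}[d]subr0; apply: ctm_prt_l; exact: prt_one.
  + by move=> y; rewrite -{1}[k]subr0; apply: ctm_hpr_l.
  + by rewrite ct_difE kz_conc (addmap0 (@ctmDl _ _ _ _)) add0r.
- by move=> y; rewrite gE (act1 (lactP D)).
- have gD := tliftD bal.
  apply: tens_ind => [|x y hx hy|r y].
  + by rewrite (addmap0 gD) (addmap0 (@ctmDr _ _ _ _)).
  + by rewrite gD ctmDr hx hy.
  + rewrite -/(ctm (r : cunit n) y) gE -ctmB; congr (ctm _ _).
    exact: mulr1.
Qed.
End Unit.

Section Assoc.
Variables (n : nat) (A B C : cpx n).

Lemma ct3_ext (V : zmodType) (f g : ctens (ctens A B) C -> V) :
  addmap f -> addmap g ->
  (forall a b c, f (ctm (ctm a b) c) = g (ctm (ctm a b) c)) ->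
  forall x, f x = g x.
Proof.
move=> fD gD fg; apply: ct_ext => // x c.
move: x; apply: ct_ext => [x y|x y|a b]; last exact: fg.
- by rewrite ctmDl fD.
- by rewrite ctmDl gD.
Qed.

Lemma ct3_hom_ext (V : zmodType) (f g : ctens (ctens A B) C -> V)
  (p : int -> A -> A) (q : int -> B -> B) (r : int -> C -> C) :
  is_grading p -> is_grading q -> is_grading r ->
  addmap f -> addmap g ->
  (forall i j k a b c, f (ctm (ctm (p i a) (q j b)) (r k c)) =
                       g (ctm (ctm (p i a) (q j b)) (r k c))) ->
  forall x, f x = g x.
Proof.
move=> pG qG rG fD gD fg; apply: ct3_ext => // a b c.
move: a; apply: (gext pG) => [x y|x y|i a].
- by rewrite ctmDl (ctmDl c) fD.
- by rewrite ctmDl (ctmDl c) gD.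
move: b; apply: (gext qG) => [x y|x y|j b].
- by rewrite ctmDr (ctmDl c) fD.
- by rewrite ctmDr (ctmDl c) gD.
move: c; apply: (gext rG) => [x y|x y|k c].
- by rewrite ctmDr fD.
- by rewrite ctmDr gD.
exact: fg.
Qed.

(** The associator is built in two stages, with the third factor held fixed in the first, because
    [tlift] takes functions of two variables. *)
Let al_in (c : C) : ctens A B -> ctens A (ctens B C) :=
  tlift (fun (a : A) (b : B) => @ctm n A (ctens B C) a (ctm b c)).
Let al_bal c : balanced (@sc_r n predT A) (@sc_l n predT B)
  (fun (a : A) (b : B) => @ctm n A (ctens B C) a (ctm b c)).
Proof.
split=> [b a a'|a b b'|[r rr] a b]; first exact: ctmDl.
  by rewrite ctmDl ctmDr.
by rewrite /sc_r /sc_l /= -ct_lact ctmB.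
Qed.
Let al_inE c a b : al_in c (ctm a b) = ctm a (ctm b c).
Proof. exact: (tliftE (al_bal c)). Qed.
Let al : ctens (ctens A B) C -> ctens A (ctens B C) :=
  tlift (fun (x : ctens A B) c => al_in c x).
Let al_bal2 : balanced (@sc_r n predT (ctens A B)) (@sc_l n predT C)
  (fun (x : ctens A B) c => al_in c x).
Proof.
have D c : addmap (al_in c) := tliftD (al_bal c).
split=> [c|x|[r rr] x c]; first exact: D.
  move: x; apply: ct_ind => [c c'|x y hx hy c c'|a b c c'].
  + by rewrite !(addmap0 (D _)) addr0.
  + by rewrite !D hx hy addrACA.
  + by rewrite !al_inE ctmDr ctmDr.
rewrite -[sc_r _ x]/(ract r x) -[sc_l _ c]/(lact r c).
move: x; apply: ct_ext => [x y|x y|a b].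
- by rewrite (actDr (ractP (ctens A B))) D.
- exact: D.
- by rewrite ct_ract !al_inE ctmB.
Qed.
Let alE a b c : al (ctm (ctm a b) c) = ctm a (ctm b c).
Proof. by rewrite -al_inE; exact: (tliftE al_bal2). Qed.
Let alD : addmap al := tliftD al_bal2.

Let be_in (a : A) : ctens B C -> ctens (ctens A B) C :=
  tlift (fun (b : B) (c : C) => @ctm n (ctens A B) C (ctm a b) c).
Let be_bal a : balanced (@sc_r n predT B) (@sc_l n predT C)
  (fun (b : B) (c : C) => @ctm n (ctens A B) C (ctm a b) c).
Proof.
split=> [c b b'|b c c'|[r rr] b c]; last by rewrite /sc_r /sc_l /= -ct_ract ctmB.
  by rewrite ctmDr ctmDl.
exact: ctmDr.
Qed.
Let be_inE a b c : be_in a (ctm b c) = ctm (ctm a b) c.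
Proof. exact: (tliftE (be_bal a)). Qed.
Let be : ctens A (ctens B C) -> ctens (ctens A B) C :=
  tlift (fun a (x : ctens B C) => be_in a x).
Let be_bal2 : balanced (@sc_r n predT A) (@sc_l n predT (ctens B C))
  (fun a (x : ctens B C) => be_in a x).
Proof.
have D a : addmap (be_in a) := tliftD (be_bal a).
split=> [x|a|[r rr] a x]; last first.
- rewrite -[sc_r _ a]/(ract r a) -[sc_l _ x]/(lact r x).
  move: x; apply: ct_ext => [x y|x y|b c].
  + exact: D.
  + by rewrite (actDr (lactP (ctens B C))) D.
  + by rewrite ct_lact !be_inE ctmB.
- exact: D.
move: x; apply: ct_ind => [a a'|x y hx hy a a'|b c a a'].
- by rewrite !(addmap0 (D _)) addr0.
- by rewrite !D hx hy addrACA.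
- by rewrite !be_inE !ctmDl.
Qed.
Let beE a b c : be (ctm a (ctm b c)) = ctm (ctm a b) c.
Proof. by rewrite -be_inE; exact: (tliftE be_bal2). Qed.
Let beD : addmap be := tliftD be_bal2.

Lemma ctens_assoc : ciso (ctens (ctens A B) C) (ctens A (ctens B C)).
Proof.
exists al, be; split.
- split; [split=> [|r|r|d]|move=> k|].
  + exact: alD.
  + apply: ct3_ext => [x y|x y|a b c].
    * by rewrite (actDr (lactP (ctens (ctens A B) C))) alD.
    * by rewrite alD (actDr (lactP (ctens A (ctens B C)))).
    by rewrite !ct_lact !alE ct_lact.
  + apply: ct3_ext => [x y|x y|a b c].
    * by rewrite (actDr (ractP (ctens (ctens A B) C))) alD.
    * by rewrite alD (actDr (ractP (ctens A (ctens B C)))).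
    by rewrite !ct_ract !alE !ct_ract.
  + apply: (ct3_hom_ext (prtP A) (prtP B) (prtP C)) => [x y|x y|i j k a b c].
    * by rewrite (gradD (prtP (ctens (ctens A B) C))) alD.
    * by rewrite alD (gradD (prtP (ctens A (ctens B C)))).
    have E : ctm (prt i a) (prt j b) = prt (i + j) (ctm (prt i a) (prt j b)).
      by rewrite ct_prtE eqxx.
    have E' : ctm (prt j b) (prt k c) = prt (j + k) (ctm (prt j b) (prt k c)).
      by rewrite ct_prtE eqxx.
    rewrite [in LHS]E ct_prtE -E alE [in RHS]E' ct_prtE -E' addrA.
    by case: eqP => _; rewrite ?alE // (addmap0 alD).
  + apply: (ct3_hom_ext (hprP A) (hprP B) (hprP C)) => [x y|x y|i j l a b c].
    * by rewrite hprD alD.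
    * by rewrite alD hprD.
    have E : ctm (hpr i a) (hpr j b) = hpr (i + j) (ctm (hpr i a) (hpr j b)).
      by rewrite ct_hprE eqxx.
    have E' : ctm (hpr j b) (hpr l c) = hpr (j + l) (ctm (hpr j b) (hpr l c)).
      by rewrite ct_hprE eqxx.
    rewrite [in LHS]E ct_hprE -E alE [in RHS]E' ct_hprE -E' addrA.
    by case: eqP => _; rewrite ?alE // (addmap0 alD).
  + apply: ct3_ext => [x y|x y|a b c].
    * by rewrite difD alD.
    * by rewrite alD difD.
    have E : kz 1 (ctm a b) = ctm (kz 1 a) (kz 1 b) := kz_pt (ctens_bifun n) 1 a b.
    rewrite alE !ct_difE E (ctmDl c) !alD !alE ctmDr; exact: esym (addrA _ _ _).
- apply: ct3_ext => [x y|//|a b c]; first by rewrite alD beD.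
  by rewrite alE beE.
- have E x c : al (be (ctm x c)) = ctm x c.
    move: c; apply: ct_ext => [u v|u v|b c].
    + by rewrite ctmDr beD alD.
    + exact: ctmDr.
    by rewrite beE alE.
  by apply: ct_ext => [x y|//|x c]; [rewrite beD alD|exact: E].
Qed.
End Assoc.

(** * Demazure operators and the model of B (x) C *)

Section Actions.
Variables (n : nat) (M : gbimod n).
Implicit Types (f g : Rn n) (x y : M).

Lemma lactDl f g x : lact (f + g) x = lact f x + lact g x.
Proof. exact: (actDl (lactP M) x f g). Qed.
Lemma lactBl f g x : lact (f - g) x = lact f x - lact g x.
Proof. exact: (addmapB (actDl (lactP M) x) f g). Qed.
Lemma lactNl f x : lact (- f) x = - lact f x.
Proof. exact: (addmapN (actDl (lactP M) x) f). Qed.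
Lemma lact0l x : lact 0 x = 0.
Proof. exact: (addmap0 (actDl (lactP M) x)). Qed.
Lemma lact1 x : lact 1 x = x.
Proof. exact: (act1 (lactP M) x). Qed.
Lemma lactM f g x : lact (f * g) x = lact f (lact g x).
Proof. exact: (actM (lactP M) f g x). Qed.
Lemma lactDr f x y : lact f (x + y) = lact f x + lact f y.
Proof. exact: (actDr (lactP M) f x y). Qed.
Lemma lactBr f x y : lact f (x - y) = lact f x - lact f y.
Proof. exact: (addmapB (actDr (lactP M) f) x y). Qed.
Lemma lact0r f : lact f (0 : M) = 0.
Proof. exact: (addmap0 (actDr (lactP M) f)). Qed.
Lemma ractDl f g x : ract (f + g) x = ract f x + ract g x.
Proof. exact: (actDl (ractP M) x f g). Qed.
Lemma ractDr f x y : ract f (x + y) = ract f x + ract f y.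
Proof. exact: (actDr (ractP M) f x y). Qed.
Lemma ractBr f x y : ract f (x - y) = ract f x - ract f y.
Proof. exact: (addmapB (actDr (ractP M) f) x y). Qed.
Lemma ractBl f g x : ract (f - g) x = ract f x - ract g x.
Proof. exact: (addmapB (actDl (ractP M) x) f g). Qed.
Lemma ractNl f x : ract (- f) x = - ract f x.
Proof. exact: (addmapN (actDl (ractP M) x) f). Qed.
Lemma ract0r f : ract f (0 : M) = 0.
Proof. exact: (addmap0 (actDr (ractP M) f)). Qed.
Lemma ract1 x : ract 1 x = x.
Proof. exact: (act1 (ractP M) x). Qed.
Lemma ractM f g x : ract (f * g) x = ract f (ract g x).
Proof. exact: (actM (ractP M) f g x). Qed.
Lemma prtD e x y : prt e (x + y) = prt e x + prt e y.
Proof. exact: (gradD (prtP M) e x y). Qed.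
Lemma prtB e x y : prt e (x - y) = prt e x - prt e y.
Proof. exact: (addmapB (gradD (prtP M) e) x y). Qed.
Lemma prtN e x : prt e (- x) = - prt e x.
Proof. exact: (addmapN (gradD (prtP M) e) x). Qed.

Lemma lact_var u e x : lact 'X_u (prt e x) = prt (e + 2) (lact 'X_u x).
Proof.
have h : ('X_u : Rn n) \is 1.-homog by rewrite dhomogX; apply/eqP; exact: mdeg1.
by rewrite (lact_prt h).
Qed.

End Actions.

Section Demazure.
Variables (n : nat) (a b : 'I_n).
Hypothesis ab : a != b.
Implicit Types f g : Rn n.
Notation Xa := ('X_a : Rn n).
Notation Xb := ('X_b : Rn n).
Notation sig := (msym (R := int) (tperm a b)).

Lemma msym_var (s : {perm 'I_n}) u : msym s ('X_u : Rn n) = 'X_(s u).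
Proof.
rewrite msymX; congr 'X_[_]; apply/mnmP => i; rewrite !mnmE.
by rewrite -(inj_eq (@perm_inj _ s)) permKV.
Qed.

Lemma sub_var_neq0 : Xa - Xb != 0.
Proof.
apply/eqP => /(congr1 (fun f : Rn n => f@_U_(a))); rewrite mcoeffB !mcoeffX.
rewrite mcoeff0 eqxx; case: eqP => [/mnmP/(_ a)|_ /eqP]; last by rewrite subr0 oner_eq0.
by rewrite !mnm1E eqxx eq_sym (negPf ab).
Qed.

(** Divisibility passes to products by the twisted Leibniz rule u f - s(u) s(f) = (u - s(u)) f +
    s(u) (f - s(f)), so it only has to be seen on variables. *)
Lemma dz_ex f : exists g, f - sig f = (Xa - Xb) * g.
Proof.
elim/mpoly_int_ind: f => [|f g [f' hf] [g' hg]|f u [f' hf]].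
- by exists 0; rewrite msym1 subrr mulr0.
- exists (f' - g'); rewrite msymB mulrBr -hf -hg; ring.
have [v hv] : exists v, 'X_u - sig 'X_u = (Xa - Xb) * v.
  rewrite msym_var; case: tpermP => [->|->|_ _].
  - by exists 1; rewrite mulr1.
  - by exists (-1); ring.
  - by exists 0; rewrite subrr mulr0.
exists (v * f + sig 'X_u * f'); rewrite msymM.
have -> : 'X_u * f - sig 'X_u * sig f =
    ('X_u - sig 'X_u) * f + sig 'X_u * (f - sig f) by ring.
by rewrite hv hf; ring.
Qed.

Lemma dz_sigma : {d : Rn n -> Rn n | forall f, f - sig f = (Xa - Xb) * d f}.
Proof. by exists (fun f => projT1 (cid (dz_ex f))) => f; case: cid. Qed.

(* the Demazure operator f |-> (f - s f) / (x_a - x_b), s = (a b) *)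
Definition dz : Rn n -> Rn n := sval dz_sigma.

Lemma dzE f : f - sig f = (Xa - Xb) * dz f.
Proof. exact: (svalP dz_sigma). Qed.

Lemma dz_uniq f g : f - sig f = (Xa - Xb) * g -> dz f = g.
Proof. by rewrite dzE => /(mulfI sub_var_neq0). Qed.

Lemma dz_sig f : sig f = f - (Xa - Xb) * dz f.
Proof. by rewrite -dzE; ring. Qed.

Lemma dzD : addmap dz.
Proof. by move=> f g; apply: dz_uniq; rewrite msymD mulrDr -!dzE; ring. Qed.

Lemma dzM f g : dz (f * g) = dz f * g + f * dz g - (Xa - Xb) * dz f * dz g.
Proof. by apply: dz_uniq; rewrite msymM !dz_sig; ring. Qed.

Lemma dz_inv f : sig f = f -> dz f = 0.
Proof. by move=> h; apply: dz_uniq; rewrite h subrr mulr0. Qed.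

Lemma dz1 : dz 1 = 0.
Proof. by apply: dz_inv; rewrite msym1. Qed.

Lemma dz_a : dz Xa = 1.
Proof. by apply: dz_uniq; rewrite msym_var tpermL mulr1. Qed.

Lemma dz_b : dz Xb = -1.
Proof. by apply: dz_uniq; rewrite msym_var tpermR; ring. Qed.

Lemma dz_c c : c != a -> c != b -> dz 'X_c = 0.
Proof.
by move=> ca cb; apply: dz_inv; rewrite msym_var tpermD // eq_sym.
Qed.

Lemma sig_dz f : sig (dz f) = dz f.
Proof.
apply: (mulfI sub_var_neq0); rewrite -dzE.
have /(congr1 sig) := dzE f; rewrite msymM !msymB !msym_var tpermL tpermR.
rewrite -msymMm tperm2 msym1m => h.
by rewrite -[Xa - Xb]opprB mulNr -h; ring.
Qed.

(** The explicit formula is sealed behind an opaque proof, so that unification never unfolds [dz0]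
    and only [dz0E] gives access to it. *)
Lemma dz0_sigma : {d : Rn n -> Rn n | forall f, d f = f - Xa * dz f}.
Proof. by exists (fun f => f - Xa * dz f). Qed.

(* the s-invariant component of f = dz0 f + x_a dz f *)
Definition dz0 : Rn n -> Rn n := sval dz0_sigma.

Lemma dz0E f : dz0 f = f - Xa * dz f.
Proof. exact: (svalP dz0_sigma). Qed.

Lemma dz0D : addmap dz0.
Proof. by move=> f g; rewrite !dz0E dzD; ring. Qed.

Lemma sig_dz0 f : sig (dz0 f) = dz0 f.
Proof. by rewrite !dz0E msymB msymM sig_dz msym_var tpermL dz_sig; ring. Qed.

Lemma dz_invM r f : sig r = r -> dz (r * f) = r * dz f.
Proof. by move=> h; rewrite dzM (dz_inv h); ring. Qed.

Lemma dz0_invM r f : sig r = r -> dz0 (r * f) = r * dz0 f.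
Proof. by move=> h; rewrite !dz0E dz_invM //; ring. Qed.

(* [gB M] is B (x) M for B = R (x)_(R^s) R (1), where (m, m') stands for
   1 (x) m + x_a (x) m'. *)
Section GB.
Variable M : gbimod n.
(** The matrix of multiplication by f in the basis 1, x_a over the s-invariants. The second column
    comes from x_a^2 = (x_a + x_b) x_a - x_a x_b, which gives f x_a = - x_a x_b dz f + x_a (f + x_b
    dz f). All four coefficients are s-invariant, hence cross the tensor sign and act on M. *)
Definition b_lact f (x : M * M) : M * M :=
  (lact (dz0 f) x.1 - lact (Xa * Xb * dz f) x.2,
   lact (dz f) x.1 + lact (f + Xb * dz f) x.2).
Definition b_ract f (x : M * M) : M * M := (ract f x.1, ract f x.2).
(** Because of the shift in B = R (x) R (1), the basis element 1 has degree -1 and x_a has degree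
    1. *)
Definition b_prt (d : int) (x : M * M) : M * M := (prt (d + 1) x.1, prt (d - 1) x.2).

Lemma b_lactP : is_action b_lact.
Proof.
split=> [f [x y] [x' y']|[x y] f g|[x y]|f g [x y]]; rewrite /b_lact /=.
- by rewrite pair_add !lactDr; congr (_, _); zmod.
- rewrite [RHS]pair_add dz0D dzD (mulrDr (Xa * Xb)) (mulrDr Xb) !lactDl; congr (_, _); zmod.
- by rewrite dz0E dz1 !mulr0 subr0 addr0 !lact0l !lact1 subr0 add0r.
rewrite !lactBr !lactDr -!lactM; congr (_, _).
  have -> : dz0 (f * g) = dz0 f * dz0 g - Xa * Xb * dz f * dz g.
    by rewrite !dz0E dzM; ring.
  have -> : Xa * Xb * dz (f * g) = dz0 f * (Xa * Xb * dz g) +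
      Xa * Xb * dz f * (g + Xb * dz g).
    by rewrite !dz0E dzM; ring.
  by rewrite lactBl lactDl; zmod.
have -> : f * g + Xb * dz (f * g) = (f + Xb * dz f) * (g + Xb * dz g) -
    dz f * (Xa * Xb * dz g).
  by rewrite dzM; ring.
have -> : dz (f * g) = dz f * dz0 g + (f + Xb * dz f) * dz g.
  by rewrite !dz0E dzM; ring.
by rewrite lactBl lactDl; zmod.
Qed.

Lemma b_ractP : is_action b_ract.
Proof.
split=> [f [x y] [x' y']|[x y] f g|[x y]|f g [x y]]; rewrite /b_ract /=.
- by rewrite pair_add !ractDr.
- by rewrite pair_add !ractDl.
- by rewrite !ract1.
- by rewrite !ractM.
Qed.

Lemma b_lractC f g x : b_lact f (b_ract g x) = b_ract g (b_lact f x).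
Proof. by rewrite /b_lact /b_ract /= !lractC ractBr ractDr. Qed.

Lemma b_prtP : is_grading b_prt.
Proof. exact: pair_grP (shift_prtP 1 M) (shift_prtP (-1) M). Qed.

Lemma b_lact_a x : b_lact Xa x =
  (- lact Xa (lact Xb x.2), x.1 + lact Xa x.2 + lact Xb x.2).
Proof.
rewrite /b_lact dz0E dz_a !mulr1 subrr lact0l sub0r lact1 lactDl lactM.
by rewrite addrA.
Qed.

Lemma b_lact_b x : b_lact Xb x =
  (lact Xa x.1 + lact Xb x.1 + lact Xa (lact Xb x.2), - x.1).
Proof.
rewrite /b_lact dz0E dz_b !mulrN1 opprK subrr lact0l addr0 !lactNl opprK lact1.
by rewrite lactDl lactM [lact Xb _ + _]addrC.
Qed.

Lemma b_lact_c c x : c != a -> c != b ->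
  b_lact 'X_c x = (lact 'X_c x.1, lact 'X_c x.2).
Proof.
by move=> ca cb; rewrite /b_lact dz0E dz_c // !mulr0 !lact0l !subr0 add0r addr0.
Qed.

Lemma b_lact_prt d f : f \is d.-homog -> forall e x,
  b_lact f (b_prt e x) = b_prt (e + d.*2%:Z) (b_lact f x).
Proof.
apply: (act_homog b_lactP (gradD b_prtP)) => u e x.
have [->|ua] := eqVneq u a.
  rewrite !b_lact_a /b_prt /= !lact_var prtN !prtD.
  by congr (- prt _ _, prt _ _ + prt _ _ + prt _ _); lia.
have [->|ub] := eqVneq u b.
  rewrite !b_lact_b /b_prt /= !lact_var prtN !prtD.
  by congr (prt _ _ + prt _ _ + prt _ _, - prt _ _); lia.
rewrite !b_lact_c // /b_prt /= !lact_var.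
by congr (prt _ _, prt _ _); lia.
Qed.

Lemma b_ract_prt d f : f \is d.-homog -> forall e x,
  b_ract f (b_prt e x) = b_prt (e + d.*2%:Z) (b_ract f x).
Proof.
move=> fd e x; rewrite /b_ract /b_prt /= !(ract_prt fd).
by congr (prt _ _, prt _ _); lia.
Qed.

Definition gB : gbimod n :=
  GBimod b_lactP b_ractP b_lractC b_prtP b_lact_prt b_ract_prt.
End GB.

Lemma b_map (M N : gbimod n) (f : M -> N) : ghom f ->
  ghom (fun x : gB M => (f x.1, f x.2) : gB N).
Proof.
move=> [fD fl fr fp]; split=> [[x y] [x' y']|r [x y]|r [x y]|d [x y]] /=.
- by rewrite !fD.
- by rewrite /b_lact /= (addmapB fD) fD !fl.
- by rewrite /b_ract /= !fr.
- by rewrite /b_prt /= !fp.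
Qed.

Section CB.
Variable C : cpx n.
Definition cB_hpr (k : int) (x : gB C) : gB C := (hpr k x.1, hpr k x.2).
Definition cB_dif (x : gB C) : gB C := (dif x.1, dif x.2).

Lemma cB_hprP : is_grading cB_hpr.
Proof. exact: pair_grP (hprP C) (hprP C). Qed.
Lemma cB_hpr_hom k : ghom (cB_hpr k).
Proof. exact: b_map (hpr_hom C k). Qed.
Lemma cB_dif_hom : ghom cB_dif.
Proof. exact: b_map (dif_hom C). Qed.
Lemma cB_dif_hpr k x : cB_dif (cB_hpr k x) = cB_hpr (k + 1) (cB_dif x).
Proof. by rewrite /cB_dif /cB_hpr /= !dif_hpr. Qed.
Lemma cB_dif2 x : cB_dif (cB_dif x) = 0.
Proof. by rewrite /cB_dif /= !dif_dif. Qed.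
Definition cB : cpx n :=
  Cpx cB_hprP cB_hpr_hom cB_dif_hom cB_dif_hpr cB_dif2.

(* (B -> R(1)) (x) C *)
Definition b_mu (x : gB C) : gshift 1 C := x.1 + lact Xa x.2.

Lemma b_mu_hom : ghom b_mu.
Proof.
split=> [[x y] [x' y']|r [x y]|r [x y]|d [x y]]; rewrite /b_mu /=.
- by rewrite lactDr; exact: addrACA.
- rewrite /b_lact /= !lactDr -!lactM.
  rewrite dz0E.
  have -> : Xa * (r + Xb * dz r) = r * Xa + Xa * Xb * dz r by ring.
  by rewrite lactBl lactDl; zmod.
- by rewrite /b_ract /= ractDr lractC.
- rewrite /b_prt /shift_prt /= prtD lact_var.
  by congr (_ + prt _ _); lia.
Qed.

Definition gF : gbimod n := gsum (gB C) (gshift 1 C).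
Definition cF_hpr (k : int) (x : gF) : gF := (cB_hpr k x.1, hpr (k - 1) x.2).
Definition cF_dif (x : gF) : gF := (cB_dif x.1, b_mu x.1 - dif x.2).

Lemma cF_hprP : is_grading cF_hpr.
Proof. exact: pair_grP cB_hprP (sh_hprP 0 (-1) C). Qed.

Lemma gsum_map (M M' N N' : gbimod n) (f : M -> M') (g : N -> N') :
  ghom f -> ghom g -> ghom (fun x : gsum M N => (f x.1, g x.2) : gsum M' N').
Proof.
move=> [fD fl fr fp] [gD gl gr gp].
split=> [[x y] [x' y']|r [x y]|r [x y]|d [x y]].
- by rewrite /= fD gD.
- by rewrite /= /sum_lact /= fl gl.
- by rewrite /= /sum_ract /= fr gr.
- by rewrite /= /pair_gr /= fp gp.
Qed.

Lemma cF_hpr_hom k : ghom (cF_hpr k).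
Proof.
apply: gsum_map; first exact: cB_hpr_hom.
have [hD hl hr hp] := hpr_hom C (k - 1); split=> // d x; exact: hp.
Qed.

Lemma cF_dif_hom : ghom cF_dif.
Proof.
have [hD hl hr hp] := cB_dif_hom; have [mD ml mr mp] := b_mu_hom.
have [dD dl dr dp] := dif_hom C.
split=> [[x y] [x' y']|r [x y]|r [x y]|d [x y]].
- have E (u v w z : C) : u + v - (w + z) = (u - w) + (v - z) by zmod.
  rewrite /cF_dif /= hD mD pair_add; congr (_, _); rewrite dD; exact: E.
- by rewrite /cF_dif /= /sum_lact /= hl ml dl lactBr.
- by rewrite /cF_dif /= /sum_ract /= hr mr dr ractBr.
- rewrite /cF_dif /= /pair_gr /= hp mp dp /=.
  by rewrite /shift_prt prtB.
Qed.

Lemma cF_dif_hpr k x : cF_dif (cF_hpr k x) = cF_hpr (k + 1) (cF_dif x).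
Proof.
rewrite /cF_dif /cF_hpr /= cB_dif_hpr addrK; congr (_, _).
rewrite dif_hpr subrK (addmapB (@hprD _ _ _)); congr (_ - _).
by rewrite /b_mu /= hprD (ghom_l (hpr_hom C k)).
Qed.

Lemma cF_dif2 x : cF_dif (cF_dif x) = 0.
Proof.
rewrite /cF_dif /= cB_dif2; congr (_, _).
rewrite (addmapB (@difD _ _)) dif_dif subr0 /b_mu /cB_dif /=.
by rewrite difD (ghom_l (dif_hom C)) subrr.
Qed.

Definition cF : cpx n :=
  Cpx cF_hprP cF_hpr_hom cF_dif_hom cF_dif_hpr cF_dif2.
End CB.
End Demazure.

(** * Comparison with B_i and F(sigma_i) *)

Section Model.
Variables (n : nat) (a b : 'I_n) (ab : a != b) (i : 'I_n.-1).
Hypothesis iE : s_ i = tperm a b.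
Notation Xa := ('X_a : Rn n).
Notation Xb := ('X_b : Rn n).
Notation dz := (dz a b).
Notation dz0 := (dz0 a b).
Notation S := (Rinv i).

Definition bs (f g : Rn n) : Bs i :=
  tmk (@sc_r n S (gunit n)) (@sc_l n S (gunit n)) f g.

Lemma bs_lact r f g : lact r (bs f g) = bs (r * f) g.
Proof. exact: (tmapE f g (@ot_lcompat n S (gunit n) (gunit n) r)). Qed.

Lemma bs_ract r f g : ract r (bs f g) = bs f (r * g).
Proof. exact: (tmapE f g (@ot_rcompat n S (gunit n) (gunit n) r)). Qed.

Lemma bs_swap r f g : msym (tperm a b) r = r -> bs (r * f) g = bs f (r * g).
Proof.
move=> h; have rS : r \in S by rewrite unfold_in /Rinv iE h.
exact: (tmkB (@sc_r n S (gunit n)) (@sc_l n S (gunit n)) (exist _ r rS)).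
Qed.

Lemma bsDl f f' g : bs (f + f') g = bs f g + bs f' g.
Proof. exact: (tmkDl _ _ g). Qed.

Lemma bs_ext (V : zmodType) (f g : Bs i -> V) : addmap f -> addmap g ->
  (forall u v, f (bs u v) = g (bs u v)) -> forall x, f x = g x.
Proof. exact: tens_ext. Qed.

Lemma dz0_split f : dz0 f + Xa * dz f = f.
Proof. by rewrite dz0E; ring. Qed.

Lemma bs_split f g : bs f g = ract (dz0 f * g) (bs 1 1) + ract (dz f * g) (bs Xa 1).
Proof.
rewrite !bs_ract !mulr1 -[in LHS](dz0_split f) bsDl [Xa * _]mulrC.
by rewrite bs_swap ?sig_dz // -[X in bs X g]mulr1 bs_swap ?sig_dz0.
Qed.

Lemma bs_lact1 f : lact f (bs 1 1) = ract (dz0 f) (bs 1 1) + ract (dz f) (bs Xa 1).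
Proof. by rewrite bs_lact mulr1 bs_split !mulr1. Qed.

Lemma bs_lacta f : lact f (bs Xa 1) =
  - ract (Xa * Xb * dz f) (bs 1 1) + ract (f + Xb * dz f) (bs Xa 1).
Proof.
rewrite bs_lact bs_split !mulr1 dz0E (dzM ab) (dz_a ab) -ractNl; congr (ract _ _ + ract _ _).
  by ring.
by ring.
Qed.

Lemma bs_prt1 : prt (-1) (bs 1 1) = bs 1 1.
Proof.
have E := tensor_gr (p := @R_prt n) (q := @R_prt n) (R_prtP n) (R_prtP n) (-1 + 1) 0 0 1 1
  (@sc_rD n S (gunit n)) (sc_balanced (@Rinv_hom n i) (gunit n) (gunit n)).
have h1 : R_prt 0 (1 : Rn n) = 1 := prt_one n.
rewrite eqxx !h1 in E; exact: E.
Qed.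

Lemma R_prt_var u : R_prt 2 ('X_u : Rn n) = 'X_u.
Proof.
have h : ('X_u : Rn n) \is 1.-homog by rewrite dhomogX; apply/eqP; exact: mdeg1.
by rewrite (R_prt_hom _ h).
Qed.

Lemma bs_prta : prt 1 (bs Xa 1) = bs Xa 1.
Proof.
have E := tensor_gr (p := @R_prt n) (q := @R_prt n) (R_prtP n) (R_prtP n) (1 + 1) 2 0 Xa 1
  (@sc_rD n S (gunit n)) (sc_balanced (@Rinv_hom n i) (gunit n) (gunit n)).
have h1 : R_prt 0 (1 : Rn n) = 1 := prt_one n.
rewrite eqxx h1 R_prt_var in E; exact: E.
Qed.

Section Coord.
Variable M : gbimod n.

Definition bs_coord (x : M) : Bs i -> M * M :=
  @tlift _ _ _ (@sc_r n S (gunit n)) (@sc_l n S (gunit n)) (M * M)%type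
   (fun f g : Rn n => (lact (dz0 f * g) x, lact (dz f * g) x)).

Lemma bs_coord_bal x : balanced (@sc_r n S (gunit n)) (@sc_l n S (gunit n))
  (fun f g : Rn n => (lact (dz0 f * g) x, lact (dz f * g) x) : (M * M)%type).
Proof.
split=> [g f f'|f g g'|[r rS] f g].
- rewrite [RHS]pair_add (dz0D ab f f') (dzD ab f f').
  by rewrite (mulrDl (dz0 f)) (mulrDl (dz f)) !lactDl.
- by rewrite [RHS]pair_add (mulrDr (dz0 f)) (mulrDr (dz f)) !lactDl.
have h : msym (tperm a b) r = r.
  by move: rS; rewrite unfold_in /Rinv iE => /eqP.
rewrite /sc_r /sc_l /= (dz0_invM ab) // (dz_invM ab) //.
by congr (lact _ x, lact _ x); rewrite mulrCA mulrA.
Qed.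

Lemma bs_coordE x f g :
  bs_coord x (bs f g) = (lact (dz0 f * g) x, lact (dz f * g) x).
Proof. exact: (tliftE (bs_coord_bal x)). Qed.

Lemma bs_coordD x : addmap (bs_coord x).
Proof. exact: tliftD (bs_coord_bal x). Qed.

Lemma bs_coordDl y : addmap (bs_coord^~ y).
Proof.
move=> x x'; move: y; apply: bs_ext => [u v|u v|f g].
- exact: bs_coordD.
- by rewrite !bs_coordD; exact: addrACA.
- by rewrite !bs_coordE [RHS]pair_add !lactDr.
Qed.

Lemma bs_coord_swap r x y : bs_coord x (ract r y) = bs_coord (lact r x) y.
Proof.
move: y; apply: bs_ext => [u v|u v|f g].
- by rewrite ractDr bs_coordD.
- exact: bs_coordD.
- rewrite bs_ract !bs_coordE -!lactM.
  by congr (lact _ x, lact _ x); ring.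
Qed.
End Coord.

Section Iso.
Variable C : cpx n.

Let P := ctens (conc (Bs i)) C.
Let e1 : conc (Bs i) := bs 1 1.
Let ea : conc (Bs i) := bs Xa 1.

(** The coordinates refer to the basis 1, x_a of B_i. Only the transposition is prescribed, so a may
    be either of the two positions; the braid relation needs this freedom to have the shared strand
    as b in both models. *)
Lemma cB_iso : ciso (cB ab C) (ctens (conc (Bs i)) C).
Proof.
pose f (x : cB ab C) : P := ctm e1 x.1 + ctm ea x.2.
pose g : P -> cB ab C := @tlift _ _ _ (@sc_r n predT (conc (Bs i)))
  (@sc_l n predT C) (gB ab C) (fun y x => bs_coord x y).
have bal : balanced (@sc_r n predT (conc (Bs i))) (@sc_l n predT C)
    (fun y x => bs_coord x y : gB ab C).
  split=> [x|y|[r rr] y x]; [exact: bs_coordD|exact: bs_coordDl|].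
  exact: bs_coord_swap.
have gE y x : g (ctm y x) = bs_coord x y by exact: (tliftE bal).
have gD : addmap g by exact: tliftD bal.
have fD : addmap f.
  move=> x y; rewrite /f (ctmDr e1 x.1 y.1) (ctmDr ea x.2 y.2); exact: addrACA.
exists f, g; split.
- split; [split=> [|r [x y]|r [x y]|d]|move=> k|move=> [x y]].
  + exact: fD.
  + have L1 : lact r e1 = ract (dz0 r) e1 + ract (dz r) ea := bs_lact1 r.
    have La : lact r ea = - ract (Xa * Xb * dz r) e1 + ract (r + Xb * dz r) ea :=
      bs_lacta r.
    rewrite /f lactDr !ct_lact L1 La.
    rewrite !(ctmDl _) -ractNl !ctmB lactNl.
    have -> : lact r ((x, y) : cB ab C) = (lact (dz0 r) x - lact (Xa * Xb * dz r) y,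
        lact (dz r) x + lact (r + Xb * dz r) y) by [].
    cbn [fst snd].
    rewrite (addmapB (@ctmDr _ _ _ _)) ctmDr (addmapN (@ctmDr _ _ _ _)).
    by zmod.
  + by rewrite /f ractDr !ct_ract.
  + have h1 : prt (-1) e1 = e1 := bs_prt1.
    have h2 : prt 1 ea = ea := bs_prta.
    move=> [x y]; rewrite /f [RHS]prtD -(ctm_prt_l d x h1) -(ctm_prt_l d y h2).
    by rewrite opprK.
  + by move=> [x y]; rewrite /f [RHS]hprD -!(@ctm_hpr_l n (conc (Bs i)) C 0) ?subr0.
  + by rewrite /f [RHS]difD !ct_difE !kz_conc !(addmap0 (@ctmDl _ _ _ _)) !add0r.
- move=> [x y]; rewrite /f gD !gE !bs_coordE dz0E (dz1 ab) dz0E (dz_a ab).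
  rewrite !mulr1 mulr0 subr0 subrr !lact0l !lact1.
  by rewrite [LHS]pair_add addr0 add0r.
- apply: ct_ext => [x y|//|y x]; first by rewrite gD fD.
  rewrite gE; move: y; apply: bs_ext => [u v|u v|u v].
  + by rewrite bs_coordD fD.
  + exact: ctmDl.
  + rewrite bs_coordE /f; cbn [fst snd]; rewrite -!ctmB -ctmDl.
    congr (ctm _ x); exact: esym (bs_split u v).
Qed.

Lemma cF_iso : ciso (cF ab C) (ctens (Fsigma i) C).
Proof.
pose fe1 : Fsigma i := (e1, 0); pose fea : Fsigma i := (ea, 0).
pose f1 : Fsigma i := (0, 1).
pose f (x : cF ab C) : ctens (Fsigma i) C :=
  ctm fe1 x.1.1 + ctm fea x.1.2 + ctm f1 x.2.
pose coord (y : Fsigma i) (x : C) : cF ab C := (bs_coord x y.1, lact (y.2 : Rn n) x).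
pose g : ctens (Fsigma i) C -> cF ab C := @tlift _ _ _ (@sc_r n predT (Fsigma i))
  (@sc_l n predT C) (cF ab C) coord.
have bal : balanced (@sc_r n predT (Fsigma i)) (@sc_l n predT C) coord.
  split=> [x [y z] [y' z']|[y z] x x'|[r rr] [y z] x]; rewrite /coord /=.
  - by rewrite bs_coordD lactDl.
  - by rewrite (bs_coordDl y) lactDr.
  - rewrite /sc_r /sc_l /= bs_coord_swap; congr (_, _).
    by rewrite -lactM mulrC.
have gE y x : g (ctm y x) = coord y x by exact: (tliftE bal).
have gD : addmap g by exact: tliftD bal.
have fD : addmap f.
  move=> x y; have E (u v w u' v' w' : ctens (Fsigma i) C) :
    u + u' + (v + v') + (w + w') = u + v + w + (u' + v' + w') by zmod.
  rewrite /f (ctmDr fe1 x.1.1 y.1.1) (ctmDr fea x.1.2 y.1.2) (ctmDr f1 x.2 y.2).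
  exact: E.
have zr : ract (0 : Rn n) = ract 0 by [].
exists f, g; split.
- split; [split=> [|r [[x y] z]|r [[x y] z]|d]|move=> k|move=> [[x y] z]].
  + exact: fD.
  + rewrite /f !lactDr !ct_lact.
    have -> : lact r fe1 = ract (dz0 r) fe1 + ract (dz r) fea.
      rewrite [RHS]pair_add; congr (_, _); first exact: bs_lact1.
      by rewrite /= !mulr0 addr0.
    have -> : lact r fea = - ract (Xa * Xb * dz r) fe1 + ract (r + Xb * dz r) fea.
      rewrite [RHS]pair_add; congr (_, _); first exact: bs_lacta.
      by rewrite /= !mulr0 addr0 oppr0.
    have -> : lact r f1 = ract r f1.
      by congr (_, _); rewrite lact0r ract0r.
    rewrite !ctmDl -ractNl !ctmB lactNl.
    have -> : lact r ((x, y, z) : cF ab C) = ((lact (dz0 r) x - lact (Xa * Xb * dz r) y,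
        lact (dz r) x + lact (r + Xb * dz r) y), lact r (z : C)) by [].
    cbn [fst snd].
    rewrite (addmapB (@ctmDr _ _ _ _)) ctmDr (addmapN (@ctmDr _ _ _ _)).
    by zmod.
  + by rewrite /f !ractDr !ct_ract.
  + have h1 : prt (-1) fe1 = fe1.
      by congr (_, _); [exact: bs_prt1|exact: (addmap0 (@R_prtD n _))].
    have h2 : prt 1 fea = fea.
      by congr (_, _); [exact: bs_prta|exact: (addmap0 (@R_prtD n _))].
    have h3 : prt (-1) f1 = f1.
      congr (_, _); first exact: (addmap0 (gradD (prtP (Bs i)) _)).
      exact: prt_one.
    move=> [[x y] z]; rewrite /f !prtD -(ctm_prt_l d x h1) -(ctm_prt_l d y h2).
    by rewrite -(ctm_prt_l d z h3) opprK.
  + have h1 : hpr 0 fe1 = fe1 by [].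
    have h2 : hpr 0 fea = fea by [].
    have h3 : hpr 1 f1 = f1 by [].
    move=> [[x y] z]; rewrite /f !hprD -(ctm_hpr_l k x h1) -(ctm_hpr_l k y h2).
    by rewrite -(ctm_hpr_l k z h3) subr0.
  + have k1 c s (w : Fsigma i) : hpr c w = w -> kz s w = w *~ sg (s * c).
      by move=> <-; rewrite kz_hpr.
    have -> : f (dif ((x, y, z) : cF ab C)) = ctm fe1 (dif x) + ctm fea (dif y)
        + ctm f1 (x + lact Xa y - dif (z : C)) by [].
    have -> : f (x, y, z) = ctm fe1 x + ctm fea y + ctm f1 (z : C) by [].
    rewrite !difD !ct_difE (k1 0) // (k1 0 _ fea) // (k1 1) // mulr0.
    rewrite !mulr1 !mulr1z.
    have -> : dif fe1 = f1.
      congr (_, _); apply: etrans (tliftE (B_mul_bal i) 1 1) _; exact: mulr1.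
    have -> : dif fea = ract Xa f1.
      congr (_, _); first by rewrite ract0r.
      by apply: etrans (tliftE (B_mul_bal i) Xa 1) _.
    have -> : dif f1 = 0.
      by congr (_, _); exact: (addmap0 (ghomD (@B_mul_hom n i))).
    rewrite ctmB (addmap0 (@ctmDl _ _ _ _)).
    have -> : ctm (f1 *~ sg 1) (dif (z : C)) = - ctm f1 (dif (z : C)).
      by rewrite (addmapMz (@ctmDl _ _ _ _)) mulrN1z.
    rewrite (addmapB (@ctmDr _ _ _ f1)) (ctmDr f1 x).
    by zmod.
- move=> [[x y] z]; rewrite /f !gD !gE /coord /= !bs_coordE dz0E (dz1 ab) dz0E (dz_a ab).
  rewrite !mulr1 mulr0 subr0 subrr !lact0l !lact1 (addmap0 (@bs_coordD _ _)).
  by rewrite !pair_add !addr0 !add0r.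
- apply: ct_ext => [x y|//|[y r] x]; first by rewrite gD fD.
  rewrite gE /coord.
  have -> : ctm ((y, r) : Fsigma i) x =
      ctm ((y, 0) : Fsigma i) x + ctm ((0, r) : Fsigma i) x.
    by rewrite -ctmDl; congr (ctm _ x); rewrite [RHS]pair_add addr0 add0r.
  have F (w : Bs i) : ctm fe1 (bs_coord x w).1 + ctm fea (bs_coord x w).2 =
      ctm ((w, 0) : Fsigma i) x.
    move: w {y}; apply: bs_ext => [u v|u v|u v].
    + rewrite bs_coordD (ctmDr fe1 (bs_coord x u).1) (ctmDr fea (bs_coord x u).2).
      exact: addrACA.
    + by rewrite -ctmDl; congr (ctm _ x); rewrite [RHS]pair_add addr0.
    + rewrite bs_coordE; cbn [fst snd]; rewrite -!ctmB -ctmDl; congr (ctm _ x).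
      rewrite [LHS]pair_add /=; congr (_, _); first exact: esym (bs_split u v).
      by rewrite !mulr0 addr0.
  rewrite /f; cbn [fst snd]; rewrite F; congr (_ + _).
  rewrite -ctmB; congr (ctm _ x); congr (_, _); first by rewrite ract0r.
  exact: mulr1.
Qed.
End Iso.
End Model.

(* If B (x) C is contractible then (B -> R(1)) (x) C is equivalent to its
   subcomplex C(1)[-1]. *)
Lemma cF_absorb n (a b : 'I_n) (ab : a != b) (C : cpx n) :
  contr (cB ab C) -> heq (cF ab C) (csh 1 (-1) C).
Proof.
move=> [h hH hE]; have hD := chomD hH; have [mD ml mr mp] := b_mu_hom ab C.
have hE' x : dif (h x) + h (dif x) = x by rewrite -dgN1 -hE.
pose m (x : cB ab C) : csh 1 (-1) C := b_mu x.
have dm x : dif (m x) = - m (dif x).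
  rewrite /dif /= /sh_dif /m /b_mu /= mulrN1z difD.
  by rewrite (ghom_l (dif_hom C)).
(* The second coordinate alone is not a chain map, since d adds mu x to it. As h contracts the B
   part, subtracting mu h x restores compatibility with d. *)
pose p (x : cF ab C) : csh 1 (-1) C := x.2 - m (h x.1).
pose j (x : csh 1 (-1) C) : cF ab C := (0, x).
have [[_ hl hr hp] hh] := hH.
have pC : is_chmap p.
  split; [split=> [[x y] [x' y']|r [x y]|r [x y]|d [x y]]|move=> k [x y]|move=> [x y]];
    rewrite /p /=.
  - rewrite hD [m _]mD; have E (u v w z : C) : u + v - (w + z) = (u - w) + (v - z) by zmod.
    exact: E.
  - by rewrite hl [m _]ml (lactBr (M := csh 1 (-1) C)).
  - by rewrite hr [m _]mr (ractBr (M := csh 1 (-1) C)).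
  - rewrite [h _]hp [m _]mp; exact: esym (prtB (M := csh 1 (-1) C) d y (m (h x))).
  - rewrite [h _]hh; apply: etrans _ (esym (addmapB (@hprD _ (csh 1 (-1) C) k) y _)).
    congr (_ - _); by rewrite /m /b_mu /= /sh_hpr hprD (ghom_l (hpr_hom C _)).
  - apply: etrans _ (esym (addmapB (@difD _ (csh 1 (-1) C)) y _)).
    rewrite dm opprK -[LHS]/(p (dif ((x, y) : cF ab C))).
    have -> : p (dif ((x, y) : cF ab C)) = (m x : C) - @dif _ C y - (m (h (@dif _ (cB ab C) x))
      : C) by [].
    have -> : m x = m (dif (h x)) + m (h (@dif _ (cB ab C) x)) by rewrite -{1}(hE' x) [m _]mD.
    have -> : @dif _ (csh 1 (-1) C) y = - @dif _ C y by rewrite /= /sh_dif mulrN1z.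
    have E (u v w : C) : u + v - w - v = - w + u by zmod.
    exact: E.
have jC : is_chmap j.
  split; [split=> [x y|r x|r x|d x]|move=> k x|move=> x]; rewrite /j /=.
  - by rewrite [RHS]pair_add addr0.
  - exact: (congr1 (fun z : gB ab C => (z, lact r x)) (esym (lact0r (gB ab C) r))).
  - exact: (congr1 (fun z : gB ab C => (z, ract r x)) (esym (ract0r (gB ab C) r))).
  - exact: (congr1 (fun z : gB ab C => (z, _)) (esym (addmap0 (gradD (prtP (gB ab C)) d)))).
  - exact: (congr1 (fun z : gB ab C => (z, _)) (esym (addmap0 (@hprD _ (cB ab C) k)))).
  - have -> : sh_dif (-1) x = (b_mu (0 : gB ab C) : C) - @dif _ C x.
      by rewrite (addmap0 mD) sub0r /sh_dif mulrN1z.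
    exact: (congr1 (fun z : gB ab C => (z, _)) (esym (addmap0 (@difD _ (cB ab C))))).
exists p, j; split=> //.
  (* On the B part the difference j p - id is -1, so the homotopy there is -h. *)
  pose N (x : cB ab C) : cB ab C := - h x.
  have NH : chom (-1) N.
    have := chom_mulz (-1) hH; congr chom; apply/funext => x; exact: mulrN1z.
  have NE x : dif (N x) + N (dif x) = - x.
    by rewrite /N (addmapN (@difD _ (cB ab C))) -opprD hE'.
  apply/homotopicE; exists (fun x : cF ab C => (N x.1, 0)).
    split=> [|k [x y]].
      exact: gsum_map (chom_g NH) (ghom_zero (gshift 1 C) (gshift 1 C)).
    rewrite [N _](chom_hpr NH); congr (_, _).
    exact: esym (addmap0 (@hprD _ C _)).
  move=> [x y]; rewrite dgN1.
  have -> : (j \o p) (x, y) = (0, (y : C) - m (h x)) :> cF ab C by [].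
  have -> : dif ((N x, 0) : cF ab C) = (dif (N x), b_mu (N x : gB ab C) - @dif _ C 0) by [].
  have -> : ((0, (y : C) - m (h x)) : cF ab C) - (x, y) =
      (- x, ((y : C) - m (h x)) - y).
    by congr (_, _); exact: sub0r.
  rewrite [RHS]pair_add; congr (_, _); first exact: esym (NE x).
  rewrite (addmap0 (@difD _ C)) subr0 /N (addmapN mD) addr0.
  have E (u v : C) : u - v - u = - v by zmod.
  exact: E.
have -> : p \o j = id.
  apply/funext => x; rewrite /p /j /= (addmap0 hD) [m _](addmap0 mD).
  exact: subr0.
exact: homotopic_refl.
Qed.

(** * External products with the models *)

Section CsqcupLift.
Variables (k l : nat) (C : cpx k) (D : cpx l) (V : zmodType).
Variable phi : C -> D -> V.
Hypotheses (phiDl : forall y, addmap (phi^~ y)) (phiDr : forall x, addmap (phi x)).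

Definition cs_lift : csqcup C D -> V :=
  @tlift _ _ _ (@zl k C) (@zr l D) V phi.

Lemma cs_lift_bal : balanced (@zl k C) (@zr l D) phi.
Proof. by split=> // -[]. Qed.

Lemma cs_liftE x y : cs_lift (csm x y) = phi x y.
Proof. exact: (tliftE cs_lift_bal). Qed.

Lemma cs_liftD : addmap cs_lift.
Proof. exact: tliftD cs_lift_bal. Qed.
End CsqcupLift.

Lemma cs_hom_ext k l (C : cpx k) (D : cpx l) (p : int -> C -> C)
  (q : int -> D -> D) (V : zmodType) (f g : csqcup C D -> V) :
  is_grading p -> is_grading q -> addmap f -> addmap g ->
  (forall i j x y, f (csm (p i x) (q j y)) = g (csm (p i x) (q j y))) ->
  forall x, f x = g x.
Proof. exact: (pt_hom_ext (B := csqcup_bifun k l)). Qed.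

Lemma csm0l k l (C : cpx k) (D : cpx l) (y : D) : csm (0 : C) y = 0.
Proof. exact: (addmap0 (@csmDl _ _ C _ y)). Qed.

Lemma csm0r k l (C : cpx k) (D : cpx l) (x : C) : csm x (0 : D) = 0.
Proof. exact: (addmap0 (@csmDr _ _ _ D x)). Qed.

Lemma csmNl k l (C : cpx k) (D : cpx l) (x : C) (y : D) : csm (- x) y = - csm x y.
Proof. exact: (addmapN (@csmDl _ _ C _ y)). Qed.

Lemma csmNr k l (C : cpx k) (D : cpx l) (x : C) (y : D) : csm x (- y) = - csm x y.
Proof. exact: (addmapN (@csmDr _ _ _ D x)). Qed.

Lemma kz_cB n (a b : 'I_n) (ab : a != b) (C : cpx n) s (x : cB ab C) :
  kz s x = (kz s x.1, kz s x.2).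
Proof.
have P := pair_grP (hprP C) (hprP C).
move: x; apply: (gext (hprP (cB ab C))) => [x y|x y|j [x y]].
- exact: kzD.
- by rewrite [LHS]/= !kzD.
rewrite kz_hpr /= !kz_hpr; set c := sg _.
have E (u v : C) : ((u, v) : cB ab C) *~ c = (u *~ c, v *~ c).
  rewrite [LHS]surjective_pairing; congr (_, _).
    by apply: (addmapMz (f := fun z : cB ab C => z.1 : C)).
  by apply: (addmapMz (f := fun z : cB ab C => z.2 : C)).
exact: E.
Qed.

Section Lshift.
Variables (k l : nat) (a b : 'I_k) (ab : a != b).

Lemma lshift_neq : lshift l a != lshift l b.
Proof. by rewrite (inj_eq (@lshift_inj _ _)). Qed.

Notation ab' := lshift_neq.
Variables (C : cpx k) (D : cpx l).

Lemma lrshift_neq (u : 'I_k) (v : 'I_l) : rshift k v != lshift l u.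
Proof. by rewrite eq_rlshift. Qed.

(** In coordinates both sides are two copies of C |_| D, with the same matrices for the variables of
    the left factor and diagonal action of the others. This gives (B_i C) |_| D = B_i (C |_| D). *)
Lemma csqcup_cBl : ciso (csqcup (cB ab C) D) (cB ab' (csqcup C D)).
Proof.
pose CD := csqcup C D.
pose phi (x : cB ab C) (y : D) : cB ab' CD := (csm (x.1 : C) y, csm (x.2 : C) y).
have ph1 : forall y, addmap (phi^~ y).
  by move=> y u v; rewrite /phi [RHS]pair_add -!csmDl.
have ph2 : forall x, addmap (phi x).
  by move=> x u v; rewrite /phi [RHS]pair_add -!csmDr.
pose f : csqcup (cB ab C) D -> cB ab' CD := cs_lift phi.
have fE x y : f (csm x y) = (csm (x.1 : C) y, csm (x.2 : C) y) by exact: cs_liftE.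
have fD : addmap f by exact: cs_liftD.
pose g1 : CD -> csqcup (cB ab C) D := cs_lift (fun x y => csm ((x, 0) : cB ab C) y).
pose g2 : CD -> csqcup (cB ab C) D := cs_lift (fun x y => csm ((0, x) : cB ab C) y).
have h1 y : addmap (fun x : C => csm ((x, 0) : cB ab C) y).
  by move=> u v; rewrite -csmDl; congr (csm _ y); rewrite [RHS]pair_add addr0.
have h2 y : addmap (fun x : C => csm ((0, x) : cB ab C) y).
  by move=> u v; rewrite -csmDl; congr (csm _ y); rewrite [RHS]pair_add addr0.
have g1E x y : g1 (csm x y) = csm ((x, 0) : cB ab C) y.
  by apply: cs_liftE => // ?; exact: csmDr.
have g2E x y : g2 (csm x y) = csm ((0, x) : cB ab C) y.
  by apply: cs_liftE => // ?; exact: csmDr.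
have g1D : addmap g1 by apply: cs_liftD => // ?; exact: csmDr.
have g2D : addmap g2 by apply: cs_liftD => // ?; exact: csmDr.
exists f, (fun x => g1 x.1 + g2 x.2); split.
- have [fB1 fB2 fB3] : blin f.
    apply: cs_blin => // [u x y|u x y|u x y|u x y]; rewrite !fE.
    + have -> : lact 'X_u x = b_lact a b 'X_u (x : gB ab C) by [].
      have -> : lact 'X_(lshift l u) ((csm (x.1 : C) y, csm (x.2 : C) y) : cB ab' CD) =
        b_lact (lshift l a) (lshift l b) 'X_(lshift l u)
          ((csm (x.1 : C) y, csm (x.2 : C) y) : gB ab' CD) by [].
      have [->|ua] := eqVneq u a.
        rewrite (b_lact_a ab) (b_lact_a ab'); cbn [fst snd].
        by rewrite csmNl !csmDl !cs_lactl.
      have [->|ub] := eqVneq u b.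
        rewrite (b_lact_b ab) (b_lact_b ab'); cbn [fst snd].
        by rewrite csmNl !csmDl !cs_lactl.
      rewrite (b_lact_c ab _ ua ub) (b_lact_c ab') ?(inj_eq (@lshift_inj _ _)) //.
      by cbn [fst snd]; rewrite !cs_lactl.
    + have -> : lact 'X_(rshift k u) ((csm (x.1 : C) y, csm (x.2 : C) y) : cB ab' CD) =
        b_lact (lshift l a) (lshift l b) 'X_(rshift k u)
          ((csm (x.1 : C) y, csm (x.2 : C) y) : gB ab' CD) by [].
      rewrite (b_lact_c ab') ?lrshift_neq //.
      by cbn [fst snd]; rewrite !cs_lactr.
    + by congr (_, _); rewrite cs_ractl.
    + by congr (_, _); rewrite cs_ractr.
  split; [split=> // d|move=> d|].
  + apply: (cs_hom_ext (prtP (cB ab C)) (prtP D)) => [x y|x y|i j x y].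
    * by rewrite (gradD (prtP (csqcup (cB ab C) D))) fD.
    * by rewrite fD (gradD (prtP (cB ab' CD))).
    rewrite cs_prtE fE (if_morph _ _ fD) fE.
    have -> : prt d ((csm (prt i x).1 (prt j y), csm (prt i x).2 (prt j y)) : cB ab' CD)
       = (prt (d + 1) (csm (prt (i + 1) x.1) (prt j y)),
          prt (d - 1) (csm (prt (i - 1) x.2) (prt j y))) by [].
    rewrite !cs_prtE.
    have -> : (d + 1 == i + 1 + j) = (d == i + j) by lia.
    have -> : (d - 1 == i - 1 + j) = (d == i + j) by lia.
    by case: eqP.
  + apply: (cs_hom_ext (hprP (cB ab C)) (hprP D)) => [x y|x y|i j x y].
    * by rewrite hprD fD.
    * by rewrite fD hprD.
    rewrite cs_hprE fE (if_morph _ _ fD) fE.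
    have -> : hpr d ((csm (hpr i x).1 (hpr j y), csm (hpr i x).2 (hpr j y)) : cB ab' CD)
       = (hpr d (csm (hpr i x.1) (hpr j y)), hpr d (csm (hpr i x.2) (hpr j y))) by [].
    by rewrite !cs_hprE; case: eqP.
  + apply: cs_ext => [x y|x y|x y].
    * by rewrite difD fD.
    * by rewrite fD difD.
    rewrite cs_difE fD !fE kz_cB.
    have -> : dif ((csm x.1 y, csm x.2 y) : cB ab' CD) =
      (dif (csm x.1 y), dif (csm x.2 y)) by [].
    by rewrite !cs_difE.
- apply: cs_ext => [x y|//|[x x'] y].
    by rewrite fD g1D g2D; exact: addrACA.
  rewrite fE g1E g2E -csmDl; congr (csm _ y).
  by rewrite [LHS]pair_add addr0 add0r.
- have F1 z : f (g1 z) = (z, 0).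
    move: z; apply: cs_ext => [u v|u v|u v]; first by rewrite g1D fD.
      by rewrite [RHS]pair_add addr0.
    by rewrite g1E fE csm0l.
  have F2 z : f (g2 z) = (0, z).
    move: z; apply: cs_ext => [u v|u v|u v]; first by rewrite g2D fD.
      by rewrite [RHS]pair_add addr0.
    by rewrite g2E fE csm0l.
  by move=> [z z']; rewrite fD F1 F2 [LHS]pair_add addr0 add0r.
Qed.
End Lshift.

Section Rshift.
Variables (k l : nat) (a b : 'I_l) (ab : a != b).

Lemma rshift_neq : rshift k a != rshift k b.
Proof. by rewrite (inj_eq (@rshift_inj _ _)). Qed.

Notation ab' := rshift_neq.
Variables (M : gbimod k) (D : cpx l).

(** The counterpart for a crossing in the right factor. The left factor sits in homological degree
    0, so no Koszul sign separates it from the three coordinates of [cF]. *)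
Lemma csqcup_cFr : ciso (csqcup (conc M) (cF ab D)) (cF ab' (csqcup (conc M) D)).
Proof.
pose CD := csqcup (conc M) D.
pose phi (x : conc M) (y : cF ab D) : cF ab' CD :=
  ((csm x (y.1.1 : D), csm x (y.1.2 : D)), csm x (y.2 : D)).
have ph1 : forall y, addmap (phi^~ y).
  by move=> y u v; rewrite /phi [RHS]pair_add !csmDl; congr (_, _); rewrite [RHS]pair_add.
have ph2 : forall x, addmap (phi x).
  move=> x u v; rewrite /phi [RHS]pair_add -(csmDr x u.2 v.2); congr (_, _).
  by rewrite [RHS]pair_add -(csmDr x u.1.1 v.1.1) -(csmDr x u.1.2 v.1.2).
pose f : csqcup (conc M) (cF ab D) -> cF ab' CD := cs_lift phi.
have fE x y : f (csm x y) = phi x y by exact: cs_liftE.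
have fD : addmap f by exact: cs_liftD.
pose j1 (y : D) : cF ab D := ((y, 0), 0).
pose j2 (y : D) : cF ab D := ((0, y), 0).
pose j3 (y : D) : cF ab D := (0, y).
have j1D : addmap j1.
  by move=> u v; rewrite /j1 [RHS]pair_add addr0 [X in _ = (X, _)]pair_add addr0.
have j2D : addmap j2.
  by move=> u v; rewrite /j2 [RHS]pair_add addr0 [X in _ = (X, _)]pair_add addr0.
have j3D : addmap j3 by move=> u v; rewrite /j3 [RHS]pair_add addr0.
have jj (j : D -> cF ab D) : addmap j -> forall x, addmap (fun y : D => csm (x : conc M) (j y)).
  by move=> jD x u v; rewrite jD csmDr.
pose g j : CD -> csqcup (conc M) (cF ab D) := cs_lift (fun x y => csm x (j y)).
have gE j x y : addmap j -> g j (csm x y) = csm x (j y).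
  by move=> jD; apply: cs_liftE => [?|]; [exact: csmDl|exact: jj].
have gD j : addmap j -> addmap (g j).
  by move=> jD; apply: cs_liftD => [?|]; [exact: csmDl|exact: jj].
exists f, (fun x => g j1 x.1.1 + g j2 x.1.2 + g j3 x.2); split.
- have [fB1 fB2 fB3] : blin f.
    apply: cs_blin => // [u x y|u x y|u x y|u x y]; rewrite !fE.
    + have -> : lact 'X_(lshift l u) (phi x y) = ((b_lact (rshift k a) (rshift k b) 'X_(lshift
        l u) (phi x y).1), lact 'X_(lshift l u) (csm x (y.2 : D))) by [].
      rewrite (b_lact_c ab') ?eq_lrshift //; cbn [fst snd phi].
      by rewrite !cs_lactl.
    + have -> : lact 'X_(rshift k u) (phi x y) = ((b_lact (rshift k a) (rshift k b) 'X_(rshift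
        k u) (phi x y).1), lact 'X_(rshift k u) (csm x (y.2 : D))) by [].
      have -> : phi x (lact 'X_u y) = ((csm x ((b_lact a b 'X_u (y.1 : cB ab D)).1 : D),
         csm x ((b_lact a b 'X_u (y.1 : cB ab D)).2 : D)), csm x (lact 'X_u (y.2 : D))) by [].
      rewrite cs_lactr; congr (_, _).
      have [->|ua] := eqVneq u a.
        rewrite (b_lact_a ab) (b_lact_a ab'); cbn [fst snd phi].
        by rewrite csmNr !csmDr !cs_lactr.
      have [->|ub] := eqVneq u b.
        rewrite (b_lact_b ab) (b_lact_b ab'); cbn [fst snd phi].
        by rewrite csmNr !csmDr !cs_lactr.
      rewrite (b_lact_c ab _ ua ub) (b_lact_c ab') ?(inj_eq (@rshift_inj _ _)) //.
      by cbn [fst snd phi]; rewrite !cs_lactr.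
    + have -> : ract 'X_(lshift l u) (phi x y) = ((ract 'X_(lshift l u) (csm x (y.1.1 : D)),
        ract 'X_(lshift l u) (csm x (y.1.2 : D))), ract 'X_(lshift l u) (csm x (y.2 : D))) by [].
      by rewrite !cs_ractl.
    + have -> : ract 'X_(rshift k u) (phi x y) = ((ract 'X_(rshift k u) (csm x (y.1.1 : D)),
        ract 'X_(rshift k u) (csm x (y.1.2 : D))), ract 'X_(rshift k u) (csm x (y.2 : D))) by [].
      by rewrite !cs_ractr.
  split; [split=> // d|move=> d|].
  + apply: (cs_hom_ext (prtP (conc M)) (prtP (cF ab D))) => [x y|x y|i j x y].
    * by rewrite (gradD (prtP (csqcup (conc M) (cF ab D)))) fD.
    * by rewrite fD (gradD (prtP (cF ab' CD))).
    rewrite cs_prtE (if_morph _ _ fD) fE.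
    have -> : prt d (phi (prt i x) (prt j y))
       = ((prt (d + 1) (csm (prt i x) (prt (j + 1) (y.1.1 : D))),
          prt (d - 1) (csm (prt i x) (prt (j - 1) (y.1.2 : D)))),
          prt (d + 1) (csm (prt i x) (prt (j + 1) (y.2 : D)))) by [].
    rewrite !cs_prtE.
    have -> : (d + 1 == i + (j + 1)) = (d == i + j) by lia.
    have -> : (d - 1 == i + (j - 1)) = (d == i + j) by lia.
    by case: eqP.
  + apply: (cs_hom_ext (hprP (conc M)) (hprP (cF ab D))) => [x y|x y|i j x y].
    * by rewrite hprD fD.
    * by rewrite fD hprD.
    rewrite cs_hprE (if_morph _ _ fD) fE.
    have -> : hpr d (phi (hpr i x) (hpr j y))
       = ((hpr d (csm (hpr i x) (hpr j (y.1.1 : D))),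
          hpr d (csm (hpr i x) (hpr j (y.1.2 : D)))),
          hpr (d - 1) (csm (hpr i x) (hpr (j - 1) (y.2 : D)))) by [].
    rewrite !cs_hprE.
    have -> : (d - 1 == i + (j - 1)) = (d == i + j) by lia.
    by case: eqP.
  + apply: cs_ext => [x y|x y|x y].
    * by rewrite difD fD.
    * by rewrite fD difD.
    rewrite cs_difE kz_conc csm0l add0r !fE.
    have -> : dif (phi x y) = ((dif (csm x (y.1.1 : D)), dif (csm x (y.1.2 : D))),
       csm x (y.1.1 : D) + lact 'X_(rshift k a) (csm x (y.1.2 : D)) - dif (csm x (y.2 : D))) by [].
    have -> : phi x (dif y) = ((csm x (dif (y.1.1 : D)), csm x (dif (y.1.2 : D))),
       csm x ((y.1.1 : D) + lact 'X_a (y.1.2 : D) - dif (y.2 : D))) by [].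
    by rewrite !cs_difE kz_conc !csm0l !add0r cs_lactr !csmDr csmNr.
- apply: cs_ext => [x y|//|x [[y1 y2] y3]].
    have E (u v w u' v' w' : csqcup (conc M) (cF ab D)) :
      u + u' + (v + v') + (w + w') = u + v + w + (u' + v' + w') by zmod.
    by rewrite fD (gD j1) // (gD j2) // (gD j3) //; exact: E.
  rewrite fE /phi (gE j1) // (gE j2) // (gE j3) // -!csmDr; congr (csm x _).
  rewrite -[LHS]/(((y1 + 0 + 0, 0 + y2 + 0), 0 + 0 + y3) : cF ab D).
  by rewrite !addr0 !add0r.
- have F1 z : f (g j1 z) = ((z, 0), 0).
    move: z; apply: cs_ext => [u v|u v|u v]; first by rewrite (gD j1) // fD.
      by rewrite [RHS]pair_add addr0; congr (_, _); rewrite [RHS]pair_add addr0.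
    by rewrite (gE j1) // fE /phi; cbn [j1 fst snd]; rewrite !csm0r.
  have F2 z : f (g j2 z) = ((0, z), 0).
    move: z; apply: cs_ext => [u v|u v|u v]; first by rewrite (gD j2) // fD.
      by rewrite [RHS]pair_add addr0; congr (_, _); rewrite [RHS]pair_add addr0.
    by rewrite (gE j2) // fE /phi; cbn [j2 fst snd]; rewrite !csm0r.
  have F3 z : f (g j3 z) = (0, z).
    move: z; apply: cs_ext => [u v|u v|u v]; first by rewrite (gD j3) // fD.
      by rewrite [RHS]pair_add addr0.
    by rewrite (gE j3) // fE /phi; cbn [j3 fst snd]; rewrite !csm0r.
  move=> [[z1 z2] z3]; rewrite !fD F1 F2 F3; cbn [fst snd].
  rewrite -[LHS]/(((z1 + 0 + 0, 0 + z2 + 0), 0 + 0 + z3) : cF ab' CD).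
  by rewrite !addr0 !add0r.
Qed.
End Rshift.

(** * The braid relation *)

(* The operations of cF on (C * C) * C, written without reference to the
   algebraic structures of the tuples so that they compute. *)
Section TripleOps.
Variable V : Type.
Variables (av : V -> V -> V) (nv : V -> V) (va vb : V -> V).
Implicit Types x y : V * V * V.

Definition t_add x y : V * V * V := (av x.1.1 y.1.1, av x.1.2 y.1.2, av x.2 y.2).
Definition t_opp x : V * V * V := (nv x.1.1, nv x.1.2, nv x.2).
Definition t_a x : V * V * V :=
  (nv (va (vb x.1.2)), av (av x.1.1 (va x.1.2)) (vb x.1.2), va x.2).
Definition t_b x : V * V * V :=
  (av (av (va x.1.1) (vb x.1.1)) (va (vb x.1.2)), nv x.1.1, vb x.2).
Definition t_c x : V * V * V := (va x.1.1, va x.1.2, va x.2).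
Definition t_d (d : V -> V) x : V * V * V :=
  (d x.1.1, d x.1.2, av (av x.1.1 (va x.1.2)) (nv (d x.2))).
End TripleOps.

Section BraidAlgebra.
Variable R : comRingType.
Notation T1 := (R * R * R)%type.
Notation T2 := (T1 * T1 * T1)%type.
Notation T3 := (T2 * T2 * T2)%type.

Definition add0 : R -> R -> R := fun x y => x + y.
Definition opp0 : R -> R := fun x => - x.
Definition add1 : T1 -> T1 -> T1 := t_add add0.
Definition opp1 : T1 -> T1 := t_opp opp0.
Definition add2 : T2 -> T2 -> T2 := t_add add1.
Definition opp2 : T2 -> T2 := t_opp opp1.
Definition add3 : T3 -> T3 -> T3 := t_add add2.
Definition opp3 : T3 -> T3 := t_opp opp2.

Section Ops.
Variables a b c : R.
(** The digit counts the layers of F_s F_t F_s, innermost first. The outer layers use the pair (a,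
    b), the middle one the pair (c, b), and the variable missing from a pair acts coordinatewise on
    that layer. *)
Definition a1 : T1 -> T1 := t_a add0 opp0 (fun x => a * x) (fun x => b * x).
Definition b1 : T1 -> T1 := t_b add0 opp0 (fun x => a * x) (fun x => b * x).
Definition c1 : T1 -> T1 := t_c (fun x => c * x).
Definition d1 : T1 -> T1 := t_d add0 opp0 (fun x => a * x) (fun _ => 0).
Definition a2 : T2 -> T2 := t_c a1.
Definition b2 : T2 -> T2 := t_b add1 opp1 c1 b1.
Definition c2 : T2 -> T2 := t_a add1 opp1 c1 b1.
Definition d2 : T2 -> T2 := t_d add1 opp1 c1 d1.
Definition a3 : T3 -> T3 := t_a add2 opp2 a2 b2.
Definition b3 : T3 -> T3 := t_b add2 opp2 a2 b2.
Definition c3 : T3 -> T3 := t_c c2.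
Definition d3 : T3 -> T3 := t_d add2 opp2 a2 d2.
End Ops.

(* Write s = (a b), t = (c b) and z = 1 (x) x_a (x) 1 (x) 1.  The basis element
   x_a^i (x) x_c^j (x) x_a^k of B_s B_t B_s is x_a^i x_c^j z^k, and [braid_f] is
   the map to B_t B_s B_t with 1 |-> 1, z |-> x_a + x_b - y_c (x the left, y the
   right variables), extended to a chain map; likewise [braid_h] is determined
   by 1 (x) x_a (x) 1 |-> z - x_a - x_b + y_c on B_s B_s and by 1 |-> 1 from the
   last B_s to B_s B_s. *)
Definition braid_f (a b c : R) (x : T3) : T3 :=
  let: (((((x000, x001), x00r), ((x010, x011), x01r), ((x0r0, x0r1), x0rr)),
         (((x100, x101), x10r), ((x110, x111), x11r), ((x1r0, x1r1), x1rr))),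
        (((xr00, xr01), xr0r), ((xr10, xr11), xr1r), ((xrr0, xrr1), xrrr))) := x in
  ((((x000 + (a + b) * x001 + b * c * x011 + a * b * c * x111, a * x011,
      (a + b) * x0r1 + a * b * x1r1 + xr00),
     (x100 + (a + b) * x101, - x011, - x0r1 + xr01),
     (x00r + b * x0r1 + a * x10r + a * b * x1r1, 0, - xr0r)),
    ((- x001 + x010 - c * x011 - (a * b + a * c) * x111, a * x111, - x0r1 + xr10),
     (x011 - x101 + x110 + (a + b) * x111, - x111, - x1r1 + xr11),
     (x01r - x0r1 + a * x11r - a * x1r1, 0, - xr1r))),
   ((x00r + b * x0r1, x01r - x0r1, - x0rr - xrr0),
    (x10r + b * x1r1, x11r - x1r1, - x1rr - xrr1),
    (0, 0, xrrr))).

Definition braid_h (a b : R) (x : T3) : T3 :=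
  let: (((_, _, ((_, x0r1), _)), (_, _, ((_, x1r1), _))),
        (_, _, ((xrr0, xrr1), _))) := x in
  ((((- (a + b) * x0r1, x0r1, 0), (x0r1, 0, 0), (xrr0, 0, 0)),
    ((- (a + b) * x1r1, x1r1, 0), (x1r1, 0, 0), (xrr1, 0, 0))),
   ((0, 0, 0), (0, 0, 0), (0, 0, 0))).

Ltac braid_case :=
  move=> [[[[[[? ?] ?] [[? ?] ?]] [[? ?] ?]]
           [[[[? ?] ?] [[? ?] ?]] [[? ?] ?]]]
          [[[[? ?] ?] [[? ?] ?]] [[? ?] ?]]].
Ltac braid_eval :=
  cbv [braid_f braid_h a3 b3 c3 d3 a2 b2 c2 d2 a1 b1 c1 d1 add3 opp3 add2 opp2
    add1 opp1 t_a t_b t_c t_d t_add t_opp add0 opp0 fst snd];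
  do !congr (_, _).
Ltac braid_ring := braid_case; braid_eval; ring.

Variables a b c : R.

Lemma braid_f_a x : braid_f a b c (a3 a b c x) = c3 c b a (braid_f a b c x).
Proof. move: x; braid_ring. Qed.
Lemma braid_f_b x : braid_f a b c (b3 a b c x) = b3 c b a (braid_f a b c x).
Proof. move: x; braid_ring. Qed.
Lemma braid_f_c x : braid_f a b c (c3 a b c x) = a3 c b a (braid_f a b c x).
Proof. move: x; braid_ring. Qed.
Lemma braid_f_d x : braid_f a b c (d3 a b c x) = d3 c b a (braid_f a b c x).
Proof. move: x; braid_ring. Qed.
Lemma braid_h_a x : braid_h a b (a3 a b c x) = a3 a b c (braid_h a b x).
Proof. move: x; braid_ring. Qed.
Lemma braid_h_b x : braid_h a b (b3 a b c x) = b3 a b c (braid_h a b x).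
Proof. move: x; braid_ring. Qed.
Lemma braid_h_c x : braid_h a b (c3 a b c x) = c3 a b c (braid_h a b x).
Proof. move: x; braid_ring. Qed.
(** Exchanging a and c turns [braid_f] into the map in the other direction, so this one identity
    provides the homotopies for both composites. *)
Lemma braid_fh x : add3 (add3 (d3 a b c (braid_h a b x)) (braid_h a b (d3 a b c x)))
  (braid_f c b a (braid_f a b c x)) = x.
Proof. move: x; braid_ring. Qed.

(** Describes the right action, and the left action of the variables of the other strands. *)
Definition s3 (u : R) : T3 -> T3 := t_c (t_c (t_c (fun x => u * x))).

Lemma braid_f_s u x : braid_f a b c (s3 u x) = s3 u (braid_f a b c x).
Proof. by move: x; rewrite /s3; braid_ring. Qed.
Lemma braid_h_s u x : braid_h a b (s3 u x) = s3 u (braid_h a b x).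
Proof. by move: x; rewrite /s3; braid_ring. Qed.
Lemma braid_f_D x y : braid_f a b c (add3 x y) = add3 (braid_f a b c x) (braid_f a b c y).
Proof. by move: y; move: x; braid_case; braid_case; braid_eval; ring. Qed.

Lemma braid_h_D x y : braid_h a b (add3 x y) = add3 (braid_h a b x) (braid_h a b y).
Proof. by move: y; move: x; braid_case; braid_case; braid_eval; ring. Qed.

Section Gradings.
Variable P : int -> R -> R.
Hypothesis PD : forall e, addmap (P e).

Definition gr1 d (x : T1) : T1 := (P (d + 1) x.1.1, P (d - 1) x.1.2, P (d + 1) x.2).
Definition gr2 d (x : T2) : T2 := (gr1 (d + 1) x.1.1, gr1 (d - 1) x.1.2, gr1 (d + 1) x.2).
Definition gr3 d (x : T3) : T3 := (gr2 (d + 1) x.1.1, gr2 (d - 1) x.1.2, gr2 (d + 1) x.2).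

Definition hgr1 d (x : T1) : T1 := (P d x.1.1, P d x.1.2, P (d - 1) x.2).
Definition hgr2 d (x : T2) : T2 := (hgr1 d x.1.1, hgr1 d x.1.2, hgr1 (d - 1) x.2).
Definition hgr3 d (x : T3) : T3 := (hgr2 d x.1.1, hgr2 d x.1.2, hgr2 (d - 1) x.2).

Let P0 e : P e 0 = 0. Proof. exact: addmap0 (PD e). Qed.
Let PN e x : P e (- x) = - P e x. Proof. exact: addmapN (PD e) x. Qed.

Lemma braid_f_gr d x : (forall u e x, u \in [:: a; b; c] -> P (e + 2) (u * x) = u * P e x) ->
  braid_f a b c (gr3 d x) = gr3 d (braid_f a b c x).
Proof.
move=> PM.
have E e e' u y : u \in [:: a; b; c] -> e' = e - 2 -> P e (u * y) = u * P e' y.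
  by move=> uabc ->; rewrite -PM // subrK.
have Ea := E _ _ a _ (mem_head _ _).
have Eb : forall e e' y, e' = e - 2 -> P e (b * y) = b * P e' y.
  by move=> *; apply: E => //; rewrite !inE eqxx orbT.
have Ec : forall e e' y, e' = e - 2 -> P e (c * y) = c * P e' y.
  by move=> *; apply: E => //; rewrite !inE eqxx !orbT.
(* Each layer shifts the degree by 1 or -1, so only d + 3, d + 1, d - 1 and d - 3 occur among the 27
   entries. Naming these four projections replaces degree arithmetic by rewriting. *)
pose Q3 := P (d + 3); pose Q1 := P (d + 1); pose M1 := P (d - 1); pose M3 := P (d - 3).
have e3 : P (d + 1 + 1 + 1) = Q3 by congr P; lia.
have e1 : P (d + 1 + 1 - 1) = Q1 by congr P; lia.
have e2 : P (d + 1 - 1 + 1) = Q1 by congr P; lia.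
have e4 : P (d - 1 + 1 + 1) = Q1 by congr P; lia.
have e5 : P (d + 1 - 1 - 1) = M1 by congr P; lia.
have e6 : P (d - 1 + 1 - 1) = M1 by congr P; lia.
have e7 : P (d - 1 - 1 + 1) = M1 by congr P; lia.
have e8 : P (d - 1 - 1 - 1) = M3 by congr P; lia.
have a3' y : Q3 (a * y) = a * Q1 y by apply: Ea; lia.
have a1' y : Q1 (a * y) = a * M1 y by apply: Ea; lia.
have am' y : M1 (a * y) = a * M3 y by apply: Ea; lia.
have b3' y : Q3 (b * y) = b * Q1 y by apply: Eb; lia.
have b1' y : Q1 (b * y) = b * M1 y by apply: Eb; lia.
have bm' y : M1 (b * y) = b * M3 y by apply: Eb; lia.
have c3' y : Q3 (c * y) = c * Q1 y by apply: Ec; lia.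
have c1' y : Q1 (c * y) = c * M1 y by apply: Ec; lia.
have cm' y : M1 (c * y) = c * M3 y by apply: Ec; lia.
have D3 : addmap Q3 by exact: PD.
have D1 : addmap Q1 by exact: PD.
have Dm : addmap M1 by exact: PD.
have N3 y : Q3 (- y) = - Q3 y by exact: PN.
have N1 y : Q1 (- y) = - Q1 y by exact: PN.
have Nm y : M1 (- y) = - M1 y by exact: PN.
have Nn y : M3 (- y) = - M3 y by exact: PN.
have Z3 : Q3 0 = 0 by exact: P0.
have Z1 : Q1 0 = 0 by exact: P0.
have Zm : M1 0 = 0 by exact: P0.
have Zn : M3 0 = 0 by exact: P0.
move: x; braid_case.
cbv [braid_f gr3 gr2 gr1 fst snd]; rewrite !(e1, e2, e3, e4, e5, e6, e7, e8).
do !congr (_, _); rewrite ?(mulrDl, mulNr) -?mulrA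
  ?(D3, D1, Dm, N3, N1, Nm, Nn, Z3, Z1, Zm, Zn, a3', a1', am', b3', b1', bm', c3', c1', cm'); ring.
Qed.

Lemma braid_h_gr d x : (forall u e x, u \in [:: a; b; c] -> P (e + 2) (u * x) = u * P e x) ->
  braid_h a b (gr3 d x) = gr3 d (braid_h a b x).
Proof.
move=> PM.
have E e e' u y : u \in [:: a; b; c] -> e' = e - 2 -> P e (u * y) = u * P e' y.
  by move=> uabc ->; rewrite -PM // subrK.
have Ea := E _ _ a _ (mem_head _ _).
have Eb : forall e e' y, e' = e - 2 -> P e (b * y) = b * P e' y.
  by move=> *; apply: E => //; rewrite !inE eqxx orbT.
move: x => [[[[[[? ?] ?] [[? ?] ?]] [[? x0r1] ?]]
           [[[[? ?] ?] [[? ?] ?]] [[? x1r1] ?]]]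
          [[[[? ?] ?] [[? ?] ?]] [[xrr0 xrr1] ?]]].
have ra0 y : P (d + 1 + 1 + 1) (a * y) = a * P (d + 1 + 1 - 1) y by apply: Ea; lia.
have rb0 y : P (d + 1 + 1 + 1) (b * y) = b * P (d + 1 + 1 - 1) y by apply: Eb; lia.
have ra1 y : P (d - 1 + 1 + 1) (a * y) = a * P (d - 1 + 1 - 1) y by apply: Ea; lia.
have rb1 y : P (d - 1 + 1 + 1) (b * y) = b * P (d - 1 + 1 - 1) y by apply: Eb; lia.
cbv [braid_h gr3 gr2 gr1 fst snd]; rewrite !P0.
do !congr (_, _); rewrite ?mulNr ?mulrDl ?PN ?PD ?opprD.
all: by rewrite ?(ra0, rb0, ra1, rb1) //; congr P; lia.
Qed.

Lemma braid_f_hgr d x : (forall u e x, P e (u * x) = u * P e x) ->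
  braid_f a b c (hgr3 d x) = hgr3 d (braid_f a b c x).
Proof.
move=> PM.
move: x; braid_case.
cbv [braid_f hgr3 hgr2 hgr1 fst snd].
by do !congr (_, _); rewrite ?PD ?PN ?PM ?PD ?PN ?PM ?P0; ring.
Qed.

Lemma braid_h_hgr d x : (forall u e x, P e (u * x) = u * P e x) ->
  braid_h a b (hgr3 d x) = hgr3 (d - 1) (braid_h a b x).
Proof.
move=> PM.
move: x; braid_case.
cbv [braid_h hgr3 hgr2 hgr1 fst snd].
by do !congr (_, _); rewrite ?PM ?P0.
Qed.
End Gradings.
End BraidAlgebra.

(** * The actions and differentials of F_s F_t F_s in coordinates *)

Section CFLact.
Variables (n : nat) (a b : 'I_n) (ab : a != b) (C : cpx n).
Let add (x y : C) := x + y.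
Let opp (x : C) := - x.

Lemma cF_lact_a : (lact 'X_a : cF ab C -> cF ab C) =
  t_a add opp (lact 'X_a) (lact 'X_b).
Proof.
apply/funext => x; transitivity ((b_lact a b 'X_a x.1, lact 'X_a (x.2 : C)) : cF ab C) => //.
by rewrite b_lact_a.
Qed.

Lemma cF_lact_b : (lact 'X_b : cF ab C -> cF ab C) =
  t_b add opp (lact 'X_a) (lact 'X_b).
Proof.
apply/funext => x; transitivity ((b_lact a b 'X_b x.1, lact 'X_b (x.2 : C)) : cF ab C) => //.
by rewrite b_lact_b.
Qed.

Lemma cF_lact_c c : c != a -> c != b ->
  (lact 'X_c : cF ab C -> cF ab C) = t_c (lact 'X_c).
Proof.
move=> ca cb; apply/funext => x.
transitivity ((b_lact a b 'X_c x.1, lact 'X_c (x.2 : C)) : cF ab C) => //.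
by rewrite b_lact_c.
Qed.
End CFLact.

Section BraidComplex.
Variables (n : nat) (a b c : 'I_n).
Hypotheses (ab : a != b) (cb : c != b) (ac : a != c).
Notation A := ('X_a : Rn n).
Notation B := ('X_b : Rn n).
Notation C := ('X_c : Rn n).

Definition br1 := cF ab (cunit n).
Definition br2 := cF cb br1.
Definition br3 := cF ab br2.

Let bc : b != c. Proof. by rewrite eq_sym. Qed.
Let ca : c != a. Proof. by rewrite eq_sym. Qed.

Let l1a : (lact A : br1 -> br1) = a1 A B.
Proof. exact: (cF_lact_a ab (cunit n)). Qed.
Let l1b : (lact B : br1 -> br1) = b1 A B.
Proof. exact: (cF_lact_b ab (cunit n)). Qed.
Let l1c : (lact C : br1 -> br1) = c1 C.
Proof. exact: (cF_lact_c ab (cunit n) ca cb). Qed.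
Let l2a : (lact A : br2 -> br2) = a2 A B.
Proof. exact: (etrans (cF_lact_c cb br1 ac ab) (congr1 (@t_c _) l1a)). Qed.
Let l2b : (lact B : br2 -> br2) = b2 A B C.
Proof. exact: (etrans (cF_lact_b cb br1) (f_equal2 (t_b _ _) l1c l1b)). Qed.
Let l2c : (lact C : br2 -> br2) = c2 A B C.
Proof. exact: (etrans (cF_lact_a cb br1) (f_equal2 (t_a _ _) l1c l1b)). Qed.

Lemma br_a : (lact A : br3 -> br3) = a3 A B C.
Proof. exact: (etrans (cF_lact_a ab br2) (f_equal2 (t_a _ _) l2a l2b)). Qed.
Lemma br_b : (lact B : br3 -> br3) = b3 A B C.
Proof. exact: (etrans (cF_lact_b ab br2) (f_equal2 (t_b _ _) l2a l2b)). Qed.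
Lemma br_c : (lact C : br3 -> br3) = c3 A B C.
Proof. exact: (etrans (cF_lact_c ab br2 ca cb) (congr1 (@t_c _) l2c)). Qed.

Lemma br_u u : u != a -> u != b -> u != c ->
  (lact 'X_u : br3 -> br3) = s3 'X_u.
Proof.
move=> ua ub uc; apply: (etrans (cF_lact_c ab br2 ua ub)); congr (t_c _).
exact: (etrans (cF_lact_c cb br1 uc ub)
  (congr1 (@t_c _) (cF_lact_c ab (cunit n) ua ub))).
Qed.

Lemma br_lact u x : lact 'X_u (x : br3) =
  if u == a then a3 A B C x else if u == b then b3 A B C x
  else if u == c then c3 A B C x else s3 'X_u x.
Proof.
have [->|ua] := eqVneq u a; first exact: (congr1 (fun F => F x) br_a).
have [->|ub] := eqVneq u b; first exact: (congr1 (fun F => F x) br_b).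
have [->|uc] := eqVneq u c; first exact: (congr1 (fun F => F x) br_c).
exact: (congr1 (fun F => F x) (br_u ua ub uc)).
Qed.

Let dif1 : (@dif _ br1) = d1 A.
Proof.
apply/funext => x; rewrite -[LHS]/(cF_dif x) /cF_dif /b_mu /cB_dif.
by [].
Qed.
Let dif2 : (@dif _ br2) = d2 A C.
Proof.
apply/funext => x; transitivity ((dif x.1.1, dif x.1.2,
  (x.1.1 : br1) + lact C (x.1.2 : br1) - dif (x.2 : br1)) : br2) => //.
by rewrite dif1 l1c.
Qed.
Lemma br_dif : (@dif _ br3) = d3 A B C.
Proof.
apply/funext => x; transitivity ((dif x.1.1, dif x.1.2,
  (x.1.1 : br2) + lact A (x.1.2 : br2) - dif (x.2 : br2)) : br3) => //.
by rewrite dif2 l2a.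
Qed.
End BraidComplex.

Section BraidRelation.
Variables (n : nat) (a b c : 'I_n).
Hypotheses (ab : a != b) (cb : c != b) (ac : a != c).
Notation A := ('X_a : Rn n).
Notation B := ('X_b : Rn n).
Notation C := ('X_c : Rn n).
Notation X := (br3 ab cb).
Notation Y := (br3 cb ab).

(** The carrier of [br3] is by conversion the 27-fold product of R, so the polynomial formula
    applies to it directly. *)
Definition brf (x : X) : Y := braid_f A B C x.
Definition brh (x : X) : X := braid_h A B x.

Lemma R_prt_mul_var u e (x : Rn n) : R_prt (e + 2) ('X_u * x) = 'X_u * R_prt e x.
Proof.
have h : ('X_u : Rn n) \is 1.-homog by rewrite dhomogX; apply/eqP; exact: mdeg1.
by rewrite (R_mul_prt h).
Qed.

Let ca : c != a. Proof. by rewrite eq_sym. Qed.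
Let P0D (e : int) : addmap (fun x : Rn n => (if e == 0 then x else 0) : Rn n).
Proof. by move=> x y; case: ifP; rewrite ?addr0. Qed.
Let P0M (u : Rn n) (e : int) (x : Rn n) :
  (if e == 0 then u * x else 0) = u * (if e == 0 then x else 0).
Proof. by case: ifP; rewrite ?mulr0. Qed.
Let R_prt_abc u e (x : Rn n) : u \in [:: A; B; C] -> R_prt (e + 2) (u * x) = u * R_prt e x.
Proof. rewrite !inE => /or3P[]/eqP->; exact: R_prt_mul_var. Qed.

Lemma brfD : addmap brf. Proof. move=> x y; exact: braid_f_D. Qed.

Lemma brf_lact u x : brf (lact 'X_u x) = lact 'X_u (brf x).
Proof.
apply: (etrans (congr1 brf (@br_lact n a b c ab cb ac u x))).
apply: (etrans _ (esym (@br_lact n c b a cb ab ca u (brf x)))).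
have [->|ua] := eqVneq u a.
  rewrite (negPf ac) (negPf ab); exact: braid_f_a.
have [->|ub] := eqVneq u b.
  rewrite eq_sym (negPf cb); exact: braid_f_b.
have [_|uc] := eqVneq u c; first exact: braid_f_c.
exact: braid_f_s.
Qed.

Lemma brf_chmap : is_chmap brf.
Proof.
split; [split|move=> d x|move=> x].
- exact: brfD.
- exact: (act_ext (lactP X) (lactP Y) brfD brf_lact).
- move=> r x; exact: braid_f_s.
- move=> d x; exact: (braid_f_gr (@R_prtD n) d x R_prt_abc).
- exact: (braid_f_hgr A B C (P := fun (e : int) (x : Rn n) => if e == 0 then x else 0) P0D d x P0M).
- apply: (etrans (congr1 (fun F => brf (F x)) (@br_dif n a b c ab cb ac))).
  apply: (etrans _ (esym (congr1 (fun F => F (brf x)) (@br_dif n c b a cb ab ca)))).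
  exact: braid_f_d.
Qed.

Lemma brhD : addmap brh. Proof. move=> x y; exact: braid_h_D. Qed.

Lemma brh_lact u x : brh (lact 'X_u x) = lact 'X_u (brh x).
Proof.
apply: (etrans (congr1 brh (@br_lact n a b c ab cb ac u x))).
apply: (etrans _ (esym (@br_lact n a b c ab cb ac u (brh x)))).
have [_|ua] := eqVneq u a; first exact: braid_h_a.
have [_|ub] := eqVneq u b; first exact: braid_h_b.
have [_|uc] := eqVneq u c; first exact: braid_h_c.
exact: braid_h_s.
Qed.

Lemma brh_hom : chom (-1) brh.
Proof.
split; [split|move=> d x].
- exact: brhD.
- exact: (act_ext (lactP X) (lactP X) brhD brh_lact).
- move=> r x; exact: braid_h_s.
- move=> d x; exact: (braid_h_gr (c := C) (@R_prtD n) d x R_prt_abc).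
- exact: (braid_h_hgr A B (P := fun (e : int) (x : Rn n) => if e == 0 then x else 0) P0D d x P0M).
Qed.

Lemma brfh x : (braid_f C B A (brf x) : X) - x = dg (-1) (fun y => - brh y) x.
Proof.
have E : (dif (brh x) + brh (dif x) + (braid_f C B A (brf x) : X)) = x.
  apply: (etrans _ (braid_fh A B C x)).
  apply: (etrans (congr1 (fun F => (F (brh x) : X) + brh (F x) + _) (@br_dif n a b c ab cb ac))).
  by [].
rewrite dgN1 (addmapN (@difD _ X)) -opprD -{2}E.
set u := dif _; set v := brh _; set w : X := braid_f _ _ _ _.
zmod.
Qed.
End BraidRelation.

Lemma cF_braid n (a b c : 'I_n) (ab : a != b) (cb : c != b) : a != c ->
  heq (br3 ab cb) (br3 cb ab).
Proof.
move=> ac; have ca : c != a by rewrite eq_sym.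
have K x y (xy : x != y) z (zy : z != y) : x != z -> chom (-1) (fun w => - brh (ab :=
  xy) (cb := zy) w).
  move=> xz; have := chom_mulz (-1) (brh_hom xy zy xz).
  by congr chom; apply/funext => w; rewrite mulrN1z.
exists (@brf _ a b c ab cb), (@brf _ c b a cb ab); split; try exact: brf_chmap.
  apply/homotopicE; exists (fun y => - brh (ab := ab) (cb := cb) y); first exact: K.
  by move=> x; exact: brfh.
apply/homotopicE; exists (fun y => - brh (ab := cb) (cb := ab) y); first exact: K.
by move=> x; exact: brfh.
Qed.

(** * Far commutativity *)

Section FarAlgebra.
Variable R : comRingType.
Notation T1 := (R * R * R)%type.
Notation T2 := (T1 * T1 * T1)%type.

(** Transposition of the 3 by 3 array of coordinates. The sign at the last entry is the Koszul sign
    for exchanging two factors of homological degree 1. *)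
Definition far_swap (x : T2) : T2 :=
  ((x.1.1.1.1, x.1.2.1.1, x.2.1.1), (x.1.1.1.2, x.1.2.1.2, x.2.1.2),
   (x.1.1.2, x.1.2.2, - x.2.2)).

Variables a b c d : R.
Definition f_in (u : R) : T1 -> T1 := t_c (fun x => u * x).
Definition far_a : T2 -> T2 := t_a (@add1 R) (@opp1 R) (f_in a) (f_in b).
Definition far_b : T2 -> T2 := t_b (@add1 R) (@opp1 R) (f_in a) (f_in b).
Definition far_c : T2 -> T2 := t_c (t_a (@add0 R) (@opp0 R) (fun x => c * x) (fun x => d * x)).
Definition far_d : T2 -> T2 := t_c (t_b (@add0 R) (@opp0 R) (fun x => c * x) (fun x => d * x)).
Definition far_s (u : R) : T2 -> T2 := t_c (f_in u).
Definition far_dif : T2 -> T2 :=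
  t_d (@add1 R) (@opp1 R) (f_in a) (t_d (@add0 R) (@opp0 R) (fun x => c * x) (fun _ => 0)).
End FarAlgebra.

Section FarAlgebraLemmas.
Variable R : comRingType.
Variables a b c d : R.
Ltac far_ring := 
  move=> [[[[? ?] ?] [[? ?] ?]] [[? ?] ?]];
  cbv [far_swap far_a far_b far_c far_d far_s far_dif f_in add1 opp1
    t_a t_b t_c t_d t_add t_opp add0 opp0 fst snd];
  do !congr (_, _); ring.

Lemma far_swapK : cancel (@far_swap R) (@far_swap R).
Proof. far_ring. Qed.
Lemma far_swap_a x : far_swap (far_a a b x) = far_c a b (far_swap x).
Proof. move: x; far_ring. Qed.
Lemma far_swap_b x : far_swap (far_b a b x) = far_d a b (far_swap x).
Proof. move: x; far_ring. Qed.
Lemma far_swap_c x : far_swap (far_c c d x) = far_a c d (far_swap x).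
Proof. move: x; far_ring. Qed.
Lemma far_swap_d x : far_swap (far_d c d x) = far_b c d (far_swap x).
Proof. move: x; far_ring. Qed.
Lemma far_swap_s (u : R) x : far_swap (far_s u x) = far_s u (far_swap x).
Proof. move: x; far_ring. Qed.
Lemma far_swap_dif x : far_swap (far_dif a c x) = far_dif c a (far_swap x).
Proof. move: x; far_ring. Qed.
Lemma far_swap_D (x y : R * R * R * (R * R * R) * (R * R * R)) : far_swap (add2 x y) = add2
  (far_swap x) (far_swap y).
Proof.
move: x y => [[[[? ?] ?] [[? ?] ?]] [[? ?] ?]] [[[[? ?] ?] [[? ?] ?]] [[? ?] ?]].
by cbv [far_swap add2 add1 t_add add0 fst snd]; do !congr (_, _); ring.
Qed.
Lemma far_swap_gr (P : int -> R -> R) e x : (forall k, addmap (P k)) ->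
  far_swap (gr2 P e x) = gr2 P e (far_swap x).
Proof.
move=> PD; move: x => [[[[? ?] ?] [[? ?] ?]] [[? ?] ?]].
cbv [far_swap gr2 gr1 fst snd]; do !congr (_, _); rewrite ?(addmapN (PD _)) //; congr P; lia.
Qed.
Lemma far_swap_hgr (P : int -> R -> R) e x : (forall k, addmap (P k)) ->
  far_swap (hgr2 P e x) = hgr2 P e (far_swap x).
Proof.
move=> PD; move: x => [[[[? ?] ?] [[? ?] ?]] [[? ?] ?]].
by cbv [far_swap hgr2 hgr1 fst snd]; do !congr (_, _); rewrite ?(addmapN (PD _)).
Qed.
End FarAlgebraLemmas.

Section FarComplex.
Variables (n : nat) (a b c d : 'I_n).
Hypotheses (ab : a != b) (cd : c != d).
Hypotheses (ac : a != c) (ad : a != d) (bc : b != c) (bd : b != d).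
Notation A := ('X_a : Rn n).
Notation B := ('X_b : Rn n).
Notation C := ('X_c : Rn n).
Notation D := ('X_d : Rn n).

Definition fr1 := cF cd (cunit n).
Definition fr2 := cF ab fr1.

Let l1a : (lact A : fr1 -> fr1) = f_in A.
Proof. exact: (cF_lact_c cd (cunit n) ac ad). Qed.
Let l1b : (lact B : fr1 -> fr1) = f_in B.
Proof. exact: (cF_lact_c cd (cunit n) bc bd). Qed.

Lemma fr_lact u x : lact 'X_u (x : fr2) =
  if u == a then far_a A B x else if u == b then far_b A B x
  else if u == c then far_c C D x else if u == d then far_d C D x else far_s 'X_u x.
Proof.
have [->|ua] := eqVneq u a.
  exact: (congr1 (fun F => F x) (etrans (cF_lact_a ab fr1) (f_equal2 (t_a _ _) l1a l1b))).
have [->|ub] := eqVneq u b.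
  exact: (congr1 (fun F => F x) (etrans (cF_lact_b ab fr1) (f_equal2 (t_b _ _) l1a l1b))).
apply: (etrans (congr1 (fun F => F x) (cF_lact_c ab fr1 ua ub))).
have [->|uc] := eqVneq u c.
  exact: (congr1 (fun F => t_c F x) (cF_lact_a cd (cunit n))).
have [->|ud] := eqVneq u d.
  exact: (congr1 (fun F => t_c F x) (cF_lact_b cd (cunit n))).
exact: (congr1 (fun F => t_c F x) (cF_lact_c cd (cunit n) uc ud)).
Qed.

Let dif1 : (@dif _ fr1) = t_d (@add0 (Rn n)) (@opp0 (Rn n)) (fun x => C * x) (fun _ => 0).
Proof. by []. Qed.

Lemma fr_dif : (@dif _ fr2) = far_dif A C.
Proof.
apply/funext => x; transitivity ((dif x.1.1, dif x.1.2,
  (x.1.1 : fr1) + lact A (x.1.2 : fr1) - dif (x.2 : fr1)) : fr2) => //.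
by rewrite l1a dif1.
Qed.
End FarComplex.

Lemma cF_far n (a b c d : 'I_n) (ab : a != b) (cd : c != d) :
  a != c -> a != d -> b != c -> b != d ->
  ciso (cF ab (cF cd (cunit n))) (cF cd (cF ab (cunit n))).
Proof.
move=> ac ad bc bd.
have [ca da cb db] : [/\ c != a, d != a, c != b & d != b].
  by rewrite ![_ == a]eq_sym ![_ == b]eq_sym.
pose f (x : fr2 ab cd) : fr2 cd ab := far_swap x.
pose g (x : fr2 cd ab) : fr2 ab cd := far_swap x.
have fD : addmap f by move=> x y; exact: far_swap_D.
exists f, g; split; [|exact: far_swapK|exact: far_swapK].
split; [split|move=> k x|move=> x].
- exact: fD.
- apply: (act_ext (lactP _) (lactP _) fD) => u x.
  apply: (etrans (congr1 f (@fr_lact n a b c d ab cd ac ad bc bd u x))).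
  apply: (etrans _ (esym (@fr_lact n c d a b cd ab ca cb da db u (f x)))).
  have [->|ua] := eqVneq u a; first by rewrite (negPf ac) (negPf ad); exact: far_swap_a.
  have [->|ub] := eqVneq u b; first by rewrite (negPf bc) (negPf bd); exact: far_swap_b.
  have [_|uc] := eqVneq u c; first exact: far_swap_c.
  have [_|ud] := eqVneq u d; first exact: far_swap_d.
  exact: far_swap_s.
- move=> r x; exact: far_swap_s.
- move=> k x; exact: (far_swap_gr k x (@R_prtD n)).
- apply: (far_swap_hgr k x (P := fun (e : int) (x : Rn n) => if e == 0 then x else 0)) => e u w.
  by case: ifP; rewrite ?addr0.
- have E1 := congr1 (fun F => F x) (@fr_dif n a b c d ab cd ac ad).
  have E2 := congr1 (fun F => F (f x)) (@fr_dif n c d a b cd ab ca cb).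
  apply: (etrans (congr1 f E1)); apply: (etrans _ (esym E2)).
  exact: far_swap_dif.
Qed.

(** * More units *)

Section UnitRight.
Variables (n : nat) (D : cpx n).

Let f (y : D) : ctens D (cunit n) := ctm y (1 : cunit n).
Let g : ctens D (cunit n) -> D := @tlift _ _ _ (@sc_r n predT D) (@sc_l n predT (cunit n)) _
  (fun (y : D) (r : cunit n) => ract (r : Rn n) y).

Let bal : balanced (@sc_r n predT D) (@sc_l n predT (cunit n))
  (fun (y : D) (r : Rn n) => ract r y).
Proof.
have A := ractP D; split=> [r|y|[r rr] y s]; [exact: (actDr A)|exact: (actDl A)|].
by rewrite /sc_r /sc_l /= -(actM A) mulrC.
Qed.

Lemma ctens_unitr : ciso (ctens D (cunit n)) D.
Proof.
apply: ciso_sym; exists f, g; rewrite /f /g.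
have gE (y : D) (r : cunit n) : @tlift _ _ _ (@sc_r n predT D) (@sc_l n predT (cunit n)) _
  (fun (y : D) (r : cunit n) => ract (r : Rn n) y) (ctm y r) = ract (r : Rn n) y.
  exact: (tliftE bal).
split.
- split; [split=> [x y|r y|r y|d]|move=> k|move=> y].
  + exact: ctmDl.
  + by rewrite ct_lact.
  + rewrite ct_ract (@ctmB _ D (cunit n)); congr (ctm _ _).
  + apply: (gext (prtP D)) => [x y|x y|e y].
    * by rewrite (gradD (prtP D)) ctmDl.
    * by rewrite ctmDl (gradD (prtP _)).
    rewrite -prt_one (ct_prtE (D := cunit n)) addr0 (gradK (prtP D)).
    by case: eqP => // _; rewrite (addmap0 (@ctmDl _ _ _ _)).
  + apply: (gext (hprP D)) => [x y|x y|e y].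
    * by rewrite hprD ctmDl.
    * by rewrite ctmDl hprD.
    have E : (1 : cunit n) = hpr 0 (1 : cunit n) by [].
    rewrite E (ct_hprE (D := cunit n)) addr0 (gradK (hprP D)).
    by case: eqP => // _; rewrite (addmap0 (@ctmDl _ _ _ _)).
  + by rewrite ct_difE (addmap0 (@ctmDr _ _ _ _)) addr0.
- by move=> y; rewrite gE (act1 (ractP D)).
- have gD := tliftD bal.
  apply: tens_ind => [|x y hx hy|y r].
  + by rewrite (addmap0 gD) (addmap0 (@ctmDl _ _ _ _)).
  + by rewrite gD ctmDl hx hy.
  + rewrite -/(ctm y (r : cunit n)) gE (@ctmB _ D (cunit n)); congr (ctm _ _).
    exact: mulr1.
Qed.
End UnitRight.

Section SqcupUnit.
Variables a b : nat.
Notation S := (csqcup (cunit a) (cunit b)).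

Definition vars_l := [tuple ('X_(lshift b i) : Rn (a + b)) | i < a].
Definition vars_r := [tuple ('X_(rshift a j) : Rn (a + b)) | j < b].

Lemma comp_varsM n k (s : n.-tuple (Rn k)) (f g : Rn n) : (f * g) \mPo s = (f \mPo s) * (g \mPo s).
Proof. exact: rmorphM. Qed.

Lemma comp_varsB n k (s : n.-tuple (Rn k)) (f g : Rn n) : (f - g) \mPo s = (f \mPo s) - (g \mPo s).
Proof. exact: raddfB. Qed.

Lemma comp_vars_l i : ('X_i : Rn a) \mPo vars_l = 'X_(lshift b i).
Proof. by rewrite comp_mpolyXU -tnth_nth tnth_mktuple. Qed.

Lemma comp_vars_r j : ('X_j : Rn b) \mPo vars_r = 'X_(rshift a j).
Proof. by rewrite comp_mpolyXU -tnth_nth tnth_mktuple. Qed.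

Definition sq_one : S := csm (1 : cunit a) (1 : cunit b).
Definition sq_to (f : cunit (a + b)) : S := lact (f : Rn _) sq_one.
Definition sq_fro : S -> cunit (a + b) :=
  cs_lift (fun (f : cunit a) (g : cunit b) => ((f : Rn a) \mPo vars_l) * ((g : Rn b) \mPo vars_r)).

Let fl : forall g : cunit b, addmap (fun f : cunit a => ((f : Rn a) \mPo vars_l) * ((g : Rn b)
  \mPo vars_r)).
Proof. by move=> g f f'; rewrite /= raddfD mulrDl. Qed.
Let fr : forall f : cunit a, addmap (fun g : cunit b => ((f : Rn a) \mPo vars_l) * ((g : Rn b)
  \mPo vars_r)).
Proof. by move=> f g g'; rewrite /= raddfD mulrDr. Qed.

Lemma sq_froE (f : cunit a) (g : cunit b) :
  sq_fro (csm f g) = ((f : Rn a) \mPo vars_l) * ((g : Rn b) \mPo vars_r).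
Proof. exact: (cs_liftE fl fr). Qed.

Lemma sq_froD : addmap sq_fro.
Proof. exact: (cs_liftD fl fr). Qed.

Lemma sq_fro_lact r x : sq_fro (lact r x) = lact r (sq_fro x).
Proof.
move: r x; apply: (act_ext (lactP S) (lactP (cunit (a + b))) sq_froD) => u.
apply: cs_ext => [x y|x y|f g].
- by rewrite (actDr (lactP S)) sq_froD.
- by rewrite sq_froD (actDr (lactP (cunit (a + b)))).
have [i ->|j ->] := split_ordP u.
  rewrite cs_lactl !sq_froE.
  rewrite -[X in X \mPo _]/('X_i * (f : Rn a)) comp_varsM comp_vars_l -mulrA.
  by [].
rewrite cs_lactr !sq_froE.
rewrite -[X in _ * (X \mPo _)]/('X_j * (g : Rn b)) comp_varsM comp_vars_r mulrCA.
by [].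
Qed.

Lemma lact_csm_l (f f' : cunit a) (g : cunit b) :
  lact ((f : Rn a) \mPo vars_l) (csm f' g : S) = csm (lact (f : Rn a) f') g.
Proof.
move: f f'; apply: mpoly_int_ind => [f'|f h hf hh f'|f u hf f'].
- by rewrite comp_mpoly1 (act1 (lactP S)) (act1 (lactP (cunit a))).
- by rewrite comp_varsB lactBl hf hh [in RHS]lactBl (addmapB (@csmDl _ _ _ _ _)).
- by rewrite comp_varsM comp_vars_l !lactM hf cs_lactl.
Qed.

Lemma lact_csm_r (g g' : cunit b) (f : cunit a) :
  lact ((g : Rn b) \mPo vars_r) (csm f g' : S) = csm f (lact (g : Rn b) g').
Proof.
move: g g'; apply: mpoly_int_ind => [g'|g h hg hh g'|g u hg g'].
- by rewrite comp_mpoly1 (act1 (lactP S)) (act1 (lactP (cunit b))).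
- by rewrite comp_varsB lactBl hg hh [in RHS]lactBl (addmapB (@csmDr _ _ _ _ _)).
- by rewrite comp_varsM comp_vars_r !lactM hg cs_lactr.
Qed.

(** Both multiplications agree on 1 (x) 1, which makes the left linear map [sq_to] linear on the
    right too. *)
Lemma lract_sq_one (r : Rn (a + b)) : ract r sq_one = lact r sq_one.
Proof.
elim/mpoly_int_ind: r => [|f g hf hg|f u hf].
- by rewrite (act1 (lactP S)) (act1 (ractP S)).
- by rewrite lactBl ractBl hf hg.
have X : ract 'X_u sq_one = lact 'X_u sq_one.
  by have [i ->|j ->] := split_ordP u; rewrite ?cs_lactl ?cs_ractl ?cs_lactr ?cs_ractr.
by rewrite ractM hf -lractC X -lactM mulrC.
Qed.

Lemma csqcup_unit : ciso S (cunit (a + b)).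
Proof.
apply: ciso_sym; exists sq_to, sq_fro.
have toD : addmap sq_to by move=> f g; exact: lactDl.
have one_prt : sq_one = prt 0 sq_one.
  have := cs_prtE (C := cunit a) (D := cunit b) 0 0 0 (1 : Rn a) (1 : Rn b).
  have E c : prt 0 (1 : cunit c) = 1 by exact: prt_one.
  by rewrite !E addr0 eqxx => ->.
have one_hpr : sq_one = hpr 0 sq_one.
  have := cs_hprE (C := cunit a) (D := cunit b) 0 0 0 (1 : Rn a) (1 : Rn b).
  by rewrite addr0 eqxx => ->.
split; [split; [split=> [//|r f|r f|d]|move=> k f|move=> f]|move=> f|].
- exact: (lactM r f sq_one).
- rewrite /sq_to -[X in lact X]/((r : Rn _) * (f : Rn _)) mulrC lactM -lract_sq_one lractC.
  by [].
- apply: (gext (R_prtP (a + b))) => [x y|x y|e f].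
  + by rewrite (gradD (prtP (cunit (a + b)))) toD.
  + by rewrite toD (gradD (prtP S)).
  rewrite -[prt d _]/(R_prt d (R_prt e f)).
  case: (R_prt_cases e f) => [->|[k -> kh]].
    by rewrite (addmap0 (R_prtD _)) (addmap0 toD) (addmap0 (gradD (prtP S) _)).
  have Y : lact (R_prt k.*2 f) sq_one = prt k.*2 (lact (R_prt k.*2 f) sq_one).
    by rewrite {1}one_prt (lact_prt kh) add0r.
  rewrite (R_prt_hom _ kh) /sq_to [in RHS]Y (gradK (prtP S)) -Y.
  by case: eqP => // _; rewrite lact0l.
- have E : hpr k (sq_to f) = lact (f : Rn _) (hpr k sq_one).
    by rewrite (ghom_l (hpr_hom S k)).
  rewrite E one_hpr (gradK (hprP S)) -one_hpr.
  transitivity (sq_to (if k == 0 then f else 0)) => //.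
  by case: eqP => // _; rewrite (addmap0 toD) lact0r.
- have d0 : dif sq_one = 0.
    by rewrite /sq_one cs_difE (addmap0 (@csmDl _ _ _ _ _)) (addmap0 (@csmDr _ _ _ _ _)) addr0.
  transitivity (sq_to 0) => //.
  by rewrite (addmap0 toD) /sq_to (ghom_l (dif_hom S)) d0 lact0r.
- rewrite /sq_to sq_fro_lact sq_froE !comp_mpoly1 mul1r.
  exact: mulr1.
- apply: cs_ind => [|x y hx hy|f g].
  + by rewrite (addmap0 sq_froD) (addmap0 toD).
  + by rewrite sq_froD toD hx hy.
  rewrite sq_froE /sq_to lactM lact_csm_r lact_csm_l.
  congr (csm _ _); exact: mulr1.
Qed.
End SqcupUnit.

(** * Braid words *)

Section Shifts.
Variable n : nat.
Implicit Types C D : cpx n.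

Lemma csh_chmap a b C D (f : C -> D) : is_chmap f ->
  is_chmap (f : csh a b C -> csh a b D).
Proof.
move=> [[fD fl fr fp] fh fd]; split; [split=> // d x; exact: fp|move=> k x; exact: fh|].
by move=> x; rewrite /= /sh_dif (addmapMz fD) fd.
Qed.

Lemma csh_homotopic a b C D (f g : C -> D) : homotopic f g ->
  homotopic (f : csh a b C -> csh a b D) (g : csh a b C -> csh a b D).
Proof.
move=> /homotopicE[h hH hE]; apply/homotopicE; exists (fun x => h x *~ sg b).
  have [[hD hl hr hp] hh] := chom_mulz (sg b) hH; split.
    by split=> // d x; exact: hp.
  by move=> k x; rewrite /= /sh_hpr hh addrAC.
move=> x; rewrite [LHS]hE /dg /= /sh_dif -/(sg b).
rewrite (addmapMz (@difD _ _)) (addmapMz (chomD hH)) /= mulzsgK.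
by congr (_ - _ *~ _); rewrite mulzsgK.
Qed.

Lemma csh_heq a b C D : heq C D -> heq (csh a b C) (csh a b D).
Proof.
move=> [f [g [fC gC gf fg]]]; exists f, g.
by split; [exact: csh_chmap|exact: csh_chmap|exact: csh_homotopic..].
Qed.

Lemma csh_csh a b c d C : ciso (csh a b (csh c d C)) (csh (a + c) (b + d) C).
Proof.
exists id, id; split=> //; split=> [|k x|x].
- by split=> // e x /=; rewrite /shift_prt addrA.
- by rewrite /= /sh_hpr addrA.
- by rewrite /= /sh_dif /= /sh_dif -mulrzA -!/(sg _) sgD mulrC.
Qed.

Lemma csh0 C : ciso (csh 0 0 C) C.
Proof.
exists id, id; split=> //; split=> [|k x|x].
- by split=> // e x /=; rewrite /shift_prt addr0.
- by rewrite /= /sh_hpr addr0.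
- by rewrite /= /sh_dif mulr1z.
Qed.

Lemma ctens_cshl a b C D : ciso (ctens (csh a b C) D) (csh a b (ctens C D)).
Proof. exact: (mp_sh (bifun_left (ctens_bifun n) D) a b C). Qed.

Lemma ctens_cshr a b C D : ciso (ctens C (csh a b D)) (csh a b (ctens C D)).
Proof. exact: (mp_sh (bifun_right (ctens_bifun n) C) a b D). Qed.
End Shifts.

Section TensorCongruence.
Variable n : nat.
Implicit Types A B C D : cpx n.

Lemma ctens_heq A B C D : heq A B -> heq C D -> heq (ctens A C) (ctens B D).
Proof.
move=> AB CD; apply: (heq_trans (D := ctens B C)).
  exact: (ob_heq (bifun_left (ctens_bifun n) C) AB).
exact: (ob_heq (bifun_right (ctens_bifun n) B) CD).
Qed.

Lemma ctens_heql A B C : heq A B -> heq (ctens A C) (ctens B C).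
Proof. by move=> AB; apply: ctens_heq => //; exact: heq_refl. Qed.

Lemma ctens_heqr A C D : heq C D -> heq (ctens A C) (ctens A D).
Proof. by move=> CD; apply: ctens_heq => //; exact: heq_refl. Qed.

End TensorCongruence.

Section Words.
Variable N : nat.
(** Letters are natural numbers, so that words can be shifted and compared without ordinal proofs; a
    letter out of range stands for the unit. *)
Definition Fn (i : nat) : cpx N :=
  if insub i is Some j then Fsigma (j : 'I_N.-1) else cunit N.

Definition rqn (w : seq nat) : cpx N := cprod [seq Fn i | i <- w].

Lemma Fn_val (i : 'I_N.-1) : Fn i = Fsigma i.
Proof. by rewrite /Fn valK. Qed.

Lemma rouquier_rqn (w : seq 'I_N.-1) : rouquier w = rqn [seq val i | i <- w].
Proof.
rewrite /rouquier /rqn -map_comp; congr cprod; apply: eq_map => i.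
by rewrite /= Fn_val.
Qed.

Lemma rqn_cat u v : ciso (rqn (u ++ v)) (ctens (rqn u) (rqn v)).
Proof.
elim: u => [|i u IH]; first exact/ciso_sym/ctens_unitl.
apply: (ciso_trans _ (ciso_sym (ctens_assoc _ _ _))).
exact: (ob_ciso (bifun_right (ctens_bifun N) (Fn i)) IH).
Qed.

Section Letters.
Variables (i j : 'I_N.-1).
Lemma lo_hi (k : 'I_N.-1) : lo k != hi k.
Proof. by apply/eqP => /(congr1 val) /=; lia. Qed.

Lemma rqn_far : (i.+1 < j)%N -> heq (rqn [:: val i; val j]) (rqn [:: val j; val i]).
Proof.
move=> ij; rewrite /rqn /= !Fn_val.
have FF k (l : 'I_N.-1) : ciso (cF (lo_hi k) (cF (lo_hi l) (cunit N)))
    (ctens (Fsigma k) (ctens (Fsigma l) (cunit N))).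
  apply: (ciso_trans (cF_iso (lo_hi k) (erefl _) _)).
  exact: (ob_ciso (bifun_right (ctens_bifun N) (Fsigma k)) (cF_iso (lo_hi l) (erefl _) _)).
apply/ciso_heq/(ciso_trans (ciso_sym (FF i j)))/(ciso_trans _ (FF j i)).
by apply: cF_far; apply/eqP => /(congr1 val) /=; lia.
Qed.

Lemma rqn_braid : j = i.+1 :> nat ->
  heq (rqn [:: val i; val j; val i]) (rqn [:: val j; val i; val j]).
Proof.
move=> ij; rewrite /rqn /= !Fn_val.
have E : hi i = lo j by apply: val_inj; rewrite /= ij.
have cb : hi j != hi i by apply/eqP => /(congr1 val) /=; lia.
(* The pair for j is listed in descending order, so that both pairs have the common strand hi i = lo
   j as second entry, as [cF_braid] requires. *)
have sj : s_ j = tperm (hi j) (hi i) by rewrite E tpermC.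
have ac : lo i != hi j by apply/eqP => /(congr1 val) /=; lia.
have FF (a b c : 'I_N) (ab : a != b) (cb' : c != b) k l :
   s_ k = tperm a b -> s_ l = tperm c b ->
   ciso (br3 ab cb')
    (ctens (Fsigma k) (ctens (Fsigma l) (ctens (Fsigma k) (cunit N)))).
  move=> kE lE; apply: (ciso_trans (cF_iso ab kE _)).
  apply: (ob_ciso (bifun_right (ctens_bifun N) (Fsigma k))).
  apply: (ciso_trans (cF_iso cb' lE _)).
  exact: (ob_ciso (bifun_right (ctens_bifun N) (Fsigma l)) (cF_iso ab kE _)).
apply: (heq_trans (ciso_heq (ciso_sym (FF _ _ _ (lo_hi i) cb i j (erefl _) sj)))).
apply: (heq_trans (cF_braid (lo_hi i) cb ac)).
exact: (ciso_heq (FF _ _ _ cb (lo_hi i) j i sj (erefl _))).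
Qed.
End Letters.
End Words.

(* Equality of positive braid words, the letter i standing for sigma_(i+1). *)
Inductive beq : seq nat -> seq nat -> Prop :=
| beq_refl w : beq w w
| beq_sym u v : beq u v -> beq v u
| beq_trans u v w : beq u v -> beq v w -> beq u w
| beq_cat u u' v v' : beq u u' -> beq v v' -> beq (u ++ v) (u' ++ v')
| beq_far i j : (i.+1 < j)%N -> beq [:: i; j] [:: j; i]
| beq_braid i : beq [:: i; i.+1; i] [:: i.+1; i; i.+1].

(** The range of the letters is tracked along with the equivalence, because symmetry and
    transitivity have to transfer it to the other word. *)
Lemma beq_heq N u v : beq u v ->
  all (fun i => i < N.-1)%N u = all (fun i => i < N.-1)%N v /\
  (all (fun i => i < N.-1)%N u -> heq (rqn N u) (rqn N v)).
Proof.
elim=> {u v} [w|u v _ [E H]|u v w _ [E H] _ [E' H']|u u' v v' _ [E H] _ [E' H']|i j ij|i].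
- by split=> // _; exact: heq_refl.
- by split=> // h; apply: heq_sym; apply: H; rewrite E.
- split=> [|h]; first by rewrite E.
  by apply: (heq_trans (H h)); apply: H'; rewrite -E.
- rewrite !all_cat E E'; split=> // /andP[h h'].
  apply: (heq_trans (ciso_heq (rqn_cat _ _ _))).
  apply: (heq_trans _ (heq_sym (ciso_heq (rqn_cat _ _ _)))).
  by apply: ctens_heq; [apply: H; rewrite E|apply: H'; rewrite E'].
- split=> [|/and3P[iN jN _]]; first by rewrite /= !andbT andbC.
  exact: (@rqn_far N (Ordinal iN) (Ordinal jN)).
- split=> [|/and3P[iN jN _]]; first by rewrite /=; case: (i < _)%N; case: (i.+1 < _)%N.
  exact: (@rqn_braid N (Ordinal iN) (Ordinal jN)).
Qed.

(** * The complexes K_n *)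

Section DgfunComposition.
Variables (i j n : nat) (F : dgfun j n) (G : dgfun i j).
Let m s (C D : cpx i) (f : C -> D) := mp F s (mp G s f).

Let c_hom s (C D : cpx i) (f : C -> D) : chom s f -> chom s (m s f).
Proof. by move=> fH; do 2!apply: mp_hom. Qed.
Let c_id (C : cpx i) (x : F (G C)) : m 0 (@id C) x = x.
Proof.
rewrite /m -[RHS](mp_id F); congr (mp F 0 _ x); apply/funext => y; exact: mp_id.
Qed.
Let c_comp s t (C D E : cpx i) (f : D -> E) (g : C -> D) : chom s f -> chom t g ->
  forall x, m (t + s) (f \o g) x = m s f (m t g x).
Proof.
move=> fH gH x; rewrite /m -(mp_comp F (mp_hom G fH) (mp_hom G gH)).
congr (mp F _ _ x); apply/funext => y; exact: mp_comp.
Qed.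
Let c_add s (C D : cpx i) (f g : C -> D) : chom s f -> chom s g ->
  forall x, m s (f \+ g) x = m s f x + m s g x.
Proof.
move=> fH gH x; rewrite /m -(mp_add F (mp_hom G fH) (mp_hom G gH)).
congr (mp F _ _ x); apply/funext => y; exact: mp_add.
Qed.
Let c_dg s (C D : cpx i) (f : C -> D) : chom s f ->
  forall x, m (s + 1) (dg s f) x = dg s (m s f) x.
Proof.
move=> fH x; rewrite /m -(mp_dg F (mp_hom G fH)).
congr (mp F _ _ x); apply/funext => y; exact: mp_dg.
Qed.
Let c_gr (C : cpx i) (p : int -> C -> C) : is_grading p ->
  (forall k, chom 0 (p k)) -> is_grading (fun k => m 0 (p k)).
Proof.
by move=> pG pH; apply: (mp_gr F (mp_gr G pG pH)) => k; exact: mp_hom.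
Qed.
Let c_sh a b (C : cpx i) : ciso (F (G (csh a b C))) (csh a b (F (G C))).
Proof.
apply: (ciso_trans (ob_ciso F (mp_sh G a b C))); exact: mp_sh.
Qed.

Definition dgcomp : dgfun i n :=
  @Dgfun i n (fun C => F (G C)) m c_hom c_id c_comp c_add c_dg c_gr c_sh.
End DgfunComposition.

(** * Complexes killed by the first bimodules B_i *)

Section Kill.
Variable n : nat.

Lemma contr_ctens_assoc (A B C : cpx n) :
  contr (ctens A (ctens B C)) <-> contr (ctens (ctens A B) C).
Proof.
by split; apply: contr_heq; apply/ciso_heq; [apply: ciso_sym|]; exact: ctens_assoc.
Qed.

(** The letters below m are the crossings among the first m + 1 strands; this is why a complex on a
    strands kills at most [a.-1] of them. *)
Definition kills m (Z : cpx n) := forall i : 'I_n.-1, (i < m)%N -> contr (ctens (conc (Bs i)) Z).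

Lemma kills_ctens m Y Z : kills m Y -> kills m (ctens Y Z).
Proof.
move=> hY i im; apply/contr_ctens_assoc.
exact: (ob_contr (bifun_left (ctens_bifun n) Z) (hY i im)).
Qed.

Lemma Fsigma_absorb (i : 'I_n.-1) Z : contr (ctens (conc (Bs i)) Z) ->
  heq (ctens (Fsigma i) Z) (thalf 1 Z).
Proof.
move=> h; apply: (heq_trans (ciso_heq (ciso_sym (cF_iso (lo_hi i) (erefl _) Z)))).
apply: cF_absorb; apply: contr_heq h; apply/ciso_heq/ciso_sym.
exact: (cB_iso (lo_hi i) (erefl _) Z).
Qed.
End Kill.

Lemma Bs_sqcup k l (i0 : 'I_k.-1) (i : 'I_(k + l).-1) : i = i0 :> nat ->
  forall (C : cpx k) (D : cpx l),
  ciso (csqcup (ctens (conc (Bs i0)) C) D) (ctens (conc (Bs i)) (csqcup C D)).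
Proof.
move=> ii C D; have iE : s_ i = tperm (lshift l (lo i0)) (lshift l (hi i0)).
  by rewrite /s_; congr tperm; apply: val_inj; rewrite /= ii.
apply: (ciso_trans (ob_ciso (bifun_left (csqcup_bifun k l) D)
   (ciso_sym (cB_iso (lo_hi i0) (erefl _) C)))).
apply: (ciso_trans (csqcup_cBl (lo_hi i0) C D)).
exact: (cB_iso _ iE).
Qed.

Lemma kills_box k l N (e : (k + l)%N = N) (C : cpx k) (D : cpx l) m :
  (m <= k.-1)%N -> kills m C -> kills m (ccast e (csqcup C D)).
Proof.
case: N / e => /= mk hC i im.
have ik : (i < k.-1)%N by lia.
have ii : i = Ordinal ik :> nat by [].
apply: (contr_heq (ciso_heq (Bs_sqcup ii C D))).
apply: (ob_contr (bifun_left (csqcup_bifun k l) D)); exact: hC.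
Qed.

Lemma conc_gtens n (M N : gbimod n) : ciso (conc (gtens M N)) (ctens (conc M) (conc N)).
Proof.
pose T := ctens (conc M) (conc N).
exists (fun x : gtens M N => x : T), (fun x : T => x : gtens M N).
split=> //; split=> // [k|x].
- apply: (pt_hom_ext (B := ctens_bifun n) (hprP (conc M)) (hprP (conc N))).
  + exact: (hprD (C := conc (gtens M N)) k).
  + exact: (hprD (C := T) k).
  move=> e e' x y.
  rewrite [RHS](ct_hprE (C := conc M) (D := conc N)).
  transitivity ((if k == 0 then ctm (hpr e (x : conc M)) (hpr e' (y : conc N)) else 0) : T) => //.
  have Z1 : ctm (0 : conc M) (hpr e' (y : conc N)) = 0 := addmap0 (@ctmDl _ _ (conc N) _).
  have Z2 (z : conc M) : ctm z (0 : conc N) = 0 := addmap0 (@ctmDr _ (conc M) _ _).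
  have E1 : hpr e (x : conc M) = if e == 0 then x else 0 by [].
  have E2 : hpr e' (y : conc N) = if e' == 0 then y else 0 by [].
  rewrite E1 E2; case: (e =P 0) => [->|_]; last by rewrite -E2 Z1 !if_same.
  by case: (e' =P 0) => [->|_]; rewrite ?addr0 // Z2 !if_same.
- suff -> : dif (x : T) = 0 by [].
  move: x; apply: (@ct_ext _ (conc M) (conc N)) => [x y|x y|x y].
  + exact: difD.
  + by rewrite addr0.
  rewrite ct_difE (addmap0 (@ctmDl _ _ (conc N) _)) add0r.
  exact: (addmap0 (@ctmDr _ (conc M) _ _)).
Qed.

Lemma conc_gshift n a (M : gbimod n) : ciso (conc (gshift a M)) (csh a 0 (conc M)).
Proof.
exists id, id; split=> //; split=> [|k x|x] //.
by rewrite /= /sh_hpr addr0.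
Qed.

Lemma conc_chmap n (M N : gbimod n) (f : M -> N) : ghom f ->
  is_chmap (f : conc M -> conc N).
Proof.
move=> fH; split=> // [k x|x]; first by rewrite /= (if_morph _ _ (ghomD fH)).
exact: (addmap0 (ghomD fH)).
Qed.

Lemma gsum_sext n (M N : gbimod n) :
  sext (W := conc (gsum M N)) (A := conc M) (B := conc N)
    (fun x : M => (x, 0) : gsum M N) fst snd (fun y : N => (0, y) : gsum M N).
Proof.
have H1 : ghom (fun x : M => (x, 0) : gsum M N).
  split=> [x y|r x|r x|d x]; first by rewrite [RHS]pair_add addr0.
  - by rewrite /= /sum_lact /= lact0r.
  - by rewrite /= /sum_ract /= ract0r.
  - by rewrite /= /pair_gr /= (addmap0 (gradD (prtP N) _)).
have H2 : ghom (fun y : N => (0, y) : gsum M N).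
  split=> [x y|r x|r x|d x]; first by rewrite [RHS]pair_add addr0.
  - by rewrite /= /sum_lact /= lact0r.
  - by rewrite /= /sum_ract /= ract0r.
  - by rewrite /= /pair_gr /= (addmap0 (gradD (prtP M) _)).
have H3 : ghom (fst : gsum M N -> M) by [].
have H4 : ghom (snd : gsum M N -> N) by [].
split=> //; try (exact: conc_chmap); try (apply: chmap_hom0; exact: conc_chmap).
by move=> [x y]; rewrite [LHS]pair_add addr0 add0r.
Qed.

(** * Tensoring with a symmetrizer keeps the killing property *)

Section KillSymmetrizer.
Variables (j l N : nat) (e : (j + l)%N = N) (Z : cpx N).

(** The functor sending C to (C |_| 1) (x) Z. Having it as a dg functor of C allows applying it to
    the unit map of a symmetrizer and to the cone of that map. *)
Definition kill_fun : dgfun j N :=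
  dgcomp (bifun_left (ctens_bifun N) Z)
    (ecast n (dgfun j n) e (bifun_left (csqcup_bifun j l) (cunit l))).

Lemma kill_funE C : kill_fun C = ctens (ccast e (csqcup C (cunit l))) Z.
Proof. by rewrite /kill_fun; case: N / e Z. Qed.

Lemma kill_fun_unit : ciso (kill_fun (cunit j)) Z.
Proof.
rewrite kill_funE; case: N / e Z => Z' /=.
apply: ciso_trans (ctens_unitl Z').
exact: (ob_ciso (bifun_left (ctens_bifun _) Z') (csqcup_unit j l)).
Qed.

Lemma kill_fun_Bs (i0 : 'I_j.-1) (i : 'I_N.-1) : i = i0 :> nat -> forall C,
  ciso (kill_fun (ctens (conc (Bs i0)) C)) (ctens (conc (Bs i)) (kill_fun C)).
Proof.
move=> ii C; rewrite !kill_funE; move: i ii; case: N / e Z => Z' i ii /=.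
apply: (ciso_trans _ (ctens_assoc _ _ _)).
exact: (ob_ciso (bifun_left (ctens_bifun _) Z') (Bs_sqcup ii C (cunit l))).
Qed.

Variables (m : nat) (jm : (j.-1 <= m)%N) (hZ : kills m Z).

(** The last letter of the word meets Z and is killed; the letters before it are only tensored on
    the left of a contractible complex. *)
Lemma kill_word (w : seq 'I_j.-1) : w != [::] ->
  contr (kill_fun (conc (foldr (@gtens j) (gunit j) [seq Bs i | i <- w]))).
Proof.
elim: w => // i0 w IH _ /=.
have iN : (i0 < N.-1)%N by have := ltn_ord i0; lia.
have ii : Ordinal iN = i0 :> nat by [].
apply: (contr_heq (ciso_heq (ob_ciso kill_fun (ciso_sym (conc_gtens _ _))))).
apply: (contr_heq (ciso_heq (ciso_sym (kill_fun_Bs ii _)))).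
case: w IH => [_|i1 w IH] /=; last first.
  exact: (ob_contr (bifun_right (ctens_bifun N) _) (IH isT)).
apply: (contr_heq (ctens_heqr _ (ciso_heq (ciso_sym kill_fun_unit)))).
apply: hZ => /=; have := ltn_ord i0; lia.
Qed.

Lemma kill_Bsum (M : gbimod j) : is_Bsum M -> contr (kill_fun (conc M)).
Proof.
move=> [s sw MS].
apply: (contr_heq (ob_heq kill_fun (ciso_heq (giso_conc (giso_sym MS))))).
elim: s sw {M MS} => [_|[w a] s IH /= /andP[w0 /IH sw]] /=.
  exact: (ob_contr kill_fun (contr_czero j)).
apply: (contr_mid (ob_sext kill_fun (gsum_sext _ _))) => //.
apply: (contr_heq (ob_heq kill_fun (ciso_heq (ciso_sym (conc_gshift _ _))))).
apply: ob_csh; exact: kill_word.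
Qed.

(** Apply B_i (x) (- |_| 1) (x) Z to the unit map R -> P. The cone becomes contractible column by
    column, and the source becomes B_i (x) Z, which is contractible by assumption; hence so is the
    target. B_i is never moved past P |_| 1, so i may lie beyond the strands of P. *)
Lemma kill_symm (P : cpx j) : is_symmetrizer P -> kills m (kill_fun P).
Proof.
move=> [_ _ _ [f [fC [D [Db Dc Dh]]]]] i ij.
pose G := dgcomp (bifun_right (ctens_bifun N) (conc (Bs i))) kill_fun.
apply: (@ob_cone_target _ _ G _ _ _ fC).
  apply: (ob_contr (bifun_right (ctens_bifun N) (conc (Bs i)))).
  apply: (contr_heq (ob_heq kill_fun (heq_sym Dh))).
  by apply: contr_columns => // k; exact: kill_Bsum.
apply: (contr_heq (ctens_heqr _ (ciso_heq (ciso_sym kill_fun_unit)))).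
exact: hZ.
Qed.
End KillSymmetrizer.

Section KillK.
Variables (P : forall j : nat, cpx j)
  (hP : forall j : nat, (1 <= j)%N -> is_symmetrizer (P j))
  (u : forall j : nat, qsh (tsh (1 - j%:Z) (P j)) -> P j)
  (uC : forall j : nat,
     is_chmap (C := qsh (tsh (1 - j%:Z) (P j))) (D := P j) (@u j))
  (Q : forall j : nat, cpx j)
  (hQ : forall j : nat, (1 <= j)%N -> heq (Q j) (tsh (j%:Z - 1) (cone (uC j)))).

Lemma contr_Q j n (G : dgfun j n) : (1 <= j)%N -> contr (G (P j)) -> contr (G (Q j)).
Proof.
move=> j1 h; apply: (contr_heq (ob_heq G (heq_sym (hQ j1)))).
apply: ob_csh; apply: ob_cone => //; exact/ob_csh/ob_csh.
Qed.

Lemma kills_Q j l N (e : (j.+1 + l)%N = N) Z : kills N.-1 Z ->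
  kills N.-1 (ctens (ccast e (csqcup (Q j.+1) (cunit l))) Z).
Proof.
move=> hZ; have jm : (j.+1.-1 <= N.-1)%N by lia.
rewrite -(kill_funE e) => i iN.
apply: (contr_Q (G := dgcomp (bifun_right (ctens_bifun N) (conc (Bs i))) (kill_fun e Z))) => //.
exact: (kill_symm e jm hZ (hP (ltn0Sn j)) iN).
Qed.

(** The induction runs from the right end of the product. The last factor Q_a uses all a strands and
    is killed by property (i) of P_a; each further factor is multiplied on the left, where [kills_Q]
    applies. *)
Lemma kills_Kn a : kills a.-1 (Kn Q a).
Proof.
case: a => [i|a]; first by rewrite ltn0.
rewrite /Kn enum_ordSr map_rcons /cprod foldr_rcons.
have : kills a (ctens (ccast (subnKC (ltn_ord (@ord_max a)))
   (csqcup (Q (@ord_max a).+1) (cunit (a.+1 - (@ord_max a).+1)))) (cunit a.+1)).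
  apply: kills_ctens; apply: kills_box => //= i ia.
  apply: (contr_Q (G := bifun_right (ctens_bifun a.+1) (conc (Bs i)))) => //.
  apply: heq_contr; exact: (symm_Bl (hP (ltn0Sn a)) i).
move=> Z0K; elim: [seq widen_ord _ _ | _ <- _] => // j s IH /=.
exact: (kills_Q _ IH).
Qed.
End KillK.

(** * Absorption of crossings *)

Lemma rqn_absorb n m (Z : cpx n) (w : seq nat) : (m <= n.-1)%N -> kills m Z ->
  all (fun i => i < m)%N w -> heq (ctens (rqn n w) Z) (thalf (size w)%:Z Z).
Proof.
move=> mn hZ; elim: w => [_|i w IH /= /andP[im /IH h]].
  apply: (heq_trans (ciso_heq (ctens_unitl Z))).
  exact/ciso_heq/ciso_sym/csh0.
have iN : (i < n.-1)%N by apply: leq_trans mn.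
apply: (heq_trans (ciso_heq (ctens_assoc _ _ _))).
apply: (heq_trans (ctens_heqr _ h)).
apply: (heq_trans (ciso_heq (ctens_cshr _ _ _ _))).
rewrite (Fn_val (Ordinal iN)).
apply: (heq_trans (csh_heq _ _ (Fsigma_absorb (i := Ordinal iN) (hZ (Ordinal iN) im)))).
apply: (heq_trans (ciso_heq (csh_csh _ _ _ _ _))).
have -> : (size w)%:Z + 1 = (size w).+1%:Z by lia.
have -> : - (size w)%:Z + - (1 : int) = - (size w).+1%:Z by lia.
exact: heq_refl.
Qed.

(** The crossings are pulled out of the right factor one at a time by [csqcup_cFr], which applies
    because each partial product is paired with a unit complex. *)
Lemma csqcup_rqn a b w : all (fun i => i < b.-1)%N w ->
  ciso (csqcup (cunit a) (rqn b w)) (rqn (a + b) [seq (a + i)%N | i <- w]).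
Proof.
elim: w => [_|i w IH /= /andP[ib /IH h]]; first exact: csqcup_unit.
have jb : (a + i < (a + b).-1)%N by lia.
rewrite -[rqn b _]/(ctens (Fn b (Ordinal ib)) (rqn b w)).
rewrite -[rqn (a + b) _]/(ctens (Fn (a + b) (Ordinal jb)) (rqn (a + b) [seq (a + i)%N | i <- w])).
rewrite (Fn_val (Ordinal ib)) (Fn_val (Ordinal jb)).
have E : s_ (Ordinal jb) = tperm (rshift a (lo (Ordinal ib))) (rshift a (hi (Ordinal ib))).
  by rewrite /s_; congr tperm; apply: val_inj; rewrite /= ?addnS.
apply: (ciso_trans (ob_ciso (bifun_right (csqcup_bifun a b) (cunit a))
   (ciso_sym (cF_iso (lo_hi (Ordinal ib)) (erefl _) (rqn b w))))).
apply: (ciso_trans (csqcup_cFr (lo_hi (Ordinal ib)) (gunit a) (rqn b w))).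
apply: (ciso_trans (cF_iso _ E _)).
exact: (ob_ciso (bifun_right (ctens_bifun _) _) h).
Qed.

Definition coxn n : seq nat := rev (iota 0 n.-1).
(** The full twist on the strands l, ..., n-1 of an n-strand braid, strands counted from 0. *)
Definition ftn l n : seq nat := flatten (nseq (n - l) (rev (iota l (n - l).-1))).

Lemma FT_rqn n : FT n = rqn n (ftn 0 n).
Proof.
rewrite /FT rouquier_rqn /ftn subn0; congr rqn.
rewrite map_flatten map_nseq; congr (flatten (nseq _ _)).
by rewrite map_rev val_enum_ord.
Qed.

Lemma rouquier_cox n : rouquier (cox n) = rqn n (coxn n).
Proof. by rewrite rouquier_rqn /cox map_rev val_enum_ord. Qed.

Lemma FT_box a b N (e : (a + b)%N = N) :
  ciso (ccast e (csqcup (cunit a) (FT b))) (rqn N (ftn a N)).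
Proof.
case: N / e => /=; rewrite FT_rqn.
have -> : ftn a (a + b) = [seq (a + i)%N | i <- ftn 0 b].
  rewrite /ftn map_flatten map_nseq subn0 addKn; congr (flatten (nseq _ _)).
  by rewrite map_rev -{1}[a]addn0 iotaDl.
apply: csqcup_rqn; apply/allP => i /flattenP[s /nseqP[-> _]].
by rewrite mem_rev mem_iota subn0 => /andP[_].
Qed.

Section NatScope.
Local Open Scope nat_scope.

(** * Full twists in the braid monoid *)

Lemma beq_catr u v t : beq u v -> beq (u ++ t) (v ++ t).
Proof. by move=> uv; apply: beq_cat => //; exact: beq_refl. Qed.

Lemma beq_catl u v t : beq u v -> beq (t ++ u) (t ++ v).
Proof. by move=> uv; apply: beq_cat => //; exact: beq_refl. Qed.

Lemma beq_rev u v : beq u v -> beq (rev u) (rev v).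
Proof.
elim=> {u v} [w|u v _ h|u v w _ h _ h'|u u' v v' _ h _ h'|i j ij|i].
- exact: beq_refl.
- exact: beq_sym.
- exact: beq_trans h'.
- by rewrite !rev_cat; exact: beq_cat.
- exact/beq_sym/beq_far.
- exact: beq_braid.
Qed.

Lemma beq_comm i w : all (fun j => (j.+1 < i) || (i.+1 < j)) w ->
  beq (i :: w) (rcons w i).
Proof.
elim: w => [_|j w IH /= /andP[ij /IH h]]; first exact: beq_refl.
apply: (@beq_trans _ ([:: j] ++ (i :: w))); last exact: (beq_catl [:: j] h).
apply: (beq_catr (u := [:: i; j]) (v := [:: j; i])).
by case/orP: ij => ij; [apply: beq_sym|]; exact: beq_far.
Qed.

(* the words l, l+1, ..., n-1 and n-1, ..., l+1, l *)
Definition up l n := iota l (n - l).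
Definition dn l n := rev (up l n).

Lemma mem_up l n i : (i \in up l n) = (l <= i < n).
Proof. by rewrite mem_iota; apply/idP/idP; lia. Qed.

Lemma mem_dn l n i : (i \in dn l n) = (l <= i < n).
Proof. by rewrite mem_rev mem_up. Qed.

Lemma up_cat l j n : l <= j <= n -> up l n = up l j ++ up j n.
Proof.
move=> h; rewrite /up (_ : n - l = (j - l) + (n - j)); last by lia.
by rewrite iotaD subnKC //; case/andP: h.
Qed.

Lemma dn_cat l j n : l <= j <= n -> dn l n = dn j n ++ dn l j.
Proof. by move=> h; rewrite /dn (up_cat h) rev_cat. Qed.

Lemma dn_last l n : l < n -> dn l n = dn l.+1 n ++ [:: l].
Proof.
by move=> ln; rewrite (@dn_cat l l.+1 n) ?leqnSn //; congr (_ ++ _); rewrite /dn /up subSnn.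
Qed.

Lemma dn_first l n : l <= n -> dn l n.+1 = n :: dn l n.
Proof.
by move=> ln; rewrite (@dn_cat l n n.+1) ?leqnSn ?ln // {1}/dn /up subSnn.
Qed.

(** The letter i commutes with the letters above i + 1, meets i + 1, i in one braid move that turns
    it into i + 1, and then commutes with the letters below i. *)
Lemma beq_dn a b i : a <= i -> i.+1 < b -> beq (i :: dn a b) (rcons (dn a b) i.+1).
Proof.
move=> ai ib; rewrite (@dn_cat a i.+2 b) ?(@dn_cat a i i.+2); try lia.
rewrite -cats1 -!catA -cat1s.
have -> : dn i i.+2 = [:: i.+1; i] by rewrite /dn /up -addn2 addKn.
have h1 : beq (i :: dn i.+2 b) (dn i.+2 b ++ [:: i]).
  by rewrite cats1; apply: beq_comm; apply/allP => j; rewrite mem_dn; lia.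
have h2 : beq (i.+1 :: dn a i) (dn a i ++ [:: i.+1]).
  by rewrite cats1; apply: beq_comm; apply/allP => j; rewrite mem_dn; lia.
rewrite catA; apply: (beq_trans (beq_catr _ h1)); rewrite -catA; apply: beq_catl.
apply: (beq_trans (beq_catr (dn a i) (beq_braid i))).
exact: (beq_catl [:: i.+1; i] h2).
Qed.

Lemma beq_dn_word a b w : all (fun i => (a <= i) && (i.+1 < b)) w ->
  beq (w ++ dn a b) (dn a b ++ [seq i.+1 | i <- w]).
Proof.
elim: w => [_|i w IH /= /andP[/andP[ai ib] /IH h]]; first by rewrite cats0; exact: beq_refl.
apply: (beq_trans (beq_catl [:: i] h)); rewrite /= -cat_rcons.
exact: (beq_catr _ (beq_dn ai ib)).
Qed.

Definition rep j (w : seq nat) := flatten (nseq j w).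

Lemma repS j w : rep j.+1 w = w ++ rep j w. Proof. by []. Qed.
Lemma repSr j w : rep j.+1 w = rep j w ++ w.
Proof. by elim: j => [|j IH]; [exact: cats0|rewrite repS {1}IH catA -repS]. Qed.
Lemma repD i j w : rep (i + j) w = rep i w ++ rep j w.
Proof. by rewrite /rep nseqD flatten_cat. Qed.

Lemma beq_rep_dn a b i j : a <= i -> i + j < b ->
  beq (i :: rep j (dn a b)) (rcons (rep j (dn a b)) (i + j)).
Proof.
elim: j i => [|j IH] i ai ib; first by rewrite addn0; exact: beq_refl.
rewrite repS -cat_cons.
apply: (beq_trans (beq_catr _ (beq_dn ai _))); first by lia.
rewrite cat_rcons rcons_cat -addSnnS; apply: beq_catl; apply: IH; lia.
Qed.

(* c x_{i+1} = x_i c for c = dn a b, hence c^2 maps the last letter to the first *)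
Lemma beq_dn2 a n : a <= n ->
  beq (n :: rep 2 (dn a n.+1)) (rcons (rep 2 (dn a n.+1)) a).
Proof.
move=> an; rewrite /rep /= cats0.
have h : beq (dn a n ++ dn a n.+1) (dn a n.+1 ++ dn a.+1 n.+1).
  have -> : dn a.+1 n.+1 = [seq i.+1 | i <- dn a n].
    by rewrite /dn /up subSS map_rev -add1n iotaDl.
  by apply: beq_dn_word; apply/allP => i; rewrite mem_dn; lia.
rewrite -cats1 -catA {3}(dn_first an) cat_cons; apply: (beq_catl [:: n]).
apply: beq_sym; rewrite catA; apply: (beq_trans (beq_catr _ h)).
by rewrite -catA -(dn_last (n := n.+1)) ?ltnS //; exact: beq_refl.
Qed.

(* the full twist on the strands l, ..., n *)
Definition ft l n := rep (n.+1 - l) (dn l n).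

(** On n + 1 strands the last strand is n; this is the index used by [ft]. *)
Lemma ftnE l n : ftn l n.+1 = ft l n.
Proof. by rewrite /ftn /ft /rep /dn /up; congr (flatten (nseq _ (rev (iota _ _)))); lia. Qed.

(** The full twist is a power of c = [dn l n], and passing one c raises a letter by one. The copies
    are divided so that the letter climbs to the top, is carried from the top to l by two copies
    ([beq_dn2]), and climbs back to i with the rest. *)
Lemma ft_comm l n i : l <= i < n -> beq (i :: ft l n) (rcons (ft l n) i).
Proof.
case: n => [|n] //; first lia.
move=> /andP[li iN]; rewrite /ft.
have -> : n.+2 - l = (n - i) + (2 + (i - l)) by lia.
rewrite !repD -cat_cons.
apply: (beq_trans (beq_catr _ (beq_rep_dn (j := n - i) li _))); first by lia.
have -> : i + (n - i) = n by lia.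
rewrite cat_rcons rcons_cat; apply: beq_catl.
rewrite -cat_cons; apply: (beq_trans (beq_catr _ (beq_dn2 _))); first by lia.
rewrite cat_rcons rcons_cat; apply: beq_catl.
apply: (beq_trans (beq_rep_dn (j := i - l) (leqnn l) _)); first by lia.
by rewrite subnKC //; exact: beq_refl.
Qed.

Lemma ft_comm_word l n w : all (fun i => l <= i < n) w ->
  beq (w ++ ft l n) (ft l n ++ w).
Proof.
elim: w => [_|i w IH /= /andP[li /IH h]]; first by rewrite cats0; exact: beq_refl.
apply: (beq_trans (beq_catl [:: i] h)); rewrite /= -cat_rcons -cat_cons.
exact: (beq_catr _ (ft_comm li)).
Qed.

(** Each factor ends in the letter l. Pushed through the j factors to its right, this letter becomes
    l + j; the released letters form an ascending word. *)
Lemma rep_dn_split l n j : l + j <= n ->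
  beq (rep j (dn l n)) (rep j (dn l.+1 n) ++ up l (l + j)).
Proof.
elim: j => [|j IH] h; first by rewrite /up addn0 subnn; exact: beq_refl.
rewrite repS {1}(@dn_last l n); last by lia.
rewrite -catA.
apply: (beq_trans (beq_catl _ (beq_rep_dn (leqnn l) _))); first by lia.
rewrite repS -catA; apply: beq_catl.
rewrite -cats1; apply: (beq_trans (beq_catr _ (IH _))); first by lia.
rewrite -catA (@up_cat l (l + j) (l + j.+1)); last by lia.
have -> : up (l + j) (l + j.+1) = [:: l + j] by rewrite /up addnS subSnn.
exact: beq_refl.
Qed.

(** Of the n + 1 - l factors, n - l are reduced by [rep_dn_split], and the last one is kept as
    [dn l n]. *)
Lemma ft_split l n : l <= n -> beq (ft l n) (ft l.+1 n ++ up l n ++ dn l n).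
Proof.
move=> ln; rewrite /ft subSS subSn // repSr catA; apply: beq_catr.
have := @rep_dn_split l n (n - l); rewrite subnKC //; exact.
Qed.
End NatScope.

Section NatScope.
Local Open Scope nat_scope.

(** * Sorting words *)

(** An exchange is described by splitting the list, its letter being the length of the prefix, which
    avoids index computations. The final sequence is recorded so that successive runs can be
    concatenated. *)
Inductive srt : seq nat -> seq nat -> seq nat -> Prop :=
| srt_nil s : srt [::] s s
| srt_cons p x y q w t : y < x -> srt w (p ++ y :: x :: q) t ->
    srt (size p :: w) (p ++ x :: y :: q) t.

Lemma srt_cat u v r s t : srt u r s -> srt v s t -> srt (u ++ v) r t.
Proof.
move=> h; elim: h v t => {u r s} [s|p x y q w s yx _ IH] v t st //=.
by apply: srt_cons => //; exact: IH.
Qed.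

Lemma srt_rcons w s t r : srt w s t -> srt w (s ++ r) (t ++ r).
Proof.
elim=> {w s t} [s|p x y q w t yx _]; first exact: srt_nil.
by rewrite -!catA /= => h; exact: srt_cons.
Qed.

Lemma srt_shift w s t x : srt w s t -> srt [seq i.+1 | i <- w] (x :: s) (x :: t).
Proof.
elim=> {w s t} [s|p y z q w t zy _]; first exact: srt_nil.
rewrite -cat_cons => h /=; rewrite -cat_cons.
exact: (@srt_cons (x :: p)).
Qed.

Lemma srt_perm w s t : srt w s t -> perm_eq s t.
Proof.
elim=> {w s t} [s|p x y q w t _ _ IH] //.
apply: perm_trans IH; rewrite perm_cat2l.
by rewrite -[x :: y :: q]/([:: x; y] ++ q) -[y :: x :: q]/([:: y;
  x] ++ q) perm_cat2r (perm_catC [:: x] [:: y]).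
Qed.

Lemma srt_size w s t : srt w s t -> all (fun i => i < (size s).-1) w.
Proof.
elim=> {w s t} [s|p x y q w t _ _ IH] //=; rewrite !size_cat /= in IH *.
by rewrite IH andbT; lia.
Qed.

Lemma srt_right p t1 q k : all (fun y => y < k) t1 ->
  srt (iota (size p) (size t1)) (p ++ k :: t1 ++ q) (p ++ t1 ++ k :: q).
Proof.
elim: t1 p => [|y t1 IH] p /=; first by move=> _; exact: srt_nil.
move=> /andP[yk tk]; apply: srt_cons => //.
by have := IH (rcons p y) tk; rewrite size_rcons !cat_rcons.
Qed.

Lemma srt_left t1 t2 x : all (fun y => x < y) t2 ->
  srt (rev (iota (size t1) (size t2))) (t1 ++ t2 ++ [:: x]) (t1 ++ x :: t2).
Proof.
elim: t2 t1 => [|y t2 IH] t1 /=; first by move=> _; exact: srt_nil.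
move=> /andP[xy xt]; rewrite rev_cons -cats1.
have h := IH (rcons t1 y) xt; rewrite size_rcons !cat_rcons in h.
by apply: (srt_cat h); apply: srt_cons => //; exact: srt_nil.
Qed.

Fixpoint inv (s : seq nat) : nat :=
  if s is x :: s' then count (fun y => y < x) s' + inv s' else 0.

Lemma inv_swap p x y q : y < x ->
  inv (p ++ x :: y :: q) = (inv (p ++ y :: x :: q)).+1.
Proof.
move=> yx; elim: p => [|z p IH] /=; first by rewrite yx [x < y]ltnNge ltnW //=; lia.
by rewrite IH !count_cat /=; lia.
Qed.

Lemma unsorted_descent (s : seq nat) : ~~ sorted leq s ->
  exists p x y q, s = p ++ x :: y :: q /\ y < x.
Proof.
elim: s => // x [|y s] IH //=.
rewrite negb_and -ltnNge; case: ltnP => [yx _|_ /= /IH].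
  by exists [::], x, y, s.
by move=> [p [x' [y' [q [-> h]]]]]; exists (x :: p), x', y', q.
Qed.

Lemma sorted_no_descent p x y q : y < x -> sorted leq (p ++ x :: y :: q) = false.
Proof.
move=> yx; rewrite (sorted_pairwise leq_trans) pairwise_cat /= (leqNgt x y) yx.
by rewrite !andbF.
Qed.

Lemma srt_exists s : exists w t, srt w s t /\ sorted leq t.
Proof.
have [k] := ubnP (inv s); elim: k s => // k IH s sk.
have [ss|/unsorted_descent[p [x [y [q [sE yx]]]]]] := boolP (sorted leq s).
  by exists [::], s; split=> //; exact: srt_nil.
have [|w [t [h st]]] := IH (p ++ y :: x :: q).
  by move: sk; rewrite sE inv_swap.
by exists (size p :: w), t; split=> //; rewrite sE; exact: srt_cons.
Qed.

Lemma srt_head i w s t : srt (i :: w) s t -> exists p x y q,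
  [/\ i = size p, s = p ++ x :: y :: q, y < x & srt w (p ++ y :: x :: q) t].
Proof.
move E: (i :: w) => v h; case: h E => // p x y q w' t' yx h [-> ->].
by exists p, x, y, q.
Qed.

Lemma cat_prefix (p p' r r' : seq nat) : p ++ r = p' ++ r' -> size p <= size p' ->
  exists z, p' = p ++ z /\ r = z ++ r'.
Proof.
move=> e h; exists (drop (size p) p').
have pE : take (size p) p' = p.
  have := congr1 (take (size p)) e; by rewrite take_size_cat // takel_cat // => <-.
rewrite -{1}(cat_take_drop (size p) p') pE; split=> //.
have := congr1 (drop (size p)) e; rewrite drop_size_cat // => ->.
by rewrite -{1}(cat_take_drop (size p) p') pE -catA drop_size_cat.
Qed.

(* Matsumoto's theorem for the words that sort a given sequence, by the usual
   diamond argument on the first letters *)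
Lemma srt_uniq s w w' t t' : srt w s t -> srt w' s t' ->
  sorted leq t -> sorted leq t' -> beq w w'.
Proof.
have [k] := ubnP (inv s); elim: k s w w' t t' => // k IH s w w' t t' sk.
case: w => [|i w]; case: w' => [|j w'] h h' st st'.
- exact: beq_refl.
- have [p [x [y [q [_ sE yx _]]]]] := srt_head h'.
  move E : [::] h => v h; case: h E sE st => // r _ -> ; first by rewrite sorted_no_descent.
- have [p [x [y [q [_ sE yx _]]]]] := srt_head h.
  move E : [::] h' => v h'; case: h' E sE st' => // r _ ->; first by rewrite sorted_no_descent.
wlog ij : i j w w' t t' h h' st st' / i <= j.
  move=> W; case: (leqP i j) => [ij|/ltnW ij]; first exact: (W i j w w' t t').
  by apply: beq_sym; apply: (W j i w' w t' t).
have [p [x [y [q [iE sE yx hw]]]]] := srt_head h.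
have [p' [x' [y' [q' [jE sE' yx' hw']]]]] := srt_head h'.
have K1 : inv (p ++ y :: x :: q) < k by move: sk; rewrite sE inv_swap.
have K2 : inv (p' ++ y' :: x' :: q') < k by move: sk; rewrite sE' inv_swap.
have [z [pE zE]] : exists z, p' = p ++ z /\ x :: y :: q = z ++ x' :: y' :: q'.
  by apply: cat_prefix; [rewrite -sE -sE'|rewrite -iE -jE].
(* The prefix p' of the second descent extends p by z. With z empty the two first letters agree,
   with one entry they are adjacent, and otherwise they are far apart. *)
case: z pE zE => [|a [|b z]].
- rewrite cats0 => pE [xE yE qE]; rewrite iE jE pE; apply: (beq_catl [:: _]).
  by apply: (IH _ _ _ _ _ K1 hw _ st st'); rewrite xE yE qE -pE.
- rewrite cats1 => pE [ax yx'E qE]; subst a x' q.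
  have jE' : j = i.+1 by rewrite jE pE size_rcons iE.
  (* The entries x > y > y' are reversed by i, i+1, i as well as by i+1, i, i+1. With v sorting the
     result, the induction hypothesis compares w with i+1, i, v and w' with i, i+1, v. *)
  have [v [r [hv sr]]] := srt_exists (p ++ [:: y', y, x & q']).
  have H1 : srt (i.+1 :: i :: v) (p ++ [:: y, x, y' & q']) r.
    have := @srt_cons (rcons p y) x y' q' (i :: v) r.
    rewrite size_rcons -iE !cat_rcons; apply; first exact: ltn_trans yx' yx.
    by rewrite iE; apply: srt_cons.
  have H2 : srt (i :: i.+1 :: v) (p' ++ [:: y', y & q']) r.
    rewrite pE cat_rcons iE; apply: srt_cons; first exact: ltn_trans yx' yx.
    have := @srt_cons (rcons p y') x y q' v r.
    by rewrite size_rcons !cat_rcons; apply.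
  apply: (@beq_trans _ ([:: i; i.+1; i] ++ v)).
    exact: (beq_catl [:: i] (IH _ _ _ _ _ K1 hw H1 st sr)).
  apply: (@beq_trans _ ([:: i.+1; i; i.+1] ++ v)).
    exact: beq_catr (beq_braid i).
  rewrite jE' -[_ ++ v]/([:: i.+1] ++ (i :: i.+1 :: v)); apply: (beq_catl [:: i.+1]).
  exact: (IH _ _ _ _ _ K2 H2 hw' sr st').
- move=> pE [xE yE qE]; subst a b q.
  have ij' : i.+1 < j by rewrite jE pE size_cat /= iE; lia.
  have [v [r [hv sr]]] := srt_exists (p ++ y :: x :: z ++ y' :: x' :: q').
  have H1 : srt (j :: v) (p ++ y :: x :: z ++ x' :: y' :: q') r.
    have := @srt_cons (p ++ y :: x :: z) x' y' q' v r yx'.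
    rewrite -!catA /= => W; have -> : j = size (p ++ y :: x :: z).
      by rewrite jE pE !size_cat.
    exact: W.
  have H2 : srt (i :: v) (p' ++ y' :: x' :: q') r.
    by rewrite pE -catA /= iE; exact: srt_cons.
  apply: (@beq_trans _ ([:: i; j] ++ v)).
    exact: (beq_catl [:: i] (IH _ _ _ _ _ K1 hw H1 st sr)).
  apply: (@beq_trans _ ([:: j; i] ++ v)); first exact: beq_catr (beq_far ij').
  exact: (beq_catl [:: j] (IH _ _ _ _ _ K2 H2 hw' sr st')).
Qed.

Lemma sorted_split (k : nat) (t : seq nat) : sorted leq t ->
  t = [seq x <- t | x < k] ++ [seq x <- t | k <= x].
Proof.
elim: t => // x t IH /= xt; have st := path_sorted xt.
have xA : all (leq x) t by exact: (order_path_min leq_trans).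
case: (ltnP x k) => xk /=; first by rewrite -IH.
have -> : [seq y <- t | y < k] = [::].
  apply/eqP; rewrite -[_ == _]negbK -has_filter; apply/hasPn => y yt.
  by rewrite -leqNgt; apply: leq_trans xk _; exact: (allP xA).
rewrite /=; congr (_ :: _); apply/esym/all_filterP/allP => y yt.
by apply: leq_trans xk _; exact: (allP xA).
Qed.

(* First sort s by u, then move k to the right over the L smaller entries,
   respectively k - 1 to the left over the other ones. *)
Lemma srt_insert s k w w' t t' : 0 < k ->
  srt w (k :: s) t -> sorted leq t ->
  srt w' (rcons s k.-1) t' -> sorted leq t' ->
  exists u, let L := count (fun x => x < k) s in
  [/\ all (fun i => i < (size s).-1) u,
      beq w ([seq i.+1 | i <- u] ++ up 0 L) & beq w' (u ++ dn L (size s))].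
Proof.
move=> k0 hw st hw' st'; have [u [r [hu sr]]] := srt_exists s.
have sE := srt_perm hu.
have rE := sorted_split k sr; set r1 := [seq x <- r | x < k] in rE.
set r2 := [seq x <- r | k <= x] in rE.
(* The entry k moves right past the entries smaller than k, and k - 1 moves left past the entries at
   least k. Both stop between r1 and r2, so the same L governs the two words. *)
have a1 : all (fun y => y < k) r1 by rewrite filter_all.
have a2 : all (fun y => k.-1 < y) r2.
  by apply: sub_all (filter_all _ _) => y; rewrite prednK.
have LE : size r1 = count (fun x => x < k) s.
  by rewrite size_filter; apply/esym; exact: (seq.permP sE).
have nE : size s = size r1 + size r2 by rewrite (perm_size sE) rE size_cat.
exists u; split; first exact: srt_size hu.
- have P : pairwise leq (r1 ++ r2) by rewrite -rE -(sorted_pairwise leq_trans).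
  apply: (srt_uniq hw (t' := r1 ++ k :: r2) _ st).
    apply: (srt_cat (s := k :: r)); first exact: srt_shift.
    rewrite /up subn0 -LE {1}rE -[r2 in X in srt _ X]cats0.
    have := @srt_right [::] r1 r2 k a1; by rewrite /= cats0.
  rewrite (sorted_pairwise leq_trans) pairwise_cat /=; move: P.
  rewrite pairwise_cat => /and3P[p12 -> ->]; rewrite andbT allrel_consr p12 andbT.
  apply/andP; split; first by apply: sub_all a1 => y /ltnW.
  by apply: sub_all a2 => y; rewrite prednK.
- have P : pairwise leq (r1 ++ r2) by rewrite -rE -(sorted_pairwise leq_trans).
  apply: (srt_uniq hw' (t' := r1 ++ k.-1 :: r2) _ st').
    rewrite -cats1; apply: (srt_cat (srt_rcons _ hu)).
    rewrite /dn /up nE -LE addKn {1}rE -catA.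
    exact: srt_left.
  rewrite (sorted_pairwise leq_trans) pairwise_cat /=; move: P.
  rewrite pairwise_cat => /and3P[p12 -> ->]; rewrite andbT allrel_consr p12 andbT.
  apply/andP; split; first by apply: sub_all a1 => y /= yk; lia.
  by rewrite /=; apply: sub_all a2 => y /ltnW.
Qed.
End NatScope.

Section NatScope.
Local Open Scope nat_scope.

Section SortsSrt.
Variables (m N : nat).
Implicit Types v : N.-tuple 'I_m.+1.

Definition vals v : seq nat := [seq val a | a <- v].

Lemma size_vals v : size (vals v) = N.
Proof. by rewrite size_map size_tuple. Qed.

Lemma nth_vals v (j : 'I_N) : nth 0 (vals v) j = tnth v j.
Proof.
rewrite (nth_map (tnth v j)) ?size_tuple //; congr val.
by rewrite [RHS](tnth_nth (tnth v j)).
Qed.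

Lemma vals_split v (i : 'I_N.-1) :
  vals v = take i (vals v) ++ [:: val (tnth v (lo i)), val (tnth v (hi i)) & drop i.+2 (vals v)].
Proof.
have iN : i.+1 < N by have := ltn_ord i; lia.
rewrite -{1}(cat_take_drop i (vals v)); congr (_ ++ _).
rewrite (drop_nth 0) ?size_vals; last by lia.
rewrite (drop_nth 0) ?size_vals //.
congr (_ :: _ :: _); [exact: (nth_vals v (lo i))|exact: (nth_vals v (hi i))].
Qed.

Lemma vals_swap v (i : 'I_N.-1) : vals [tuple tnth v (s_ i j) | j < N] =
  take i (vals v) ++ [:: val (tnth v (hi i)), val (tnth v (lo i)) & drop i.+2 (vals v)].
Proof.
set v' := [tuple _ | _ < _].
have tE j : tnth v' j = tnth v (s_ i j) by rewrite tnth_mktuple.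
rewrite (vals_split v' i) !tE /s_ tpermL tpermR.
have E (j : nat) : j < N -> j != i -> j != i.+1 -> nth 0 (vals v') j = nth 0 (vals v) j.
  move=> jN ji ji1; rewrite (nth_vals v' (Ordinal jN)) tE (nth_vals v (Ordinal jN)).
  by rewrite /s_ tpermD // -val_eqE /= eq_sym.
have iN : i.+1 < N by have := ltn_ord i; lia.
congr (_ ++ _ :: _ :: _); apply: (@eq_from_nth _ 0).
- by rewrite !size_take !size_vals.
- move=> j; rewrite size_take size_vals => h.
  have ji : j < i by move: h; case: ifP; lia.
  by rewrite !nth_take // E //; lia.
- by rewrite !size_drop !size_vals.
- by move=> j; rewrite size_drop size_vals => h; rewrite !nth_drop E //; lia.
Qed.

Lemma sorts_srt v (w : seq 'I_N.-1) : sorts w v ->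
  exists t, srt [seq val i | i <- w] (vals v) t /\ sorted leq t.
Proof.
elim: w v => [|i w IH] v /=; first by exists (vals v); split=> //; exact: srt_nil.
move=> [yx /IH[t [h st]]]; exists t; split=> //.
have sE : size (take i (vals v)) = i.
  by rewrite size_takel // size_vals; have := ltn_ord i; lia.
rewrite vals_swap in h; rewrite (vals_split v i) -{1}sE.
exact: srt_cons.
Qed.

Lemma lowE v j : low v j = count (fun x => x < j) (vals v).
Proof.
rewrite /vals count_map -sum1_count big_tuple /low.
rewrite (partition_big (tnth v) (fun i : 'I_m.+1 => i < j)) //=.
apply: eq_bigr => i ij; rewrite /mult -sum1dep_card; apply: eq_bigl => l.
by case: eqP => [->|_]; rewrite ?ij ?andbF.
Qed.
End SortsSrt.

(** * The two braid identities to the left and to the right of K *)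

Section Conjugation.
Variables (n L : nat) (u w w' : seq nat).
Hypotheses (Ln : L <= n) (un : all (fun i => i < n.-1) u).
Hypotheses (wE : beq w ([seq i.+1 | i <- u] ++ up 0 L)) (wE' : beq w' (u ++ dn L n)).

Lemma beq_cox_word (x : seq nat) : all (fun i => i < n.-1) x ->
  beq (x ++ dn 0 n) (dn 0 n ++ [seq i.+1 | i <- x]).
Proof.
move=> xn; apply: beq_dn_word; apply: sub_all xn => i /= h; lia.
Qed.

Lemma beq_left : beq (dn 0 n ++ w) (w' ++ (dn 0 L ++ up 0 L)).
Proof.
apply: (beq_trans (beq_catl _ wE)); rewrite catA.
apply: (beq_trans (beq_catr _ (beq_sym (beq_cox_word un)))).
rewrite (dn_cat (j := L)) //; apply: beq_sym.
by apply: (beq_trans (beq_catr _ wE')); rewrite -!catA; exact: beq_refl.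
Qed.

(** Splitting [ft L n] releases [up L n ++ dn L n]. The twists in s start at strands l <= L, so they
    commute with these letters, which travel to the right and combine with [rev w]. The twists in A
    stay in place. *)
Lemma beq_right A (s : seq nat) : all (fun l => l <= L) s ->
  beq ((A ++ ft L n ++ flatten [seq ft l n | l <- s]) ++ rev w)
      ((A ++ ft L.+1 n ++ flatten [seq ft l n | l <- s]) ++ rev w' ++ dn 0 n).
Proof.
move=> sL; set B := flatten _; rewrite -!catA; apply: beq_catl.
have comm x : all (fun i => L <= i < n) x -> beq (x ++ B) (B ++ x).
  move=> xL; rewrite /B; elim: s sL {B} => [_|l s IH /= /andP[lL /IH h]].
    by rewrite cats0; exact: beq_refl.
  rewrite catA; apply: (beq_trans (beq_catr _ (ft_comm_word _))).
    apply: sub_all xL => i; lia.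
  by rewrite -!catA; exact: beq_catl.
have udL : all (fun i => L <= i < n) (up L n ++ dn L n).
  rewrite all_cat; apply/andP; split; apply/allP => i; rewrite ?mem_up ?mem_dn //.
apply: (beq_trans (beq_catr _ (ft_split Ln))); rewrite -[(_ ++ _) ++ _]catA.
apply: beq_catl; rewrite catA; apply: (beq_trans (beq_catr _ (comm _ udL))).
rewrite -catA; apply: beq_catl.
have h := beq_rev wE; rewrite rev_cat in h.
have h' := beq_rev wE'; rewrite rev_cat /dn revK in h'.
apply: (beq_trans (beq_catl _ h)).
apply: beq_sym; apply: (beq_trans (beq_catr _ h')).
rewrite -!catA; apply: beq_catl.
have ru : all (fun i => i < n.-1) (rev u) by rewrite all_rev.
apply: (beq_trans (beq_cox_word ru)).
by rewrite (dn_cat (j := L)) // -catA map_rev; exact: beq_refl.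
Qed.
End Conjugation.
End NatScope.

(** * Both sides in normal form *)

(** The second index is determined by the first, and equality proofs on natural numbers are unique,
    so the cast does not matter. *)
Lemma ccast_box (N : nat) (F : forall a b, cpx (a + b)) a b a' b'
  (e : (a + b)%N = N) (e' : (a' + b')%N = N) : a = a' ->
  ccast e (F a b) = ccast e' (F a' b').
Proof.
move=> aa; subst a'; have bb : b = b' by lia.
by subst b'; rewrite (eq_irrelevance e e').
Qed.

Section Normalize.
Variables (m N : nat) (Q : forall j, cpx j).
Implicit Types v : N.-tuple 'I_m.+1.

Definition Kbox v : cpx N := ccast (low_high v m) (csqcup (Kn Q (low v m)) (FT (high v m))).

Definition fts v := flatten [seq ftn (low v j) N | j <- rev (iota 1 m.-1)].

Lemma Cv_heq v (w : seq 'I_N.-1) : heq (Cv Q v w)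
  (ctens (rqn N [seq val i | i <- w])
    (ctens (Kbox v) (rqn N (fts v ++ rev [seq val i | i <- w])))).
Proof.
rewrite /Cv rouquier_rqn /=; apply/ctens_heqr/ctens_heqr/ciso_heq.
rewrite /fts; elim: (rev (iota 1 m.-1)) => [|j s IH] /=.
  by rewrite rouquier_rqn map_rev; exact: ctens_unitr.
rewrite -catA; apply: (ciso_trans _ (ciso_sym (rqn_cat _ _ _))).
apply: (ciso_trans (ob_ciso (bifun_left (ctens_bifun N) _) (FT_box (low_high v j)))).
exact: (ob_ciso (bifun_right (ctens_bifun N) _) IH).
Qed.
End Normalize.

Lemma dn_lt n l : all (fun i => i < n)%N (dn l n).
Proof. by apply/allP => i; rewrite mem_dn => /andP[]. Qed.

Section Assembly.
Variables (N L : nat) (K : cpx N) (c w w' x x' : seq nat).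
Hypotheses (kK : kills L K) (LN : (L <= N.-1)%N).
Hypotheses (cN : all (fun i => i < N.-1)%N c) (wN : all (fun i => i < N.-1)%N w)
  (xN : all (fun i => i < N.-1)%N x).
Hypotheses (h1 : beq (c ++ w) (w' ++ (dn 0 L ++ up 0 L)))
  (h2 : beq x (x' ++ c)).

Lemma conjugation_heq (s t : int) :
  heq (ctens (csh s t (rqn N c)) (ctens (rqn N w) (ctens K (rqn N x))))
    (tsh L%:Z (ctens (ctens (rqn N w') (ctens K (rqn N x'))) (csh s t (rqn N c)))).
Proof.
set Y := ctens (rqn N w') (ctens K (rqn N x)).
apply: (@heq_trans _ (csh s t (tsh L Y))).
  apply: (heq_trans (ciso_heq (ctens_cshl _ _ _ _))); apply: csh_heq.
  apply: (heq_trans (ciso_heq (ciso_sym (ctens_assoc _ _ _)))).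
  apply: (heq_trans (ctens_heql _ (ciso_heq (ciso_sym (rqn_cat _ _ _))))).
  have cw : all (fun i => i < N.-1)%N (c ++ w) by rewrite all_cat cN.
  apply: (heq_trans (ctens_heql _ ((beq_heq N h1).2 cw))).
  apply: (heq_trans (ctens_heql _ (ciso_heq (rqn_cat _ _ _)))).
  apply: (heq_trans (ciso_heq (ctens_assoc _ _ _))).
  apply: (heq_trans _ (ciso_heq (ctens_cshr _ _ _ _))); apply: ctens_heqr.
  apply: (heq_trans (ciso_heq (ciso_sym (ctens_assoc _ _ _)))).
  apply: (heq_trans _ (ciso_heq (ctens_cshl _ _ _ _))); apply: ctens_heql.
  have ul : all (fun i => i < L)%N (dn 0 L ++ up 0 L).
    by rewrite all_cat dn_lt; apply/allP => i; rewrite mem_up.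
  apply: (heq_trans (rqn_absorb LN kK ul)).
  have -> : (size (dn 0 L ++ up 0 L))%:Z = 2 * L%:Z.
    by rewrite size_cat size_rev size_iota subn0; lia.
  exact: heq_refl.
apply: (@heq_trans _ (tsh L (csh s t Y))).
  apply: (heq_trans (ciso_heq (csh_csh _ _ _ _ _))).
  rewrite addrC [t + _]addrC; exact: (ciso_heq (ciso_sym (csh_csh _ _ _ _ _))).
apply: csh_heq; apply: heq_sym.
apply: (heq_trans (ciso_heq (ctens_cshr _ _ _ _))); apply: csh_heq.
apply: (heq_trans (ciso_heq (ctens_assoc _ _ _))); apply: ctens_heqr.
apply: (heq_trans (ciso_heq (ctens_assoc _ _ _))); apply: ctens_heqr.
apply: (heq_trans (ciso_heq (ciso_sym (rqn_cat _ _ _)))).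
exact: heq_sym ((beq_heq N h2).2 xN).
Qed.
End Assembly.

Section Main.
Variables (m n : nat) (Q : forall j, cpx j)
  (hK : forall a, kills a.-1 (Kn Q a))
  (v : n.-tuple 'I_m.+1) (k : nat) (hk : (1 <= k <= m - 1)%N)
  (w w' : seq 'I_(n.+1).-1)
  (hw : sorts w [tuple of (inord k : 'I_m.+1) :: v])
  (hw' : sorts w' [tuple of rcons v (inord k.-1 : 'I_m.+1)]).
Let kv := [tuple of (inord k : 'I_m.+1) :: v].
Let vk := [tuple of rcons v (inord k.-1 : 'I_m.+1)].
Let L := count (fun x => x < k)%N (vals v).

Let kvE : vals kv = k :: vals v.
Proof. by rewrite /vals /= inordK //; lia. Qed.
Let vkE : vals vk = rcons (vals v) k.-1.
Proof. by rewrite /vals /= map_rcons /= inordK //; lia. Qed.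

Let low_kv j : low kv j = ((k < j) + count (fun x => x < j) (vals v))%N.
Proof. by rewrite lowE kvE. Qed.
Let low_vk j : low vk j = ((k <= j) + count (fun x => x < j) (vals v))%N.
Proof. by rewrite lowE vkE -cats1 count_cat /= addn0 addnC prednK //; lia. Qed.

(** Prepending k raises the count of smaller entries for j > k, and appending k - 1 raises it for j
    >= k; these conditions differ only at j = k. *)
Let low_kv_vk j : j != k -> low kv j = low vk j.
Proof. by move=> jk; rewrite low_kv low_vk (leq_eqVlt k) [k == j]eq_sym (negPf jk). Qed.

Let iota_split : rev (iota 1 m.-1) =
  rev (iota k.+1 (m.-1 - k)) ++ k :: rev (iota 1 k.-1).
Proof.
have -> : m.-1 = (k.-1 + (m.-1 - k).+1)%N by lia.
rewrite iotaD rev_cat /= rev_cons -cats1 -catA /=.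
have -> : (k.-1 + (m.-1 - k).+1 - k = m.-1 - k)%N by lia.
by have -> : (1 + k.-1 = k)%N by lia.
Qed.

Lemma conjugation_heq_Cv :
  heq (ctens (Xn n.+1) (Cv Q kv w))
      (tsh (count (fun a : 'I_m.+1 => (a < k)%N) v)%:Z
         (ctens (Cv Q vk w') (Xn n.+1))).
Proof.
have [t [st tS]] := sorts_srt hw; have [t' [st' tS']] := sorts_srt hw'.
rewrite kvE in st; rewrite vkE in st'.
have k0 : (0 < k)%N by lia.
have [u [/= un wE wE']] := srt_insert k0 st tS st' tS'.
rewrite size_vals in un wE'.
have Ln : (L <= n)%N by rewrite -{1}(size_vals v) count_size.
rewrite -(count_map val (fun x => x < k)%N v) -/(vals v) -/L.
have lowm : low vk m = low kv m by rewrite low_kv_vk //; lia.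
have KE : Kbox Q vk = Kbox Q kv.
  exact: (@ccast_box n.+1 (fun a b => csqcup (Kn Q a) (FT b)) _ _ _ _ _ _ lowm).
rewrite /Xn rouquier_cox.
have -> : coxn n.+1 = dn 0 n by rewrite /coxn /dn /up subn0.
apply: (heq_trans (ctens_heqr _ (Cv_heq _ _ _))).
apply: heq_sym; apply: (heq_trans (csh_heq _ _ (ctens_heql _ (Cv_heq _ _ _)))).
apply: heq_sym; rewrite KE.
have all_rev_val (r : seq 'I_n) : all (fun i => i < n)%N [seq val i | i <- r].
  by apply/allP => _ /mapP[i _ ->]; exact: ltn_ord.
have w_all : all (fun i => i < n)%N (rev [seq val i | i <- w]).
  by rewrite -map_rev; exact: all_rev_val.
(* The prepended entry k is itself below m, which makes the inequality strict: K has at least L + 1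
   strands and absorbs the letters 0, ..., L - 1. *)
have L_low : (L < low kv m)%N.
  rewrite low_kv; have -> : (k < m)%N by lia.
  rewrite add1n ltnS; apply: sub_count => y /= yk; lia.
have ftsE v' : fts (v' : (n.+1).-tuple 'I_m.+1) = flatten [seq ft (low v' j) n | j <- rev (iota
  1 m.-1)].
  by rewrite /fts; congr flatten; apply: eq_map => j; exact: ftnE.
apply: conjugation_heq => //.
- apply: kills_box; last by move=> i iL; apply: hK; lia.
  by lia.
- exact: dn_lt.
- rewrite all_cat w_all andbT ftsE; apply/allP => i /flattenP[r /mapP[j _ ->]].
  by move=> /flattenP[q /nseqP[-> _]]; rewrite mem_dn => /andP[].
- exact: beq_left Ln un wE wE'.
(* The twists are listed by decreasing j. Those with j > k form A; those with j < k come after the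
   exceptional one and start at [low kv j] <= L. *)
pose s := [seq low kv j | j <- rev (iota 1 k.-1)].
pose A := flatten [seq ft (low kv j) n | j <- rev (iota k.+1 (m.-1 - k))].
have E1 : fts kv = A ++ ft L n ++ flatten [seq ft l n | l <- s].
  rewrite ftsE iota_split map_cat flatten_cat /= -map_comp low_kv ltnn.
  by [].
have E2 : fts vk = A ++ ft L.+1 n ++ flatten [seq ft l n | l <- s].
  rewrite ftsE iota_split map_cat flatten_cat /= -map_comp low_vk leqnn add1n.
  congr (flatten _ ++ (_ ++ flatten _)); apply/eq_in_map => j.
    by rewrite mem_rev mem_iota => /andP[jk _] /=; rewrite low_kv_vk //; lia.
  by rewrite mem_rev mem_iota => /andP[_ jk] /=; rewrite low_kv_vk //; lia.
rewrite E1 E2 -[X in beq _ X]catA; apply: (beq_right Ln un wE wE').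
apply/allP => _ /mapP[j + ->]; rewrite mem_rev mem_iota => /andP[_ jk].
rewrite low_kv; have -> : (k < j)%N = false by lia.
by apply: sub_count => y /= yj; lia.
Qed.
End Main.

(** * Soergel bimodules *)

Lemma sext_giso n (A W B : cpx n) (i : A -> W) r (p : W -> B) s :
  sext i r p s -> giso W (gsum A B).
Proof.
move=> E; have iH := chmap_hom (sext_i E); have pH := chmap_hom (sext_p E).
have rH := chom_g (sext_r E); have sH := chom_g (sext_s E).
have pi x : p (i x) = 0.
  have h := congr1 p (sext_sum E (i x)); rewrite (ghomD pH) (sext_ps E) (sext_ri E) in h.
  by apply: (addIr (p (i x))); rewrite add0r.
have rs x : r (s x) = 0.
  have h := congr1 r (sext_sum E (s x)); rewrite (ghomD rH) (sext_ri E) (sext_ps E) in h.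
  by apply: (addIr (r (s x))); rewrite add0r.
exists (fun w => (r w, p w) : gsum A B), (fun x : gsum A B => i x.1 + s x.2); split.
- split=> [x y|f x|f x|d x].
  + by rewrite (ghomD rH) (ghomD pH).
  + by rewrite (ghom_l rH) (ghom_l pH).
  + by rewrite (ghom_r rH) (ghom_r pH).
  + by rewrite (ghom_prt rH) (ghom_prt pH).
- split=> [x y|f x|f x|d x] /=.
  + by rewrite (ghomD iH) (ghomD sH) addrACA.
  + by rewrite (ghom_l iH) (ghom_l sH) lactDr.
  + by rewrite (ghom_r iH) (ghom_r sH) ractDr.
  + by rewrite (ghom_prt iH) (ghom_prt sH) prtD.
- by move=> x /=; rewrite (sext_sum E).
- move=> [x y] /=; rewrite (ghomD rH) (ghomD pH) (sext_ri E) (sext_ps E) pi rs.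
  by rewrite addr0 add0r.
Qed.

Section GbimodFunctor.
Variables (j n : nat) (F : dgfun j n).

(** A bimodule is viewed as a complex in degree 0, so that the facts about functors on complexes
    carry over to bimodules. *)
Definition gob (M : gbimod j) : gbimod n := F (conc M).

Lemma gob_giso M N : giso M N -> giso (gob M) (gob N).
Proof. by move=> MN; apply/ciso_giso/ob_ciso/giso_conc. Qed.

Lemma gob_sum M N : giso (gob (gsum M N)) (gsum (gob M) (gob N)).
Proof. exact: (sext_giso (ob_sext F (gsum_sext M N))). Qed.

Lemma gob_shift a M : giso (gob (gshift a M)) (gshift a (gob M)).
Proof.
apply: (ciso_giso (C := F (conc (gshift a M))) (D := csh a 0 (F (conc M)))).
exact: (ciso_trans (ob_ciso F (conc_gshift a M)) (mp_sh F a 0 (conc M))).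
Qed.
End GbimodFunctor.

Section SBimInduction.
Variable n : nat.

Lemma gsum_gzero (M : gbimod n) : giso M (gsum M (gzero n)).
Proof.
exists (fun x => (x, 0) : gsum M (gzero n)), fst; split=> //.
- split=> [x y|f x|f x|d x].
  + by rewrite [RHS]pair_add addr0.
  + by [].
  + by [].
  + by [].
- by move=> [x y]; congr (_, _); exact: zero_eq.
Qed.

Lemma gsumC (M N : gbimod n) : giso (gsum M N) (gsum N M).
Proof.
by exists (fun x : gsum M N => (x.2, x.1) : gsum N M), (fun x : gsum N M => (x.2, x.1) : gsum M N);
  split=> //; move=> [].
Qed.

Lemma SBim_giso (M N : gbimod n) : giso M N -> SBim M -> SBim N.
Proof.
move=> MN SM; apply: (SBim_summand SM (M' := gzero n)).
exact: giso_trans MN (gsum_gzero N).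
Qed.

Lemma SBim_gzero : SBim (gzero n).
Proof.
apply: (SBim_summand (M' := gunit n) (SBim_R n)).
exact: giso_trans (gsum_gzero _) (gsumC _ _).
Qed.

Lemma gtens_giso (M M' N : gbimod n) : giso M M' -> giso (gtens M N) (gtens M' N).
Proof. exact: (@gob_giso _ _ (bifun_left (ctens_bifun n) (conc N)) M M'). Qed.

Lemma gtens_sum (M M' N : gbimod n) :
  giso (gtens (gsum M M') N) (gsum (gtens M N) (gtens M' N)).
Proof. exact: (@gob_sum _ _ (bifun_left (ctens_bifun n) (conc N)) M M'). Qed.

Lemma gtens_shift a (M N : gbimod n) :
  giso (gtens (gshift a M) N) (gshift a (gtens M N)).
Proof. exact: (@gob_shift _ _ (bifun_left (ctens_bifun n) (conc N)) a M). Qed.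

Lemma gtens_assoc (M M' N : gbimod n) :
  giso (gtens (gtens M M') N) (gtens M (gtens M' N)).
Proof. exact: (ciso_giso (ctens_assoc (conc M) (conc M') (conc N))). Qed.

Lemma gtens_unitl (N : gbimod n) : giso (gtens (gunit n) N) N.
Proof. exact: (ciso_giso (ctens_unitl (conc N))). Qed.

Lemma gtens_unitr (N : gbimod n) : giso (gtens N (gunit n)) N.
Proof. exact: (ciso_giso (ctens_unitr (conc N))). Qed.

(* This form of induction avoids the interchange law for (x) and |_|. *)
Lemma SBim_left_ind (P : gbimod n -> Prop) :
  (forall M N, giso M N -> P M -> P N) ->
  P (gunit n) ->
  (forall i M, P M -> P (gtens (Bs i) M)) ->
  (forall M N, P M -> P N -> P (gsum M N)) ->
  (forall a M, P M -> P (gshift a M)) ->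
  (forall M N, P (gsum M N) -> P M) ->
  forall M, SBim M -> P M.
Proof.
move=> Pi PR PB Ps Psh Psm M SM.
(* The claim is strengthened by a right factor N: tensor products are then handled by associativity,
   and N = R gives back the claim. *)
suff H N : P N -> P (gtens M N) by apply: (Pi _ _ (gtens_unitr M)); exact: H.
elim: SM N => {M} [|i|M M' _ IH _ IH'|M M' _ IH _ IH'|a M _ IH|M M' K _ IH KE] N PN.
- exact: (Pi _ _ (giso_sym (gtens_unitl N))).
- exact: PB.
- by apply: (Pi _ _ (giso_sym (gtens_assoc _ _ _))); apply: IH; exact: IH'.
- by apply: (Pi _ _ (giso_sym (gtens_sum _ _ _))); apply: Ps; [exact: IH|exact: IH'].
- by apply: (Pi _ _ (giso_sym (gtens_shift _ _ _))); apply: Psh; exact: IH.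
- apply: (Psm _ (gtens M' N)); apply: (Pi _ _ (gtens_sum _ _ _)).
  by apply: (Pi _ _ (gtens_giso N KE)); exact: IH.
Qed.

End SBimInduction.

Lemma gob_SBim n k (F : dgfun n k) :
  SBim (gob F (gunit n)) ->
  (forall i M, SBim (gob F M) -> SBim (gob F (gtens (Bs i) M))) ->
  forall M, SBim M -> SBim (gob F M).
Proof.
move=> FR FB; apply: SBim_left_ind => //.
- by move=> M N MN; apply: SBim_giso; exact: gob_giso.
- move=> M N SM SN; apply: (SBim_giso (giso_sym (gob_sum F M N))); exact: SBim_sum.
- move=> a M SM; apply: (SBim_giso (giso_sym (gob_shift F a M))); exact: SBim_shift.
- move=> M N SMN; exact: (SBim_summand SMN (gob_sum F M N)).
Qed.

Lemma SBim_Fsigma n (i : 'I_n.-1) : SBim (Fsigma i).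
Proof. apply: SBim_sum; first exact: SBim_B. exact/SBim_shift/SBim_R. Qed.

Section SBimSqcup.
Variables k l : nat.

Lemma SBim_sqcup_unit (N : gbimod l) : SBim N -> SBim (gsqcup (gunit k) N).
Proof.
apply: (gob_SBim (F := bifun_right (csqcup_bifun k l) (cunit k))).
  exact: (SBim_giso (giso_sym (ciso_giso (csqcup_unit k l))) (SBim_R _)).
move=> i M SM; pose G := bifun_right (csqcup_bifun k l) (cunit k).
have jb : (k + i < (k + l).-1)%N by have := ltn_ord i; lia.
have E : s_ (Ordinal jb) = tperm (rshift k (lo i)) (rshift k (hi i)).
  by rewrite /s_; congr tperm; apply: val_inj; rewrite /= ?addnS.
(* [csqcup_cFr] compares the whole complexes F(sigma_i). Their total bimodule is B_i (+) R(1), so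
   the statement for B_i follows by passing to a direct summand. *)
have C1 : ciso (G (ctens (Fsigma i) (conc M))) (ctens (Fsigma (Ordinal jb)) (G (conc M))).
  apply: (ciso_trans (ob_ciso G (ciso_sym (cF_iso (lo_hi i) (erefl _) (conc M))))).
  apply: (ciso_trans (csqcup_cFr (lo_hi i) (gunit k) (conc M))).
  exact: (cF_iso _ E _).
have S1 : SBim (G (ctens (Fsigma i) (conc M))).
  apply: (SBim_giso (giso_sym (ciso_giso C1))).
  exact: (SBim_tens (SBim_Fsigma _) SM).
have S2 : SBim (gob G (gtens (Fsigma i) M)) := S1.
apply: (SBim_summand S2).
apply: giso_trans (gob_giso G (gtens_sum _ _ _)) (gob_sum G _ _).
Qed.

Lemma SBim_sqcup (M : gbimod k) (N : gbimod l) : SBim M -> SBim N -> SBim (gsqcup M N).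
Proof.
move=> SM SN; move: M SM; apply: (gob_SBim (F := bifun_left (csqcup_bifun k l) (conc N))).
  exact: SBim_sqcup_unit.
move=> i M SM; have iN : (i < (k + l).-1)%N by have := ltn_ord i; lia.
have ii : Ordinal iN = i :> nat by [].
apply: (SBim_giso (giso_sym (ciso_giso (Bs_sqcup ii (conc M) (conc N))))).
exact: (SBim_tens (SBim_B _) SM).
Qed.
End SBimSqcup.

(** * Bounded complexes of Soergel bimodules *)

Section Chains.
Variables (n : nat) (C : cpx n).

Definition chains (s : seq int) : gbimod n :=
  foldr (@gsum n) (gzero n) [seq chain C k | k <- s].

Lemma chain_proj_in k (x : C) : hpr k x \in chain_sub C k.
Proof. by apply/eqP; rewrite (gradK (hprP C)) eqxx. Qed.

Definition chain_proj k (x : C) : chain C k := Sub (hpr k x) (chain_proj_in k x).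

Lemma chain_proj_hom k : ghom (chain_proj k).
Proof.
have [hD hl hr hp] := hpr_hom C k.
by split=> [x y|f x|f x|d x]; apply: val_inj; rewrite /= ?hD ?hl ?hr ?hp.
Qed.

Lemma chain_val_hom k : ghom (val : chain C k -> C).
Proof. by split. Qed.

Fixpoint chains_to s : C -> chains s :=
  if s is k :: s' then fun x => (chain_proj k x, chains_to s' x) else fun _ => 0.

Fixpoint chains_fro s : chains s -> C :=
  if s is k :: s' then fun x => val x.1 + chains_fro x.2 else fun _ => 0.

Lemma chains_to_hom s : ghom (@chains_to s).
Proof.
elim: s => [|k s [hD hl hr hp]]; first by split=> [x y|f x|f x|d x]; exact: zero_eq.
have [gD gl gr gp] := chain_proj_hom k.
split=> [x y|f x|f x|d x].
- by rewrite [RHS]pair_add /= gD hD.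
- by rewrite /= /sum_lact /= gl hl.
- by rewrite /= /sum_ract /= gr hr.
- by rewrite /= /pair_gr /= gp hp.
Qed.

Lemma chains_fro_hom s : ghom (@chains_fro s).
Proof.
elim: s => [|k s [hD hl hr hp]] /=.
  by split=> [x y|f x|f x|d x]; rewrite ?addr0 ?lact0r ?ract0r ?(addmap0 (gradD (prtP C) _)).
have [gD gl gr gp] := chain_val_hom k.
split=> [x y|f x|f x|d x].
- rewrite -[LHS]/(val (x.1 + y.1) + chains_fro (x.2 + y.2)).
  by rewrite (gD x.1 y.1) hD addrACA.
- by rewrite -[LHS]/(val (lact f x.1) + chains_fro (lact f x.2)) (gl f x.1) hl lactDr.
- by rewrite -[LHS]/(val (ract f x.1) + chains_fro (ract f x.2)) (gr f x.1) hr ractDr.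
- by rewrite -[LHS]/(val (prt d x.1) + chains_fro (prt d x.2)) (gp d x.1) hp prtD.
Qed.

Lemma chains_toK s (x : C) : chains_fro (chains_to s x) = \sum_(k <- s) hpr k x.
Proof. by elim: s => [|k s IH]; rewrite ?big_nil ?big_cons //= IH. Qed.

Lemma hpr_chains_fro s k (y : chains s) : k \notin s -> hpr k (chains_fro y) = 0.
Proof.
elim: s y => [|j s IH] y; first by rewrite (addmap0 (@hprD _ _ _)).
rewrite inE negb_or => /andP[kj ks]; rewrite /= hprD IH // addr0.
by rewrite -(chainP y.1) (gradK (hprP C)) (negPf kj).
Qed.

Lemma chains_to0 s (x : C) : (forall k, k \in s -> hpr k x = 0) -> chains_to s x = 0.
Proof.
elim: s => // k s IH h; rewrite /= IH; last by move=> j js; rewrite h // inE js orbT.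
by congr (_, _); apply: val_inj; rewrite /= h ?mem_head.
Qed.

Lemma chains_froK s : uniq s -> cancel (@chains_fro s) (@chains_to s).
Proof.
elim: s => [|k s IH] /=; first by move=> _ y; exact: zero_eq.
move=> /andP[ks us] [y z] /=; congr (_, _).
  by apply: val_inj; rewrite /= hprD hpr_chains_fro // addr0 chainP.
rewrite (ghomD (chains_to_hom s)) IH // chains_to0 ?add0r // => j js.
rewrite -(chainP y) (gradK (hprP C)); case: eqP => // jk.
by rewrite jk (negPf ks) in js.
Qed.

Lemma chains_giso s : uniq s -> (forall k, k \notin s -> forall x : C, hpr k x = 0) ->
  giso C (chains s).
Proof.
move=> us hs; exists (chains_to s), (@chains_fro s).
split; [exact: chains_to_hom|exact: chains_fro_hom| |exact: chains_froK].
move=> x; rewrite chains_toK [RHS](gsuppE (hprP C)).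
have := @gfoldE _ _ (hprP C) C (fun _ y => y) (fun _ _ _ => erefl) s x us.
by rewrite /gfold => -> // k ks; exact: hs.
Qed.

(** The given k is put at the head of the list, so that [chain C k] appears as the first summand of
    the decomposition of C. *)
Lemma bounded_support k : bounded C -> exists s, [/\ uniq (k :: s) &
  forall j, j \notin k :: s -> forall x : C, hpr j x = 0].
Proof.
move=> [N h]; pose t : seq int := [seq i%:Z - N | i <- iota 0 (absz N).*2.+1].
exists [seq j <- undup t | j != k]; split.
  by rewrite cons_uniq mem_filter eqxx filter_uniq ?undup_uniq.
move=> j; rewrite inE mem_filter mem_undup negb_or negb_and negbK.
move=> /andP[jk /orP[/eqP jk'|jt]]; first by rewrite jk' eqxx in jk.
apply: h; rewrite ltNge; apply: contra jt => jN.
apply/mapP; exists (absz (j + N)); last by lia.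
by rewrite mem_iota; lia.
Qed.

(** The total bimodule of a bounded complex is a finite direct sum of its chain bimodules, and each
    of these is a summand of it. Being Soergel can thus be tested on the total bimodule, where the
    products of complexes are plain tensor products. *)
Lemma in_KbP : in_Kb C <-> bounded C /\ SBim C.
Proof.
split=> [[Cb Ck]|[Cb SC]]; split=> //; last move=> k.
  have [s [us hs]] := bounded_support 0 Cb.
  apply: (SBim_giso (giso_sym (chains_giso us hs))).
  elim: (0 :: s) => [|k r IH]; first exact: SBim_gzero.
  exact: SBim_sum.
have [s [us hs]] := bounded_support k Cb.
exact: (SBim_summand SC (chains_giso us hs)).
Qed.
End Chains.

Lemma in_Kb_csh n a b (C : cpx n) : in_Kb C -> in_Kb (csh a b C).
Proof.
move=> /in_KbP[[N h] SC]; apply/in_KbP; split; last exact: SBim_shift.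
by exists (N + `|b|) => k kN x; apply: (h (k + b)); lia.
Qed.

Lemma in_Kb_ctens n (C D : cpx n) : in_Kb C -> in_Kb D -> in_Kb (ctens C D).
Proof.
move=> /in_KbP[[N h] SC] /in_KbP[[N' h'] SD]; apply/in_KbP.
split; last exact: SBim_tens.
exists (`|N| + `|N'|) => k kN; apply: (pt_hom_ext (B := ctens_bifun n) (hprP C) (hprP D)).
- exact: hprD.
- by move=> *; rewrite addr0.
move=> e e' x y; rewrite [LHS](ct_hprE (C := C) (D := D)).
case: eqP => // kE; case: (ltP N `|e|) => eN.
  by rewrite h // (addmap0 (@ctmDl _ C D _)).
by rewrite h' ?(addmap0 (@ctmDr _ C D _)) //; lia.
Qed.

Lemma in_Kb_csqcup k l (C : cpx k) (D : cpx l) : in_Kb C -> in_Kb D -> in_Kb (csqcup C D).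
Proof.
move=> /in_KbP[[N h] SC] /in_KbP[[N' h'] SD]; apply/in_KbP.
split; last exact: SBim_sqcup.
exists (`|N| + `|N'|) => j jN; apply: (pt_hom_ext (B := csqcup_bifun k l) (hprP C) (hprP D)).
- exact: hprD.
- by move=> *; rewrite addr0.
move=> e e' x y; rewrite [LHS](cs_hprE (C := C) (D := D)).
case: eqP => // kE; case: (ltP N `|e|) => eN; first by rewrite h // csm0l.
by rewrite h' ?csm0r //; lia.
Qed.

Lemma in_Kb_cunit n : in_Kb (cunit n).
Proof.
apply/in_KbP; split; last exact: SBim_R.
by exists 0 => k k0 x /=; case: eqP => // kE; lia.
Qed.

Lemma in_Kb_Fsigma n (i : 'I_n.-1) : in_Kb (Fsigma i).
Proof.
apply/in_KbP; split; last exact: SBim_Fsigma.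
exists 1 => k k1 x /=; rewrite /tt_hpr.
by congr (_, _); rewrite /=; case: eqP => // kE; lia.
Qed.

Lemma in_Kb_map n (I : Type) (f : I -> cpx n) s : (forall i, in_Kb (f i)) ->
  in_Kb (cprod [seq f i | i <- s]).
Proof.
move=> h; elim: s => [|i s IH] /=; [exact: in_Kb_cunit|exact: in_Kb_ctens].
Qed.

Lemma in_Kb_rouquier n (w : seq 'I_n.-1) : in_Kb (rouquier w).
Proof. exact/in_Kb_map/in_Kb_Fsigma. Qed.

Lemma in_Kb_ccast a b (e : a = b) (C : cpx a) : in_Kb C -> in_Kb (ccast e C).
Proof. by case: b / e. Qed.

Lemma in_Kb_Kn (Q : forall j, cpx j) n : (forall j, in_Kb (Q j.+1)) -> in_Kb (Kn Q n).
Proof.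
move=> h; apply: in_Kb_map => j; apply: in_Kb_ccast.
apply: in_Kb_csqcup; [exact: h|exact: in_Kb_cunit].
Qed.

Lemma in_Kb_Cv m n (Q : forall j, cpx j) (v : n.-tuple 'I_m.+1) w :
  (forall j, in_Kb (Q j.+1)) -> in_Kb (Cv Q v w).
Proof.
move=> h; apply: in_Kb_ctens; first exact: in_Kb_rouquier.
apply: in_Kb_ctens.
  apply: in_Kb_ccast; apply: in_Kb_csqcup; [exact: in_Kb_Kn|exact: in_Kb_rouquier].
elim: (rev _) => [|j s IH] /=.
  by apply: in_Kb_ctens; [exact: in_Kb_rouquier|exact: in_Kb_cunit].
apply: in_Kb_ctens => //; apply: in_Kb_ccast.
by apply: in_Kb_csqcup; [exact: in_Kb_cunit|exact: in_Kb_rouquier].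
Qed.


Theorem proposition3p9 (m n : nat) (hm : (1 <= m)%N) (hn : (1 <= n)%N)
  (* the symmetrizers P_j *)
  (P : forall j : nat, cpx j)
  (hP : forall j : nat, (1 <= j)%N -> is_symmetrizer (P j))
  (* the generators u_j : q t^(1-j) P_j -> P_j *)
  (u : forall j : nat, qsh (tsh (1 - j%:Z) (P j)) -> P j)
  (uC : forall j : nat,
     is_chmap (C := qsh (tsh (1 - j%:Z) (P j))) (D := P j) (u j))
  (hu : forall j : nat, (1 <= j)%N ->
     is_generator (C := qsh (tsh (1 - j%:Z) (P j))) (D := P j) (u j))
  (* bounded representatives Q_j of t^(j-1) Cone(u_j) *)
  (Q : forall j : nat, cpx j)
  (hQ : forall j : nat, (1 <= j)%N ->
     in_Kb (Q j) /\ heq (Q j) (tsh (j%:Z - 1) (cone (uC j))))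
  (v : n.-tuple 'I_m.+1) (k : nat) (hk : (1 <= k <= m - 1)%N)
  (* words for gamma_(kv) and gamma_(v(k-1)) *)
  (w w' : seq 'I_(n.+1).-1)
  (hw : sorts w [tuple of (inord k : 'I_m.+1) :: v])
  (hw' : sorts w' [tuple of rcons v (inord k.-1 : 'I_m.+1)]) :
  Kb_equiv
    (ctens (Xn n.+1) (Cv Q [tuple of (inord k : 'I_m.+1) :: v] w))
    (tsh (count (fun a : 'I_m.+1 => (a < k)%N) v)%:Z
       (ctens (Cv Q [tuple of rcons v (inord k.-1 : 'I_m.+1)] w') (Xn n.+1))).
Proof.
have QK j : in_Kb (Q j.+1) by case: (hQ _ (ltn0Sn j)).
have XK : in_Kb (Xn n.+1) by apply: in_Kb_csh; exact: in_Kb_rouquier.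
split.
- by apply: in_Kb_ctens => //; exact: in_Kb_Cv.
- by apply: in_Kb_csh; apply: in_Kb_ctens => //; exact: in_Kb_Cv.
apply: conjugation_heq_Cv => // a.
by apply: (kills_Kn hP (uC := uC)) => j j1; case: (hQ _ j1).
Qed.
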